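(* Let $U,V\in\mathcal{L}_2(\mathbb{R}^m)$ be such that $Y:=(U,V)$ has a non-degenerate centered Gaussian distribution with $\Sigma_{uu}:=\mathbb{E}[UU^T]>0$, $\Sigma_{vv}:=\mathbb{E}[VV^T]>0$, $\Sigma_{uv}:=\mathbb{E}[UV^T]$, $\Sigma_{vu}:=\mathbb{E}[VU^T]=\Sigma_{uv}^T$, and let $S$ be the standard form on $\mathbb{R}^{2m}$. (a) The equation $A\Sigma_{uu}A+(A\Sigma_{uv}-\Sigma_{vu}A)=\Sigma_{vv}$ has a unique $m\times m$ matrix solution $A>0$. (b) The $Y$-equilibrium $(R,f)$ is unique and is given by $R:=(A+A^T)^{-1}(A^TU+V)$, $f(u):=Au$. The random variable $X:=(R,f(R))$ is the unique optimal map, $\mathrm{Law}(X,Y)$ is the unique optimal plan, and $\operatorname{graph}f$ is the unique optimal set of the dual problem. (c) The equation $\Lambda\Sigma_{uu}\Lambda=\Sigma_{vv}$ has the unique $m\times m$ positive-definite solution $\Lambda:=\Sigma_{uu}^{-1/2}(\Sigma_{uu}^{1/2}\Sigma_{vv}\Sigma_{uu}^{1/2})^{1/2}\Sigma_{uu}^{-1/2}$. The matrix $A$ from (a) is symmetric iff $\Lambda\Sigma_{uv}=\Sigma_{vu}\Lambda$, i.e. iff $\Lambda\Sigma_{uv}$ is symmetric; in this case $A=\Lambda$ and $R=\frac12(U+\Lambda^{-1}V)$.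
   Context: An $m\times m$ real matrix $A$, possibly non-symmetric, is positive-definite, written $A>0$, if $\langle r,Ar\rangle>0$ for every $r\ne0$. For symmetric $C>0$, $C^\alpha$ denotes its symmetric positive-definite power. Standard form on $\mathbb{R}^{2m}$: $S((r,s),(u,v)):=\langle s,u\rangle+\langle r,v\rangle$. $G$ is $S$-monotone if $S(x-y,x-y)\ge0$ for $x,y\in G$; maximal if not a strict subset of another $S$-monotone set; $\mathcal{M}(S)$ = family of maximal $S$-monotone sets; $\psi_G(y):=\sup_{x\in G}(S(x,y)-\frac12S(x,x))$. $\mathcal{X}(Y):=\{X\in\mathcal{L}_2(\mathbb{R}^{2m}):X\ Y\text{-measurable},\ \mathbb{E}[Y|X]=X\}$; optimal map: maximizer of $\frac12\mathbb{E}[S(X,Y)]$ over $\mathcal{X}(Y)$. With $\nu=\mathrm{Law}(Y)$, $\Gamma(\nu)$: Borel probability measures on $\mathbb{R}^{2m}\times\mathbb{R}^{2m}$ (coordinates $(x,y)$) with finite second moments, second marginal $\nu$, conditional expectation of $y$ given $x$ equal to $x$; optimal plan: maximizer of $\frac12\int S d\gamma$ over $\Gamma(\nu)$. Optimal set of the dual problem: minimizer of $\int\psi_G d\nu$ over $\mathcal{M}(S)$. For $R\in\mathcal{L}_2(\mathbb{R}^m)$ $Y$-measurable and Borel $f:\mathbb{R}^m\to\mathbb{R}^m$, $(R,f)$ is a $Y$-equilibrium if $f(R)=\mathbb{E}[V|R]$ and a.s. $R\in\operatorname{argmax}_{r\in\mathbb{R}^m}\langle r-U,V-f(r)\rangle$.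 *)

(* Defs.v *)
From HB Require Import structures.
From mathcomp Require Import all_boot all_order all_algebra.
From mathcomp Require Import all_classical all_reals all_analysis.
From mathcomp Require Import matrix_topology matrix_normedtype.
From Stdlib Require Import ClassicalEpsilon.

Set Implicit Arguments.
Unset Strict Implicit.
Unset Printing Implicit Defensive.

Import Order.TTheory GRing.Theory Num.Theory.
Import numFieldNormedType.Exports.

Local Open Scope classical_set_scope.
Local Open Scope ring_scope.

(* Borel sigma-algebra on R^n, with R^n represented as column vectors       *)
(* 'cV[R]_n: the sigma-algebra generated by the coordinate maps, i.e. the   *)
(* product of the Borel sigma-algebras of R (= Borel sigma-algebra of R^n). *)

Definition cV_display : measure_display.
Proof. exact: default_measure_display. Qed.

Section measurable_cV.
Context (R : realType) (n : nat).

Let coor : 'I_n -> 'cV[R]_n -> R := fun i x => x i ord0.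

Let cV_set0 : g_sigma_preimage coor set0.
Proof. exact: sigma_algebra0. Qed.

Let cV_setC A : g_sigma_preimage coor A -> g_sigma_preimage coor (~` A).
Proof. exact: sigma_algebraC. Qed.

Let cV_bigcup (F : _^nat) : (forall i, g_sigma_preimage coor (F i)) ->
  g_sigma_preimage coor (\bigcup_i (F i)).
Proof. exact: sigma_algebra_bigcup. Qed.

HB.instance Definition _ := @isMeasurable.Build cV_display
  'cV[R]_n (g_sigma_preimage coor) cV_set0 cV_setC cV_bigcup.

End measurable_cV.

Section defs.
Context (R : realType).

Definition dotv n (x y : 'cV[R]_n) : R := (x^T *m y) ord0 ord0.

(* A > 0 : <r, A r> > 0 for every r <> 0 (A possibly non-symmetric) *)
Definition posdef n (A : 'M[R]_n) : Prop :=
  forall r : 'cV[R]_n, r != 0 -> 0 < dotv r (A *m r).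

(* symmetric positive-definite square root C^(1/2) of a symmetric positive-
   definite matrix C: the (unique) symmetric positive-definite B with B B = C *)
Definition msqrt n (C : 'M[R]_n) : 'M[R]_n :=
  epsilon (inhabits (0 : 'M[R]_n))
    (fun B => B^T = B /\ posdef B /\ B *m B = C).

Definition minvsqrt n (C : 'M[R]_n) : 'M[R]_n := invmx (msqrt C).

Definition Sform m (x y : 'cV[R]_(m + m)) : R :=
  dotv (dsubmx x) (usubmx y) + dotv (usubmx x) (dsubmx y).

Definition S_monotone m (G : set 'cV[R]_(m + m)) : Prop :=
  forall x y, G x -> G y -> 0 <= Sform (x - y) (x - y).

Definition maximal_S_monotone m (G : set 'cV[R]_(m + m)) : Prop :=
  S_monotone G /\
  forall G', S_monotone G' -> G `<=` G' -> G' = G.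

Definition psiG m (G : set 'cV[R]_(m + m)) (y : 'cV[R]_(m + m)) : \bar R :=
  ereal_sup [set ((Sform x y - Sform x x / 2)%:E) | x in G].

Definition graph m (f : 'cV[R]_m -> 'cV[R]_m) : set 'cV[R]_(m + m) :=
  [set col_mx u (f u) | u in setT].

End defs.

Section probability_defs.
Context (R : realType) (d : measure_display) (T : measurableType d)
  (P : probability T R).
Local Open Scope ereal_scope.

Definition L2 n (X : T -> 'cV[R]_n) : Prop :=
  measurable_fun setT X /\
  forall i, P.-integrable setT (fun t => ((X t i ord0) ^+ 2)%:E).

(* X is Y-measurable (sigma(Y)-measurable, up to a null set):
   X = h(Y) a.s. for a Borel map h (Doob-Dynkin) *)
Definition Y_measurable k n (Y : T -> 'cV[R]_k) (X : T -> 'cV[R]_n) : Prop :=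
  exists h : 'cV[R]_k -> 'cV[R]_n,
    measurable_fun setT h /\ {ae P, forall t, X t = h (Y t)}.

Definition cond_exp_eq n k (Z : T -> 'cV[R]_n) (W : T -> 'cV[R]_k)
    (G : T -> 'cV[R]_n) : Prop :=
  [/\ forall i, P.-integrable setT (fun t => (Z t i ord0)%:E),
      forall i, P.-integrable setT (fun t => (G t i ord0)%:E),
      Y_measurable W G &
      forall B, measurable B -> forall i,
        \int[P]_(t in W @^-1` B) (Z t i ord0)%:E =
        \int[P]_(t in W @^-1` B) (G t i ord0)%:E].

Definition mom2 n k (X : T -> 'cV[R]_n) (Z : T -> 'cV[R]_k) : 'M[R]_(n, k) :=
  \matrix_(i, j) fine (\int[P]_t (X t i ord0 * Z t j ord0)%:E).

Definition nondeg_centered_gaussian n (Y : T -> 'cV[R]_n) : Prop :=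
  posdef (mom2 Y Y) /\
  forall c : 'cV[R]_n, c != 0%R ->
    forall B : set R, measurable B ->
      P ((fun t => dotv c (Y t)) @^-1` B) =
      normal_prob 0 (Num.sqrt (dotv c (mom2 Y Y *m c))) B.

Definition admissible_map m (Y X : T -> 'cV[R]_(m + m)) : Prop :=
  [/\ L2 X, Y_measurable Y X & cond_exp_eq Y X X].

Definition map_value m (Y X : T -> 'cV[R]_(m + m)) : \bar R :=
  \int[P]_t (Sform (X t) (Y t) / 2)%:E.

Definition optimal_map m (Y X : T -> 'cV[R]_(m + m)) : Prop :=
  admissible_map Y X /\
  forall X', admissible_map Y X' -> map_value Y X' <= map_value Y X.

(* Gamma(nu), nu = Law(Y): probability measures on R^(2m) x R^(2m) with
   finite second moments, second marginal nu, and E_gamma[y | x] = x. *)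
Definition admissible_plan m (Y : T -> 'cV[R]_(m + m))
    (gam : probability ('cV[R]_(m + m) * 'cV[R]_(m + m))%type R) : Prop :=
  [/\ forall i, gam.-integrable setT (fun z => ((z.1 i ord0) ^+ 2)%:E),
      forall i, gam.-integrable setT (fun z => ((z.2 i ord0) ^+ 2)%:E),
      forall B, measurable B -> gam (snd @^-1` B) = P (Y @^-1` B) &
      forall B, measurable B -> forall i,
        \int[gam]_(z in fst @^-1` B) (z.2 i ord0)%:E =
        \int[gam]_(z in fst @^-1` B) (z.1 i ord0)%:E].

Definition plan_value m
    (gam : probability ('cV[R]_(m + m) * 'cV[R]_(m + m))%type R) : \bar R :=
  \int[gam]_z (Sform z.1 z.2 / 2)%:E.

Definition optimal_plan m (Y : T -> 'cV[R]_(m + m))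
    (gam : probability ('cV[R]_(m + m) * 'cV[R]_(m + m))%type R) : Prop :=
  admissible_plan Y gam /\
  forall gam', admissible_plan Y gam' -> plan_value gam' <= plan_value gam.

Definition dual_value m (Y : T -> 'cV[R]_(m + m)) (G : set 'cV[R]_(m + m))
    : \bar R :=
  \int[pushforward P Y]_y psiG G y.

Definition optimal_set m (Y : T -> 'cV[R]_(m + m)) (G : set 'cV[R]_(m + m))
    : Prop :=
  maximal_S_monotone G /\
  forall G', maximal_S_monotone G' -> dual_value Y G <= dual_value Y G'.

Definition Y_equilibrium m (U V : T -> 'cV[R]_m)
    (Rv : T -> 'cV[R]_m) (f : 'cV[R]_m -> 'cV[R]_m) : Prop :=
  [/\ L2 Rv, Y_measurable (fun t => col_mx (U t) (V t)) Rv,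
      measurable_fun setT f,
      cond_exp_eq V Rv (f \o Rv) &
      {ae P, forall t, forall r : 'cV[R]_m,
         (dotv (r - U t) (V t - f r) <=
          dotv (Rv t - U t) (V t - f (Rv t)))%R}].

End probability_defs.

(* Main.v *)
Require Import Defs.
From HB Require Import structures.
From mathcomp Require Import all_boot all_order all_algebra.
From mathcomp Require Import all_classical all_reals all_analysis.
From mathcomp Require Import matrix_topology matrix_normedtype.
From mathcomp Require Import measurable_realfun lebesgue_integral_under.
From mathcomp Require complex.
From mathcomp Require Import ring lra.

(** Let [J] swap the two blocks and let [S] be the covariance of [Y = (U, V)].
    If [N] is the positive definite root of [N S N = J S J], then [M = J N] is
    an involution with [M S M^T = S]; it fixes the graph of a positive definite
    matrix [A] and negates the graph of [- A^T], and this is equivalent to the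
    equation for [A]. A centered Gaussian law is determined by its covariance,
    so [M Y] has the law of [Y], and [X = (Y + M Y) / 2]. Hence [X] is the
    conditional expectation of [Y] given [X]. Completing the square along the
    graph of [A] bounds the value of every map and plan, with equality only on
    the graph; for the dual problem and the equilibrium, the Jensen inequality
    is an average over [Y] and [M Y]. Uniqueness of the optimal set and of the
    equilibrium also uses that [Y] has full support: a continuous inequality
    that holds almost surely at [Y] holds everywhere. Finally, [A] is unique
    because its graph is the unique optimal set. *)

Set Implicit Arguments.
Unset Strict Implicit.
Unset Printing Implicit Defensive.

Import Order.TTheory GRing.Theory Num.Theory.
Import numFieldNormedType.Exports.

Local Open Scope classical_set_scope.
Local Open Scope ring_scope.

(** * Positive definite matrices and the Riccati equation *)

(** The equation for [N] is what invariance demands: for symmetric [N] and [M = J N] one has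
    [M S M^T = J (N S N) J]. That [M] is an involution comes from uniqueness of the root, since
    [J N^-1 J] is a positive definite root of the same equation. The form [Sform x x] is the
    quadratic form of [J], and [J = N] on the fixed space of [M], [J = - N] on the negated space. So
    the form is positive on the fixed space, and this makes it the graph of a positive definite
    matrix.

    Gaussianity is given only through the laws of the scalars [<c, Y>], whereas invariance and full
    support concern the joint law. After whitening, the coordinates are shown to be independent one
    at a time, which computes the law on boxes.

    Competitors in the dual problem and in the equilibrium have little regularity: [psiG] may be
    infinite and a pricing rule is only Borel. Averaging over [Y] and [M Y] needs no more than
    midpoint convexity and the equality of two laws. *)

Section dotv_theory.
Context (R : realType).
Implicit Types (n : nat).

Lemma dotvE n (x y : 'cV[R]_n) : dotv x y = \sum_i x i ord0 * y i ord0.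
Proof. by rewrite /dotv mxE; apply: eq_bigr => i _; rewrite mxE. Qed.

Lemma dotvC n (x y : 'cV[R]_n) : dotv x y = dotv y x.
Proof. by rewrite !dotvE; apply: eq_bigr => i _; rewrite mulrC. Qed.

Lemma dotvDl n (x y z : 'cV[R]_n) : dotv (x + y) z = dotv x z + dotv y z.
Proof. by rewrite /dotv linearD/= mulmxDl mxE. Qed.

Lemma dotvDr n (x y z : 'cV[R]_n) : dotv x (y + z) = dotv x y + dotv x z.
Proof. by rewrite /dotv mulmxDr mxE. Qed.

Lemma dotvNl n (x y : 'cV[R]_n) : dotv (- x) y = - dotv x y.
Proof. by rewrite /dotv linearN/= mulNmx mxE. Qed.

Lemma dotvNr n (x y : 'cV[R]_n) : dotv x (- y) = - dotv x y.
Proof. by rewrite /dotv mulmxN mxE. Qed.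

Lemma dotvZl n k (x y : 'cV[R]_n) : dotv (k *: x) y = k * dotv x y.
Proof. by rewrite /dotv linearZ/= -scalemxAl mxE. Qed.

Lemma dotvZr n k (x y : 'cV[R]_n) : dotv x (k *: y) = k * dotv x y.
Proof. by rewrite /dotv -scalemxAr mxE. Qed.

Lemma dotv0l n (y : 'cV[R]_n) : dotv 0 y = 0.
Proof. by rewrite /dotv linear0 mul0mx mxE. Qed.

Lemma dotv0r n (y : 'cV[R]_n) : dotv y 0 = 0.
Proof. by rewrite /dotv mulmx0 mxE. Qed.

Lemma dotv_mulmxr n p (M : 'M[R]_(n, p)) x y :
  dotv x (M *m y) = dotv (M^T *m x) y.
Proof. by rewrite /dotv trmx_mul trmxK mulmxA. Qed.

Lemma dotv_mulmxl n p (M : 'M[R]_(n, p)) x y :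
  dotv (M *m x) y = dotv x (M^T *m y).
Proof. by rewrite dotv_mulmxr trmxK. Qed.

Lemma dotvv_ge0 n (x : 'cV[R]_n) : 0 <= dotv x x.
Proof. by rewrite dotvE sumr_ge0// => i _; rewrite -expr2 sqr_ge0. Qed.

Lemma dotvv_eq0 n (x : 'cV[R]_n) : (dotv x x == 0) = (x == 0).
Proof.
apply/idP/eqP => [|->]; last by rewrite dotv0l.
rewrite dotvE psumr_eq0 => [/allP h|i _]; last by rewrite -expr2 sqr_ge0.
apply/matrixP => i j; rewrite !ord1 mxE.
by have /eqP := h i (mem_index_enum i); rewrite -expr2 => /eqP; rewrite sqrf_eq0 => /eqP.
Qed.

Lemma dotvv_gt0 n (x : 'cV[R]_n) : x != 0 -> 0 < dotv x x.
Proof. by move=> x0; rewrite lt_def dotvv_ge0 dotvv_eq0 x0. Qed.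

End dotv_theory.

Section posdef_theory.
Context (R : realType) (n : nat).
Implicit Types (A B C D Q : 'M[R]_n).

Lemma posdef_ge0 A r : posdef A -> 0 <= dotv r (A *m r).
Proof.
by move=> pA; have [->|/pA/ltW//] := eqVneq r 0; rewrite mulmx0 dotv0r.
Qed.

Lemma posdef_eq0 A r : posdef A -> dotv r (A *m r) = 0 -> r = 0.
Proof.
by move=> pA /eqP; apply: contraTeq => /pA; rewrite lt_def => /andP[].
Qed.

Lemma ker_unitmx A : (forall r : 'cV_n, A *m r = 0 -> r = 0) -> A \in unitmx.
Proof.
move=> h; rewrite -unitmx_tr -row_free_unit -kermx_eq0.
apply/rowV0P => v /sub_kermxP vA; apply: trmx_inj; rewrite trmx0; apply: h.
by apply: trmx_inj; rewrite trmx_mul trmxK trmx0.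
Qed.

Lemma posdef_unitmx A : posdef A -> A \in unitmx.
Proof.
move=> pA; apply: ker_unitmx => r Ar.
by apply: (posdef_eq0 pA); rewrite Ar dotv0r.
Qed.

Lemma posdef_tr A : posdef A -> posdef A^T.
Proof. by move=> pA r /pA; rewrite dotv_mulmxr dotvC. Qed.

Lemma posdefD A B : posdef A -> posdef B -> posdef (A + B).
Proof.
by move=> pA pB r r0; rewrite mulmxDl dotvDr; apply: addr_gt0; [exact: pA|exact: pB].
Qed.

Lemma posdef_congr A Q : Q \in unitmx -> posdef A -> posdef (Q^T *m A *m Q).
Proof.
move=> uQ pA r r0; rewrite -!mulmxA dotv_mulmxr trmxK; apply: pA.
by apply: contraNneq r0 => /(congr1 (mulmx (invmx Q))); rewrite mulKmx// mulmx0 => ->.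
Qed.

Lemma posdef_inv A : posdef A -> posdef (invmx A).
Proof.
move=> pA r r0; have uA := posdef_unitmx pA.
rewrite -{1}(mulKVmx uA r) dotvC; apply: pA.
by apply: contraNneq r0 => /(congr1 (mulmx A)); rewrite mulKVmx// mulmx0 => ->.
Qed.

Lemma mulmx_tr_eq0 p (D : 'M[R]_(n, p)) : (D^T *m D == 0) = (D == 0).
Proof.
apply/eqP/eqP => [h|->]; last by rewrite mulmx0.
apply/matrixP => i j; rewrite mxE.
have : dotv (col j D) (col j D) = 0.
  by rewrite dotvE; transitivity ((D^T *m D) j j); [rewrite mxE; apply: eq_bigr => k _; rewrite !mxE | rewrite h mxE].
by move/eqP; rewrite dotvv_eq0 => /eqP/matrixP/(_ i ord0); rewrite !mxE.
Qed.

(* The trace of [D^T (B1 D + D B2)] is a sum of two nonnegative terms. *)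
Lemma sylvester_posdef B1 B2 D :
  posdef B1 -> posdef B2 -> B1 *m D + D *m B2 = 0 -> D = 0.
Proof.
move=> p1 p2 h.
have tr1 : 0 <= \tr (D^T *m (B1 *m D)) /\ (\tr (D^T *m (B1 *m D)) = 0 -> D = 0).
  have E j : (D^T *m (B1 *m D)) j j = dotv (col j D) (B1 *m col j D).
    rewrite dotvE mxE; apply: eq_bigr => i _; rewrite !mxE; congr (_ * _).
    by apply: eq_bigr => k _; rewrite !mxE.
  have E0 j : 0 <= (D^T *m (B1 *m D)) j j by rewrite E posdef_ge0.
  split; first exact: sumr_ge0.
  move=> /eqP; rewrite psumr_eq0// => /allP h0.
  apply/matrixP => i j; have /eqP := h0 j (mem_index_enum j).
  by rewrite E => /(posdef_eq0 p1)/matrixP/(_ i ord0); rewrite !mxE.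
have tr2 : 0 <= \tr (D^T *m (D *m B2)).
  rewrite mxtrace_mulC; apply: sumr_ge0 => j _.
  rewrite (_ : _ j j = dotv (row j D)^T (B2^T *m (row j D)^T)).
    by apply: posdef_ge0; exact: posdef_tr.
  rewrite dotvE mxE; apply: eq_bigr => i _; rewrite !mxE mulrC; congr (_ * _).
  by apply: eq_bigr => k _; rewrite !mxE mulrC.
case: tr1 => tr1 Dz; apply: Dz.
have /eqP := congr1 (fun X => \tr (D^T *m X)) h.
rewrite mulmxDr raddfD/= mulmx0 raddf0 paddr_eq0//.
by case/andP => /eqP.
Qed.

End posdef_theory.

(** * Real annihilating polynomials and square roots of symmetric matrices *)

Section annihilating_polynomial.
Import complex.
Variable R : rcfType.

(** Over the complex numbers [p] splits, and being real it equals its own conjugate. So [p ^+ 2] is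
    a product of factors [(X - z)(X - conj z) = (X - a)^2 + b^2]. Squaring avoids having to match
    each root with its conjugate. *)
Lemma sqr_poly_factor (p : {poly R}) : p \is monic ->
  exists s : seq (R * R),
    p ^+ 2 = \prod_(ab <- s) (('X - ab.1%:P) ^+ 2 + (ab.2 ^+ 2)%:P).
Proof.
move=> mp.
pose toC := (@real_complex_def R (Phant R)).
have [r Hr] := closed_field_poly_normal (map_poly toC p : {poly complex R}).
rewrite (monicP (monic_map _ mp)) scale1r in Hr.
exists [seq (complex.Re z, complex.Im z) | z <- r].
have conjp : map_poly (@conjc R) (map_poly toC p) = map_poly toC p.
  by rewrite -map_poly_comp; apply: eq_map_poly => x /=; rewrite oppr0.
apply: (map_poly_inj toC).
rewrite rmorphXn/= expr2 -{2}conjp Hr rmorph_prod -big_split/= rmorph_prod big_map.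
apply: eq_bigr => -[a b] _ /=.
rewrite rmorphB rmorphD rmorphXn rmorphB/= !map_polyX !map_polyC/=.
have -> : (Complex a b)%:P = (Complex a 0)%:P + (Complex 0 b)%:P :> {poly complex R}.
  by rewrite -polyCD; congr (_%:P); simpc.
have -> : (Complex a (-b))%:P = (Complex a 0)%:P - (Complex 0 b)%:P :> {poly complex R}.
  by rewrite -polyCB; congr (_%:P); simpc.
have -> : (toC (b ^+ 2))%:P = - ((Complex 0 b)%:P ^+ 2) :> {poly complex R}.
  by rewrite -polyC_exp -polyCN; congr (_%:P); rewrite !expr2; simpc.
ring.
Qed.

End annihilating_polynomial.

Section matrix_sqrt.
Context (R : realType).

(** Newton interpolation: [w] vanishes at the earlier nodes but not at [b], so adding a multiple of
    it corrects the value at [b] alone. *)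
Lemma interpolation_poly (s : seq R) (g : R -> R) : uniq s ->
  exists p : {poly R}, forall a, a \in s -> p.[a] = g a.
Proof.
elim: s => [|b s IH] /=; first by exists 0.
move=> /andP[bs us]; have [p hp] := IH us.
pose w := \prod_(a <- s) ('X - a%:P).
have wb : w.[b] != 0 by rewrite -/(root w b) root_prod_XsubC.
exists (p + ((g b - p.[b]) / w.[b]) *: w) => a.
rewrite inE hornerD hornerZ => /orP[/eqP->|a_s]; first by rewrite divfK// addrC subrK.
have /eqP -> : w.[a] == 0 by rewrite -/(root w a) root_prod_XsubC.
by rewrite mulr0 addr0 hp.
Qed.

Variable n : nat.
Implicit Types C : 'M[R]_n.+1.

Lemma trmx_horner_mx C (p : {poly R}) : C^T = C ->
  (horner_mx C p)^T = horner_mx C p.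
Proof.
move=> sC; elim/poly_ind: p => [|p c IH]; first by rewrite rmorph0 trmx0.
rewrite rmorphD rmorphM/= horner_mx_X horner_mx_C linearD/= tr_scalar_mx.
by rewrite -mulmxE trmx_mul IH sC (comm_mx_horner p (erefl _)).
Qed.

(** A symmetric matrix with square zero is zero, which halves an exponent. The exponent is therefore
    raised from [k] to a power of two at the start. *)
Lemma horner_mx_nilp C (p : {poly R}) k : C^T = C ->
  horner_mx C (p ^+ k) = 0 -> horner_mx C p = 0.
Proof.
move=> sC pk0.
have : horner_mx C (p ^+ (2 ^ k)) = 0.
  by rewrite -(subnK (ltnW (ltn_expl k (ltnSn 1)))) exprD rmorphM/= pk0 mulr0.
elim: k {pk0} => [|k IH]; first by rewrite expr1.
rewrite expnSr exprM expr2 rmorphM/= => h; apply: IH; apply/eqP.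
by rewrite -mulmx_tr_eq0 trmx_horner_mx// mulmxE h.
Qed.

(* Replaces the spectral theorem: in the square of the characteristic
   polynomial, the factors other than [('X - a) ^+ 2] with [0 < a] take an
   invertible value at [C], and symmetry removes the multiplicities. *)
Lemma sym_posdef_annihilator C : C^T = C -> posdef C ->
  exists s : seq R, [/\ uniq s, {in s, forall a, 0 < a} &
    horner_mx C (\prod_(a <- s) ('X - a%:P)) = 0].
Proof.
move=> sC pC.
have [s Hs] := sqr_poly_factor (char_poly_monic C).
pose good (ab : R * R) := (ab.2 == 0) && (0 < ab.1).
pose F (ab : R * R) : {poly R} := ('X - ab.1%:P) ^+ 2 + (ab.2 ^+ 2)%:P.
have Fr ab (r : 'cV_n.+1) : dotv r (horner_mx C (F ab) *m r) =
    dotv ((C - ab.1%:M) *m r) ((C - ab.1%:M) *m r) + ab.2 ^+ 2 * dotv r r.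
  rewrite /F rmorphD rmorphXn rmorphB/= horner_mx_X !horner_mx_C.
  rewrite expr2 -mulmxE mulmxDl mul_scalar_mx dotvDr dotvZr -mulmxA dotv_mulmxr.
  by rewrite linearB/= sC tr_scalar_mx; congr (_ + _); rewrite dotvC.
have Funit ab : ~~ good ab -> horner_mx C (F ab) \in unitmx.
  move=> gab; apply: ker_unitmx => r hr.
  have := Fr ab r; rewrite hr dotv0r => /esym/eqP.
  rewrite paddr_eq0 ?(mulr_ge0 (sqr_ge0 _)) ?dotvv_ge0//.
  rewrite mulf_eq0 sqrf_eq0 !dotvv_eq0 => /andP[h1 /orP[b0|/eqP//]].
  (* In the remaining case [b = 0] and [a <= 0], so [C - a] is positive definite and has no
     kernel. *)
  move: gab; rewrite /good b0/= -leNgt => a0.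
  have pCa : posdef (C - ab.1%:M).
    move=> x x0; rewrite mulmxBl mul_scalar_mx dotvDr dotvNr dotvZr.
    by rewrite ltr_wpDr ?pC// oppr_ge0 mulr_le0_ge0// dotvv_ge0.
  by move/eqP: h1 => /(congr1 (mulmx (invmx (C - ab.1%:M)))); rewrite mulKmx ?mulmx0// posdef_unitmx.
(* [M] collects the good factors already passed, so that each bad factor appears on the left, where
   its inverse cancels it. *)
have kill (t : seq (R * R)) (M : 'M[R]_n.+1) :
    horner_mx C (\prod_(ab <- t) F ab) *m M = 0 ->
    horner_mx C (\prod_(ab <- t | good ab) F ab) *m M = 0.
  elim: t M => [|ab t IH] M; first by rewrite !big_nil.
  rewrite !big_cons; case: ifPn => gab.
    by rewrite mulrC rmorphM/= -mulmxE -mulmxA => /IH; rewrite mulrC rmorphM/= -mulmxE -mulmxA.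
  rewrite rmorphM/= -mulmxE -mulmxA => /(congr1 (mulmx (invmx (horner_mx C (F ab))))).
  by rewrite mulKmx ?Funit// mulmx0 => /IH.
pose s' := undup [seq ab.1 | ab <- s & good ab].
exists s'; split; first exact: undup_uniq.
  by move=> a; rewrite mem_undup => /mapP[ab]; rewrite mem_filter => /andP[/andP[_ ?] _] ->.
have h0 : horner_mx C (\prod_(ab <- s | good ab) F ab) = 0.
  rewrite -[LHS]mulmx1; apply: kill; rewrite -Hs rmorphXn/= Cayley_Hamilton.
  by rewrite expr2 mulr0 mul0mx.
pose q := \prod_(a <- s') ('X - a%:P).
(* Each good factor is [('X - a) ^+ 2] with [a] in [s'], hence divides [q ^+ 2], and there are at
   most [size s] of them. *)
rewrite -/q; pose N := (2 * size s)%N.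
suff : (\prod_(ab <- s | good ab) F ab) %| q ^+ N.
  move=> /dvdpP[u qN]; apply: (@horner_mx_nilp _ _ N) => //.
  by rewrite qN rmorphM/= h0 mulr0.
have : {subset [seq ab.1 | ab <- s & good ab] <= s'} by move=> a; rewrite mem_undup.
rewrite /N; move: s' @q => s' q; clear -q.
elim: s => [|ab s IH] /=; first by rewrite big_nil dvd1p.
rewrite big_cons; case: ifPn => gab /= sub; last first.
  by apply: dvdp_trans (IH sub) _; rewrite dvdp_exp2l// leq_mul2l leqnSn orbT.
rewrite mulnS exprD; apply: dvdp_mul; last first.
  by apply: IH => a ?; apply: sub; rewrite inE; apply/orP; right.
move: gab => /andP[/eqP b0 _]; rewrite /F b0 expr0n/= addr0; apply: dvdp_exp2r.
by rewrite dvdp_XsubCl root_prod_XsubC sub// mem_head.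
Qed.

End matrix_sqrt.

Section msqrt_theory.
Context (R : realType) (n : nat).
Implicit Types C B : 'M[R]_n.

Lemma sym_posdef_sqrt_exists C : C^T = C -> posdef C ->
  exists B, B^T = B /\ posdef B /\ B *m B = C.
Proof.
case: n C => [|k] C sC pC; first by exists C; do 2 split=> //; rewrite [LHS]flatmx0 [RHS]flatmx0.
have [s [us s0 hs]] := sym_posdef_annihilator sC pC.
(* Fourth roots are interpolated so that the square root is itself a square [H H] with [H]
   symmetric: its quadratic form is [|H r|^2], which gives positivity. *)
have [h Hh] := interpolation_poly (fun a => Num.sqrt (Num.sqrt a)) us.
have /dvdpP[u hu] : (\prod_(a <- s) ('X - a%:P)) %| h ^+ 4 - 'X.
  apply: uniq_roots_dvdp; last by rewrite uniq_rootsE.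
  apply/allP => a a_s; rewrite /root !hornerE Hh// (exprM _ 2 2).
  by rewrite sqr_sqrtr ?sqrtr_ge0// sqr_sqrtr ?subrr// ltW// s0.
have h4 : horner_mx C (h ^+ 4) = C.
  have : horner_mx C (h ^+ 4 - 'X) = 0 by rewrite hu rmorphM/= hs mulr0.
  by rewrite rmorphB/= horner_mx_X => /eqP; rewrite subr_eq0 => /eqP.
pose H := horner_mx C h; have sH : H^T = H by exact: trmx_horner_mx.
have HE : H *m H *m (H *m H) = C.
  by rewrite -[RHS]h4 rmorphXn/= (exprM _ 2 2) !expr2 -!mulmxE.
exists (H *m H); split; first by rewrite trmx_mul sH.
split; last by [].
move=> r r0; rewrite -mulmxA dotv_mulmxr sH dotvv_gt0//.
apply: contra_neq r0 => Hr.
by apply: (posdef_eq0 pC); rewrite -HE -!mulmxA Hr !mulmx0 dotv0r.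
Qed.

Lemma msqrtP C : C^T = C -> posdef C ->
  (msqrt C)^T = msqrt C /\ posdef (msqrt C) /\ msqrt C *m msqrt C = C.
Proof.
move=> sC pC; exact: (ClassicalEpsilon.epsilon_spec (inhabits (0 : 'M[R]_n))
  (fun B => B^T = B /\ posdef B /\ B *m B = C) (sym_posdef_sqrt_exists sC pC)).
Qed.

Section congruence.
Variables (S W : 'M[R]_n).
Hypotheses (sS : S^T = S) (pS : posdef S) (sW : W^T = W) (pW : posdef W).

(** The geometric mean of [S^-1] and [W]; it is also the linear optimal transport map from the
    centered Gaussian of covariance [S] to that of covariance [W]. It serves both for [N], with
    [W = J S J], and for [Lam]. *)
Definition congr_root : 'M[R]_n :=
  minvsqrt S *m msqrt (msqrt S *m W *m msqrt S) *m minvsqrt S.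

Lemma congr_rootP :
  [/\ congr_root^T = congr_root, posdef congr_root &
      congr_root *m S *m congr_root = W].
Proof.
have [sQ [pQ QQ]] := msqrtP sS pS; have uQ := posdef_unitmx pQ.
set Q := msqrt S in sQ pQ QQ uQ *.
have sM : (Q *m W *m Q)^T = Q *m W *m Q by rewrite !trmx_mul sQ sW mulmxA.
have pM : posdef (Q *m W *m Q) by rewrite -{1}sQ; exact: posdef_congr.
have [sK [pK KK]] := msqrtP sM pM.
rewrite /congr_root /minvsqrt -/Q; set K := msqrt (Q *m W *m Q) in sK pK KK *.
have siQ : (invmx Q)^T = invmx Q by rewrite trmx_inv sQ.
split.
- by rewrite !trmx_mul siQ sK mulmxA.
- rewrite -{1}siQ; apply: posdef_congr => //; by rewrite unitmx_inv.
- rewrite -QQ !mulmxA mulmxKV// mulmxK//.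
  by rewrite -[_ *m K *m K]mulmxA KK !mulmxA mulVmx// mul1mx mulmxK.
Qed.

(** Conjugation by [Q], the square root of [S], turns solutions into square roots [M1], [M2] of one
    matrix. Their difference [D] satisfies [M1 D + D M2 = 0], a Sylvester equation. Non-symmetric
    solutions are covered as well. *)
Lemma congr_eq_uniq L1 L2 : posdef L1 -> posdef L2 ->
  L1 *m S *m L1 = W -> L2 *m S *m L2 = W -> L1 = L2.
Proof.
move=> p1 p2 e1 e2.
have [sQ [pQ QQ]] := msqrtP sS pS; have uQ := posdef_unitmx pQ.
set Q := msqrt S in sQ pQ QQ uQ *.
pose M (L : 'M[R]_n) := Q *m L *m Q.
have pM L : posdef L -> posdef (M L) by move=> pL; rewrite /M -{1}sQ; exact: posdef_congr.
have MM L : L *m S *m L = W -> M L *m M L = Q *m W *m Q.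
  by move=> <-; rewrite /M -QQ !mulmxA.
have : M L1 - M L2 = 0.
  apply: (sylvester_posdef (pM _ p1) (pM _ p2)).
  by rewrite mulmxBl mulmxBr MM// MM// addrA subrK subrr.
move/eqP; rewrite subr_eq0 => /eqP; rewrite /M => /(congr1 (mulmx (invmx Q))).
rewrite !mulmxA mulVmx// !mul1mx => /(congr1 (mulmx^~ (invmx Q))).
by rewrite !mulmxK.
Qed.

End congruence.
End msqrt_theory.

(** * Existence for the Riccati equation *)

Section riccati.
Context (R : realType) (m : nat).
Variables (Suu Svv Suv : 'M[R]_m).
Let S := block_mx Suu Suv Suv^T Svv.
Hypotheses (sS : S^T = S) (pS : posdef S).

(* [J N] is the reflection that fixes the graph of [A] and negates the graph
   of [- A^T]. *)
Lemma riccati_exists : exists A : 'M[R]_m, posdef A /\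
  A *m Suu *m A + (A *m Suv - Suv^T *m A) = Svv.
Proof.
pose J : 'M[R]_(m + m) := block_mx 0 1%:M 1%:M 0.
have JJ : J *m J = 1%:M.
  by rewrite /J mulmx_block !mul0mx !mul1mx !addr0 !add0r -scalar_mx_block.
have sJ : J^T = J by rewrite /J tr_block_mx !trmx0 !tr_scalar_mx.
have uJ : J \in unitmx by have /mulmx1_unit[] := JJ.
have [W WJ] : exists W, W = J *m S *m J by eexists.
have sW : W^T = W by rewrite WJ !trmx_mul sS sJ mulmxA.
have pW : posdef W by rewrite WJ -{1}sJ; exact: posdef_congr.
have [N [sN pN NSN]] : exists N, [/\ N^T = N, posdef N & N *m S *m N = W].
  by exists (congr_root S W); exact: congr_rootP.
have uN := posdef_unitmx pN.
have NJN : N *m J *m N = J.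
  have : J *m invmx N *m J = N.
    apply: (congr_eq_uniq sS pS (W := W)) => //.
      by rewrite -{1}sJ; apply: posdef_congr => //; exact: posdef_inv.
    have SE : S = J *m W *m J by rewrite WJ !mulmxA JJ mul1mx -mulmxA JJ mulmx1.
    have WE : invmx N *m W *m invmx N = S.
      by rewrite -NSN !mulmxA mulVmx// mul1mx mulmxK.
    rewrite {1}SE !mulmxA -[_ *m J *m J]mulmxA JJ mulmx1.
    rewrite -[_ *m J *m J]mulmxA JJ mulmx1.
    by rewrite -[J *m _ *m W]mulmxA -[J *m _ *m invmx N]mulmxA WE.
  move=> e; rewrite -{2}e !mulmxA -[N *m J *m J]mulmxA JJ mulmx1 mulmxV//.
  by rewrite mul1mx.
pose a := ulsubmx N; pose b := ursubmx N; pose d := drsubmx N.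
have NE : N = block_mx a b b^T d.
  by rewrite -[LHS]submxK /b trmx_ursub sN.
have pd : posdef d.
  move=> r r0.
  have : col_mx 0 r != 0 :> 'cV[R]_(m + m).
    by apply: contra_neq r0 => /(congr1 (@dsubmx _ m m 1)); rewrite col_mxKd linear0.
  move=> /pN; rewrite NE mul_block_col mulmx0 add0r mulmx0 add0r /dotv tr_col_mx.
  by rewrite mul_row_col trmx0 mul0mx add0r.
have ud := posdef_unitmx pd.
have sd : d^T = d by rewrite /d trmx_drsub sN.
move: NJN; rewrite NE /J !mulmx_block !mulmx0 !mulmx1 !addr0 !add0r.
move=> /eq_block_mx[e1 e2 e3 e4].
(* The lower block row of [N (1, A) = J (1, A)] reads [b^T + d A = 1], which leaves this choice. The
   upper row then follows from the blocks of [N J N = J]. *)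
pose A := invmx d *m (1%:M - b^T).
have dbT : b *m invmx d = - (invmx d *m b^T).
  have : d *m b = - (b^T *m d).
    by apply/eqP; rewrite -addr_eq0; apply/eqP.
  move=> /(congr1 (fun X => invmx d *m X *m invmx d)).
  rewrite !mulmxA mulVmx// mul1mx => ->.
  by rewrite mulmxN mulNmx !mulmxA mulmxK.
have At : A^T = invmx d *m (1%:M + b^T).
  rewrite /A trmx_mul linearB/= trmxK tr_scalar_mx trmx_inv sd mulmxBl dbT.
  by rewrite mul1mx opprK mulmxDr mulmx1.
have da : d *m a = (1%:M - b^T) *m (1%:M + b^T).
  by rewrite mulmxBl mul1mx mulmxDr mulmx1 opprD addrA addrK -e3 addrK.
have da' : d *m a = (1%:M + b^T) *m (1%:M - b^T).
  by rewrite mulmxDl mul1mx mulmxBr mulmx1 addrA subrK -e3 addrK.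
have Nl : N *m col_mx 1%:M A = col_mx A 1%:M.
  rewrite NE mul_block_col !mulmx1 mulKVmx// [b^T + _]addrC subrK; congr col_mx.
  rewrite -(mulKmx ud a) da' {1 2}/A [b *m _]mulmxA dbT mulNmx -[X in _ - X]mulmxA -mulmxBr.
  by rewrite -mulmxBl addrK mul1mx.
have Nl' : N *m col_mx 1%:M (- A^T) = col_mx A^T (- 1%:M).
  rewrite NE mul_block_col !mulmx1 !mulmxN At mulKVmx// opprD addrCA subrr addr0.
  congr col_mx.
  rewrite -(mulKmx ud a) da [b *m _]mulmxA dbT mulNmx opprK -[X in _ + X]mulmxA -mulmxDr.
  by rewrite -mulmxDl subrK mul1mx.
exists A; split.
  move=> r r0.
  have : col_mx 1%:M A *m r != 0.
    apply: contra_neq r0 => /(congr1 (@usubmx _ m m 1)).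
    by rewrite mul_col_mx col_mxKu mul1mx linear0.
  move=> /pN; rewrite mulmxA Nl !mul_col_mx !mul1mx /dotv tr_col_mx mul_row_col mxE.
  rewrite -/(dotv r (A *m r)) -/(dotv (A *m r) r) [dotv (_ *m _) _]dotvC -mulr2n.
  by rewrite pmulrn_lgt0.
have Jl : J *m col_mx 1%:M A = col_mx A 1%:M.
  by rewrite /J mul_block_col !mul0mx !mul1mx addr0 add0r.
have Jl' : J *m col_mx 1%:M (- A^T) = - col_mx A^T (- 1%:M).
  by rewrite /J mul_block_col !mul0mx !mul1mx addr0 add0r opp_col_mx opprK.
(* The two columns are the images under [N] of the two graphs. Replacing [N S N] by [J S J] changes
   the sign of [q], because [J] agrees with [N] on one graph and with [- N] on the other. Expanded
   in blocks, [q = 0] is the Riccati equation. *)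
have q0 : (col_mx A^T (- 1%:M))^T *m S *m col_mx A 1%:M = 0.
  set q := (X in X = 0); suff : q = - q.
    by move=> /eqP; rewrite -addr_eq0 -mulr2n -scaler_nat scaler_eq0 pnatr_eq0 => /eqP.
  rewrite {1}/q -Nl -Nl' trmx_mul sN.
  have -> (X : 'M[R]_(m, m + m)) : X *m N *m S *m (N *m col_mx 1%:M A) = X *m (N *m S *m N) *m col_mx 1%:M A.
    by rewrite !mulmxA.
  rewrite NSN WJ !mulmxA -[_ *m J *m _]mulmxA Jl -[in LHS]sJ -[(_)^T *m J^T]trmx_mul Jl'.
  by rewrite linearN/= !mulNmx.
move: q0; rewrite tr_col_mx trmxK linearN/= tr_scalar_mx mul_row_block mul_row_col.
rewrite !mulNmx !mul1mx mulmx1 mulmxDl mulNmx => /eqP.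
rewrite addrA subr_eq0 => /eqP <-; rewrite -!addrA; congr (_ + _).
by rewrite addrC.
Qed.
End riccati.

(** * Measurability and expectation *)

Section measurable_cV_theory.
Context (R : realType).

Lemma measurable_coord n (i : 'I_n) :
  measurable_fun setT (fun x : 'cV[R]_n => x i ord0).
Proof.
move=> _ B mB; rewrite setTI; apply: sub_sigma_algebra => /=.
rewrite -bigcup_seq/=; exists i => /=; first by rewrite mem_index_enum.
by exists B => //; rewrite setTI.
Qed.

Lemma measurable_cVP (d : measure_display) (T : measurableType d) n
    (f : T -> 'cV[R]_n) :
  measurable_fun setT f <-> forall i, measurable_fun setT (fun t => f t i ord0).
Proof.
split=> [mf i|mf]; first exact: (measurableT_comp (measurable_coord i) mf).
apply: (@measurability _ _ _ _ setT f
  (\big[setU/set0]_(i < n)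
     preimage_set_system setT (fun x : 'cV[R]_n => x i ord0) measurable)) => //.
move=> _ [B + <-]; rewrite -bigcup_seq => -[i _ [C mC <-]].
by rewrite setTI; exact: (mf i).
Qed.

Lemma measurable_cst_mulmx (d : measure_display) (T : measurableType d) n p
    (M : 'M[R]_(p, n)) (f : T -> 'cV[R]_n) :
  measurable_fun setT f -> measurable_fun setT (fun t => M *m f t).
Proof.
move=> /measurable_cVP mf; apply/measurable_cVP => i.
under eq_fun do rewrite mxE.
by apply: measurable_sum => j; apply: measurable_funM => //; exact: mf.
Qed.

Lemma measurable_cVD (d : measure_display) (T : measurableType d) n
    (f g : T -> 'cV[R]_n) :
  measurable_fun setT f -> measurable_fun setT g ->
  measurable_fun setT (fun t => f t + g t).
Proof.
move=> /measurable_cVP mf /measurable_cVP mg; apply/measurable_cVP => i.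
by under eq_fun do rewrite mxE; apply: measurable_funD; [exact: mf|exact: mg].
Qed.

Lemma measurable_cVN (d : measure_display) (T : measurableType d) n
    (f : T -> 'cV[R]_n) :
  measurable_fun setT f -> measurable_fun setT (fun t => - f t).
Proof.
move=> /measurable_cVP mf; apply/measurable_cVP => i.
under eq_fun do rewrite mxE; exact: measurable_funN.
Qed.

Lemma measurable_col_mx (d : measure_display) (T : measurableType d) n p
    (f : T -> 'cV[R]_n) (g : T -> 'cV[R]_p) :
  measurable_fun setT f -> measurable_fun setT g ->
  measurable_fun setT (fun t => col_mx (f t) (g t)).
Proof.
move=> /measurable_cVP mf /measurable_cVP mg; apply/measurable_cVP => i.
case: (split_ordP i) => j ->.
- by under eq_fun do rewrite col_mxEu; exact: mf.
- by under eq_fun do rewrite col_mxEd; exact: mg.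
Qed.

Lemma measurable_usubmx (d : measure_display) (T : measurableType d) n p
    (f : T -> 'cV[R]_(n + p)) :
  measurable_fun setT f -> measurable_fun setT (fun t => usubmx (f t)).
Proof.
move=> /measurable_cVP mf; apply/measurable_cVP => i.
by under eq_fun do rewrite mxE; exact: mf.
Qed.

Lemma measurable_dsubmx (d : measure_display) (T : measurableType d) n p
    (f : T -> 'cV[R]_(n + p)) :
  measurable_fun setT f -> measurable_fun setT (fun t => dsubmx (f t)).
Proof.
move=> /measurable_cVP mf; apply/measurable_cVP => i.
by under eq_fun do rewrite mxE; exact: mf.
Qed.

Lemma measurable_dotv (d : measure_display) (T : measurableType d) n
    (f g : T -> 'cV[R]_n) :
  measurable_fun setT f -> measurable_fun setT g ->
  measurable_fun setT (fun t => dotv (f t) (g t)).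
Proof.
move=> /measurable_cVP mf /measurable_cVP mg.
under eq_fun do rewrite dotvE.
by apply: measurable_sum => j; apply: measurable_funM; [exact: mf|exact: mg].
Qed.

End measurable_cV_theory.

Section real_expectation.
Context (R : realType) (d : measure_display) (T : measurableType d)
  (P : probability T R).
Implicit Types (f g : T -> R).

Definition L1 f : Prop := P.-integrable setT (EFin \o f).
(** An infinite integral yields the value 0, so the algebraic rules below ask for [L1]. *)
Definition Ex f : R := \int[P]_x f x.

Lemma L1_measurable f : L1 f -> measurable_fun setT f.
Proof. by move=> /integrableP[/measurable_EFinP]. Qed.

Lemma L1_le f g : measurable_fun setT f -> (forall t, `|f t| <= g t) ->
  L1 g -> L1 f.
Proof.
move=> mf fg; apply: le_integrable => //; first exact/measurable_EFinP.
by move=> t _ /=; rewrite lee_fin (le_trans (fg t))// ler_norm.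
Qed.

Lemma L1_cst k : L1 (fun=> k).
Proof. exact: finite_measure_integrable_cst. Qed.

Lemma L1_bnd f k : measurable_fun setT f -> (forall t, `|f t| <= k) -> L1 f.
Proof. by move=> mf fk; exact: (L1_le mf fk (L1_cst k)). Qed.

Lemma L1D f g : L1 f -> L1 g -> L1 (fun t => f t + g t).
Proof. by move=> /integrableD; apply. Qed.

Lemma L1B f g : L1 f -> L1 g -> L1 (fun t => f t - g t).
Proof. by move=> /integrableB; apply. Qed.

Lemma L1N f : L1 f -> L1 (fun t => - f t).
Proof. by move=> /integrableN; apply. Qed.

Lemma L1Z k f : L1 f -> L1 (fun t => k * f t).
Proof. by move=> /(integrableZl measurableT k); apply. Qed.

Lemma L1_sum (I : Type) (s : seq I) (F : I -> T -> R) :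
  (forall i, L1 (F i)) -> L1 (fun t => \sum_(i <- s) F i t).
Proof.
move=> h; have := @integrable_sum _ _ _ P setT measurableT I s xpredT
  (fun i => EFin \o F i) (fun i _ => h i).
by apply: eq_integrable => // t _; rewrite /= sumEFin.
Qed.

Lemma L1_normr f : L1 f -> L1 (fun t => `|f t|).
Proof. exact: integrable_norm. Qed.

Lemma L1M_bnd f g k : L1 f -> measurable_fun setT g ->
  (forall t, `|g t| <= k) -> L1 (fun t => f t * g t).
Proof.
move=> Lf mg gk; apply: (@L1_le _ (fun t => k * `|f t|)).
- by apply: measurable_funM => //; exact: L1_measurable.
- by move=> t; rewrite normrM mulrC ler_wpM2r.
- exact/L1Z/L1_normr.
Qed.

Lemma L1M_sqr f g : measurable_fun setT f -> measurable_fun setT g ->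
  L1 (fun t => f t ^+ 2) -> L1 (fun t => g t ^+ 2) -> L1 (fun t => f t * g t).
Proof.
move=> mf mg Lf Lg; apply: (@L1_le _ (fun t => f t ^+ 2 + g t ^+ 2)).
- exact: measurable_funM.
- move=> t; rewrite normrM.
  have := sqr_ge0 (`|f t| - `|g t|).
  rewrite sqrrB !real_normK ?num_real// => h.
  have := sqr_ge0 (f t); have := sqr_ge0 (g t); have : 0 <= `|f t| * `|g t| by [].
  by move: h; rewrite -mulr_natr; lra.
- exact: L1D.
Qed.

Lemma L1_sqr_L1 f : measurable_fun setT f -> L1 (fun t => f t ^+ 2) -> L1 f.
Proof.
move=> mf Lf; have := L1M_sqr mf (measurable_cst (1:R)) Lf (L1_cst (1 ^+ 2)).
by under [fun t => f t * _]eq_fun do rewrite mulr1.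
Qed.

Lemma ExD f g : L1 f -> L1 g -> Ex (fun t => f t + g t) = Ex f + Ex g.
Proof. exact: RintegralD. Qed.

Lemma ExB f g : L1 f -> L1 g -> Ex (fun t => f t - g t) = Ex f - Ex g.
Proof. exact: RintegralB. Qed.

Lemma ExZ k f : L1 f -> Ex (fun t => k * f t) = k * Ex f.
Proof. exact: RintegralZl. Qed.

Lemma ExN f : L1 f -> Ex (fun t => - f t) = - Ex f.
Proof.
move=> Lf; under [fun t => _]eq_fun do rewrite -mulN1r.
by rewrite ExZ// mulN1r.
Qed.

Lemma Ex_cst k : Ex (fun=> k) = k.
Proof. by rewrite /Ex Rintegral_cst// [X in fine X]probability_setT mulr1. Qed.

Lemma Ex_sum (I : Type) (s : seq I) (F : I -> T -> R) :
  (forall i, L1 (F i)) ->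
  Ex (fun t => \sum_(i <- s) F i t) = \sum_(i <- s) Ex (F i).
Proof.
move=> h; elim: s => [|i s IH].
  by under [fun t => _]eq_fun do rewrite big_nil; rewrite Ex_cst big_nil.
under [fun t => _]eq_fun do rewrite big_cons.
by rewrite ExD ?big_cons ?IH//; exact: L1_sum.
Qed.

Lemma Ex_le f g : L1 f -> L1 g -> (forall t, f t <= g t) -> Ex f <= Ex g.
Proof. by move=> Lf Lg fg; apply: le_Rintegral. Qed.

Lemma Ex_ge0 f : (forall t, 0 <= f t) -> 0 <= Ex f.
Proof. by move=> f0; apply: Rintegral_ge0. Qed.

Lemma ExE f : L1 f -> (\int[P]_t (f t)%:E = (Ex f)%:E)%E.
Proof. by move=> Lf; rewrite /Ex /Rintegral fineK//; exact: integrable_fin_num. Qed.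

Lemma Ex_ae_eq f g : measurable_fun setT f -> measurable_fun setT g ->
  {ae P, forall t, f t = g t} -> Ex f = Ex g.
Proof.
move=> mf mg fg; rewrite /Ex /Rintegral; congr fine.
apply: ae_eq_integral => //; [exact/measurable_EFinP|exact/measurable_EFinP|].
by apply: filterS fg => t + _ => ->.
Qed.

Lemma L1_ae_eq f g : measurable_fun setT g ->
  {ae P, forall t, f t = g t} -> L1 f -> L1 g.
Proof.
move=> mg fg Lf; have mf := L1_measurable Lf.
move: Lf => /integrableP[_ h]; apply/integrableP; split; first exact/measurable_EFinP.
move: h; congr (_ < _)%E; apply: ae_eq_integral => //.
- by apply: measurableT_comp => //; exact/measurable_EFinP.
- by apply: measurableT_comp => //; exact/measurable_EFinP.
- by apply: filterS fg => t /= -> _.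
Qed.

Lemma Ex_ge0_eq0 f : L1 f -> {ae P, forall t, 0 <= f t} -> Ex f = 0 ->
  {ae P, forall t, f t = 0}.
Proof.
move=> Lf f0 Ef.
have mf := L1_measurable Lf.
have E0 : Ex (fun t => `|f t|) = 0.
  rewrite -Ef; apply: Ex_ae_eq => //; first exact: measurableT_comp.
  by apply: filterS f0 => t /ger0_norm.
have : (\int[P]_t `|(f t)%:E| = 0)%E by have := ExE (L1_normr Lf); rewrite E0.
have mEf : measurable_fun setT (EFin \o f) by exact/measurable_EFinP.
move=> /(ae_eq_integral_abs P measurableT mEf).
by apply: filterS => t /= /(_ I) [].
Qed.

Lemma Ex_lim (f_ : nat -> T -> R) f g c :
  (forall n, measurable_fun setT (f_ n)) ->
  (forall t, f_ n t @[n --> \oo] --> f t) ->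
  (forall n t, `|f_ n t| <= g t) -> L1 g -> (forall n, Ex (f_ n) = c) ->
  L1 f /\ Ex f = c.
Proof.
move=> mf_ cvf fg Lg Ec.
have mf : measurable_fun setT f.
  by apply: (@measurable_fun_cvg _ _ _ _ f_) => // t _; exact: cvf.
have cvE : {ae P, forall t, setT t -> (f_ n t)%:E @[n --> \oo] --> (f t)%:E}.
  by apply: aeW => t _; apply: cvg_EFin; [exact: nearW|exact: cvf].
have mEf_ n : measurable_fun setT (fun t => (f_ n t)%:E) by exact/measurable_EFinP.
have mEf : measurable_fun setT (fun t => (f t)%:E) by exact/measurable_EFinP.
have dom : {ae P, forall t n, setT t -> (`|(f_ n t)%:E| <= (g t)%:E)%E}.
  by apply: aeW => t n _; rewrite lee_fin.
have [Lf _ h] := dominated_convergence measurableT mEf_ mEf cvE Lg dom.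
split=> //; apply: EFin_inj; rewrite -ExE//.
apply: (@cvg_unique _ (@ereal_hausdorff R) _ _ _ _ h) => /=.
apply: cvg_near_cst; near=> n => /=; rewrite -(Ec n) ExE//.
by apply: (@L1_le _ g).
Unshelve. all: by end_near. Qed.

Lemma integral_set_indic (D : set T) f :
  (\int[P]_(t in D) (f t)%:E = \int[P]_t (f t * \1_D t)%:E)%E.
Proof.
rewrite integral_mkcond; apply: eq_integral => t _.
by rewrite patchE indicE; case: ifP; rewrite ?mulr1 ?mulr0.
Qed.

Lemma indic_le1 (D : set T) t : `|\1_D t : R| <= 1.
Proof. by rewrite indicE; case: (t \in D); rewrite ?normr1 ?normr0. Qed.

End real_expectation.

(** * Fourier uniqueness *)

Lemma cosM (R : realType) (u v : R) :
  cos u * cos v = 2^-1 * (cos (u + v) + cos (u - v)).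
Proof. by rewrite cosD cosB; field. Qed.

(** * Polynomial approximation of a threshold at one half *)

Section threshold.
Context (R : realType).
Implicit Types (t s : R).

Lemma bernoulli_ineq s M : 0 <= s <= 1 -> 1 - M%:R * s <= (1 - s) ^+ M.
Proof.
move=> /andP[s0 s1]; elim: M => [|M IH]; first by rewrite mul0r subr0 expr0.
rewrite exprS; apply: (@le_trans _ _ ((1 - s) * (1 - M%:R * s))); last first.
  by rewrite ler_wpM2l// subr_ge0.
rewrite -subr_ge0 -(natr1 M).
have -> : (1 - s) * (1 - M%:R * s) - (1 - (M%:R + 1) * s) = M%:R * s ^+ 2 by ring.
by rewrite mulr_ge0 ?sqr_ge0.
Qed.

Lemma expr_onem_le s M : 0 <= s <= 1 -> (1 - s) ^+ M <= (1 + M%:R * s)^-1.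
Proof.
move=> /andP[s0 s1].
apply: (@le_trans _ _ (expR (- (M%:R * s)))).
  rewrite -mulrN mulrC expRM_natr lerXn2r ?nnegrE ?subr_ge0 ?expR_ge0//.
  by rewrite expR_ge1Dx.
by rewrite expRN lef_pV2 ?posrE ?expR_gt0 ?expR_ge1Dx// ltr_pwDl// mulr_ge0.
Qed.

Lemma natr_mul_expr_le t n : 0 <= t < 1 -> n%:R * (1 - t) * t ^+ n <= 1.
Proof.
move=> /andP[t0 t1].
suff : (1 + n%:R * (1 - t)) * t ^+ n <= 1.
  apply: le_trans; rewrite mulrDl mul1r lerDr exprn_ge0//.
elim: n => [|n IH]; first by rewrite mul0r addr0 mul1r expr0.
have -> : (1 + n.+1%:R * (1 - t)) * t ^+ n.+1 =
    t * ((1 + n%:R * (1 - t)) * t ^+ n) + (1 - t) * t ^+ n.+1.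
  by rewrite exprS -(natr1 n); ring.
rewrite -[leRHS](subrK t) addrC; apply: lerD.
  by rewrite ger_pMr ?subr_gt0// exprn_ile1// ltW.
by rewrite -[leRHS]mulr1 ler_wpM2l.
Qed.

Lemma cvg_natr_mul_expr t : 0 <= t < 1 -> n%:R * t ^+ n @[n --> \oo] --> (0 : R).
Proof.
move=> /andP[t0 t1].
(* Half of the decay absorbs the factor: [n t^n = (n r^n) r^n], and [n r^n] is at most
   [(1 - r)^-1]. *)
pose r := Num.sqrt t.
have r0 : 0 <= r by rewrite sqrtr_ge0.
have r1 : r < 1 by rewrite -sqrtr1 ltr_sqrt.
have rt : t = r ^+ 2 by rewrite sqr_sqrtr.
apply: (@squeeze_cvgr _ _ _ _ (fun=> 0) (fun n => (1 - r)^-1 * r ^+ n)).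
- near=> n; rewrite mulr_ge0 ?exprn_ge0//= rt -exprM mulnC exprM expr2.
  rewrite mulrA ler_wpM2r ?exprn_ge0//.
  rewrite -[leRHS]mul1r ler_pdivlMr ?subr_gt0// mulrAC.
  by rewrite natr_mul_expr_le// r0 r1.
- exact: cvg_cst.
- rewrite -[0](mulr0 (1 - r)^-1); apply: cvgMl_tmp => //.
  by apply: cvg_expr; rewrite ger0_norm.
Unshelve. all: by end_near. Qed.

(** The exponent times [t ^+ n] is [n (2 t)^n], which tends to 0 below one half and is at least [n]
    from one half on. The factor [n] in the exponent settles the point one half itself, where the
    limit is 0; this produces the closed condition [0 <= cos] below. *)
Lemma threshold_cvg t : 0 <= t <= 1 ->
  (1 - t ^+ n) ^+ (n * 2 ^ n) @[n --> \oo] --> (((t < 2^-1)%R : bool)%:R : R).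
Proof.
move=> /andP[t0 t1].
have tn n : 0 <= t ^+ n <= 1 by rewrite exprn_ge0//= exprn_ile1.
have [t2|t2] := ltP t 2^-1.
  have c : 1 - n%:R * (2 * t) ^+ n @[n --> \oo] --> (1 : R).
    rewrite -[X in _ --> X]subr0; apply: cvgB; first exact: cvg_cst.
    by apply: cvg_natr_mul_expr; apply/andP; split; lra.
  apply: (@squeeze_cvgr _ _ _ _ (fun n => 1 - n%:R * (2 * t) ^+ n) (fun=> 1)) => //.
    near=> n; apply/andP; split; last first.
      by have /andP[? ?] := tn n; rewrite exprn_ile1 ?subr_ge0// gerBl.
    have := bernoulli_ineq (n * 2 ^ n) (tn n).
    by rewrite natrM natrX exprMn mulrA.
  exact: cvg_cst.
apply: (@squeeze_cvgr _ _ _ _ (fun=> 0) (fun n => n.+1%:R^-1)).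
- near=> n; have /andP[? ?] := tn n; rewrite exprn_ge0 ?subr_ge0//=.
  apply: (le_trans (expr_onem_le _ (tn n))).
  rewrite lef_pV2 ?posrE// -?natr1 ?ltr_pwDl// ?mulr_ge0//.
  rewrite addrC lerD2l natrM natrX -mulrA -exprMn ler_peMr// exprn_ege1//.
  by lra.
- exact: cvg_cst.
- exact: cvg_harmonic.
Unshelve. all: by end_near. Qed.

End threshold.

Section fourier_uniqueness.
Context (R : realType) (d : measure_display) (T : measurableType d)
  (P : probability T R) (X Z : T -> R) (kZ : R).
Hypotheses (mX : measurable_fun setT X) (mZ : measurable_fun setT Z)
  (bZ : forall t, `|Z t| <= kZ).
Hypothesis EZcos : forall a p, Ex P (fun t => Z t * cos (a * X t + p)) = 0.

Let bounded (phi : R -> R) := exists k, forall x, `|phi x| <= k.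

(* A bounded function is tame if no multiple of it by a shifted cosine
   correlates with [Z]. Tame functions are stable under multiplication by the
   indicator of [0 <= cos], a limit of polynomials in the cosine, hence by
   indicators of intervals. *)
Let tame (phi : R -> R) : Prop :=
  [/\ measurable_fun setT phi, bounded phi &
   forall a p, Ex P (fun t => Z t * phi (X t) * cos (a * X t + p)) = 0].

Let measurable_cos_aff a p : measurable_fun setT (fun x : R => cos (a * x + p)).
Proof.
apply: measurableT_comp.
  by apply: continuous_measurable_fun; exact: continuous_cos.
by apply: measurable_funD => //; exact: measurable_funM.
Qed.

Let L1_tame phi a p : measurable_fun setT phi -> bounded phi ->
  L1 P (fun t => Z t * phi (X t) * cos (a * X t + p)).
Proof.
move=> mphi [k bk]; apply: (@L1_bnd _ _ _ _ _ (kZ * k)).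
- apply: measurable_funM; first by apply: measurable_funM => //; exact: measurableT_comp.
  exact: (measurableT_comp (measurable_cos_aff a p) mX).
- move=> t; rewrite 2!normrM -[leRHS]mulr1 ler_pM ?cos_max//.
  exact: ler_pM.
Qed.

Let tame1 : tame (fun=> 1).
Proof.
split=> //; first by exists 1 => x; rewrite normr1.
by move=> a p; rewrite -(EZcos a p); congr Ex; apply/funext => t; rewrite mulr1.
Qed.

Let tame_lin phi psi c : tame phi -> tame psi -> tame (fun x => phi x + c * psi x).
Proof.
move=> [m1 [k1 b1] e1] [m2 [k2 b2] e2]; split.
- by apply: measurable_funD => //; exact: measurable_funM.
- exists (k1 + `|c| * k2) => x; rewrite (le_trans (ler_normD _ _))// lerD// normrM.
  by rewrite ler_wpM2l.
- move=> a p.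
  have := ExD (L1_tame a p m1 (ex_intro _ k1 b1)) (L1Z c (L1_tame a p m2 (ex_intro _ k2 b2))).
  rewrite ExZ ?e1 ?e2 ?mulr0 ?addr0; last by apply: L1_tame => //; exists k2.
  by move=> <-; congr Ex; apply/funext => t; ring.
Qed.

Let tame_cos phi b q : tame phi -> tame (fun x => phi x * cos (b * x + q)).
Proof.
move=> [m1 [k1 b1] e1]; split.
- by apply: measurable_funM => //; exact: measurable_cos_aff.
- by exists k1 => x; rewrite normrM -[leRHS]mulr1 ler_pM ?cos_max.
- move=> a p.
  have bphi : bounded phi by exists k1.
  have := ExD (L1Z 2^-1 (L1_tame (b + a) (q + p) m1 bphi))
              (L1Z 2^-1 (L1_tame (b - a) (q - p) m1 bphi)).
  rewrite !ExZ ?e1 ?mulr0 ?addr0; [|exact: L1_tame|exact: L1_tame].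
  move=> <-; congr Ex; apply/funext => t.
  rewrite mulrA -[LHS]mulrA cosM.
  have -> : (b + a) * X t + (q + p) = (b * X t + q) + (a * X t + p) by ring.
  have -> : (b - a) * X t + (q - p) = (b * X t + q) - (a * X t + p) by ring.
  by ring.
Qed.

Let tame_poly phi b q (u : {poly R}) : tame phi ->
  tame (fun x => phi x * u.[cos (b * x + q)]).
Proof.
move=> tphi; elim/poly_ind: u => [|u c IH].
  have := tame_lin (-1) tphi tphi; congr tame; apply/funext => x.
  by rewrite horner0 mulr0 mulN1r subrr.
have := tame_lin c (tame_cos b q IH) tphi; congr tame; apply/funext => x.
by rewrite hornerMXaddC; ring.
Qed.

Let tame_lim (phi_ : nat -> R -> R) phi k : (forall n, tame (phi_ n)) ->
  (forall n x, `|phi_ n x| <= k) ->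
  (forall x, phi_ n x @[n --> \oo] --> phi x) -> tame phi.
Proof.
move=> tphi bk cv; split.
- by apply: (@measurable_fun_cvg _ _ _ _ phi_) => // n; have [] := tphi n.
- exists k => x; rewrite ler_norml; apply/andP; split.
  + apply: (ler_cvg_to (cvg_cst (- k)) (cv x)).
    by apply: nearW => n; have := bk n x; rewrite ler_norml => /andP[].
  + apply: (ler_cvg_to (cv x) (cvg_cst k)).
    by apply: nearW => n; have := bk n x; rewrite ler_norml => /andP[].
- move=> a p.
  have [] // := @Ex_lim _ _ _ P (fun n t => Z t * phi_ n (X t) * cos (a * X t + p))
    (fun t => Z t * phi (X t) * cos (a * X t + p)) (fun=> kZ * k) 0.
  + move=> n; have [mn [kn bn] _] := tphi n.
    by apply: L1_measurable; apply: (L1_tame a p mn); exists kn.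
  + move=> t; apply: cvgMr_tmp; apply: cvgMl_tmp; exact: cv.
  + move=> n t; rewrite 2!normrM -[leRHS]mulr1 ler_pM ?cos_max//.
    exact: ler_pM.
  + exact: L1_cst.
  + by move=> n; have [_ _] := tphi n; apply.
Qed.

Let stable (B : set R) := measurable B /\
  forall phi, tame phi -> tame (fun x => phi x * \1_B x).

Let stable_cos b q : stable [set x | 0 <= cos (b * x + q)].
Proof.
split.
  rewrite -[X in measurable X]setTI.
  have := measurable_cos_aff b q measurableT (measurable_itv `[0, +oo[).
  by congr (measurable (_ `&` _)); apply/funext => x /=; rewrite in_itv/= andbT.
move=> phi tphi.
pose y x := cos (b * x + q).
(* The map [y |-> (1 + y) / 2] takes values of the cosine into [[0, 1]] and sends 0 to one half, the
   threshold. *)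
pose u n : {poly R} := 1 - (1 - ((2^-1)%:P * (1 + 'X)) ^+ n) ^+ (n * 2 ^ n).
have uE n x : (u n).[y x] = 1 - (1 - ((1 + y x) / 2) ^+ n) ^+ (n * 2 ^ n).
  by rewrite /u !hornerE [2^-1 * _]mulrC.
have yb x : 0 <= (1 + y x) / 2 <= 1.
  have := cos_geN1 (b * x + q); have := cos_le1 (b * x + q); rewrite -/(y x).
  by move=> ? ?; apply/andP; split; lra.
have ub n x : `|(u n).[y x]| <= 1.
  rewrite uE; set s := _ ^+ n.
  have /andP[s0 s1] : 0 <= s <= 1.
    by have /andP[? ?] := yb x; rewrite /s exprn_ge0//= exprn_ile1.
  have h0 : 0 <= (1 - s) ^+ (n * 2 ^ n) by rewrite exprn_ge0// subr_ge0.
  have h1 : (1 - s) ^+ (n * 2 ^ n) <= 1 by rewrite exprn_ile1 ?subr_ge0// gerBl.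
  by rewrite ger0_norm ?subr_ge0// gerBl.
have [mphi [k bk] _] := tphi.
apply: (@tame_lim (fun n x => phi x * (u n).[y x]) _ k).
- by move=> n; exact: tame_poly.
- by move=> n x; rewrite normrM -[leRHS]mulr1 ler_pM.
- move=> x; apply: cvgMl_tmp; under eq_fun do rewrite uE.
  have -> : \1_[set x | 0 <= cos (b * x + q)] x = 1 - (((1 + y x) / 2 < 2^-1)%R : bool)%:R :> R.
    rewrite indicE -/(y x); have [h|h] := leP 0 (y x).
      rewrite mem_set//= ltNge (_ : 2^-1 <= _)/= ?subr0//; lra.
    by rewrite memNset/= -/(y x) ?lt_geF// (_ : _ < 2^-1) ?subrr//; lra.
  by apply: cvgB; [exact: cvg_cst|exact: threshold_cvg].
Qed.

Let stableC B : stable B -> stable (~` B).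
Proof.
move=> [mB sB]; split; first exact: measurableC.
move=> phi tphi; have := tame_lin (-1) tphi (sB _ tphi); congr tame.
apply/funext => x; rewrite !indicE in_setC; case: (x \in B) => /=; ring.
Qed.

Let stable_bigcap (B_ : nat -> set R) : (forall n, stable (B_ n)) ->
  stable (\bigcap_n B_ n).
Proof.
move=> sB; split; first by apply: bigcapT_measurable => n; have [] := sB n.
move=> phi tphi; have [mphi [k bk] _] := tphi.
apply: (@tame_lim (fun n x => phi x * \prod_(i < n) \1_(B_ i) x) _ k).
- elim=> [|n IH].
    by move: tphi; congr tame; apply/funext => x; rewrite big_ord0 mulr1.
  have := (sB n).2 _ IH; congr tame; apply/funext => x.
  by rewrite big_ord_recr/= mulrA.
- move=> n x; rewrite normrM -[leRHS]mulr1 ler_pM// normr_prod.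
  suff /andP[] : 0 <= \prod_(i < n) `|\1_(B_ i) x : R| <= 1 by [].
  elim/big_ind: _ => [|a b /andP[a0 a1] /andP[b0 b1]|i _]; first by rewrite ler01 lexx.
    by rewrite mulr_ge0// mulr_ile1.
  by rewrite normr_ge0/=; exact: indic_le1.
- move=> x; apply: cvgMl_tmp; rewrite indicE.
  have [xB|] := boolP (x \in _).
    apply: cvg_near_cst; apply: nearW => n; rewrite big1// => i _.
    by rewrite indicE mem_set//; move/set_mem: xB; apply.
  move=> /negP; rewrite inE => /existsNP[i /not_implyP[_ nB]].
  apply: cvg_near_cst; near=> n.
  have ni : (i < n)%N by near: n; exact: nbhs_infty_gt.
  by rewrite (bigD1 (Ordinal ni))//= indicE memNset// mul0r.
Unshelve. all: by end_near. Qed.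

(** A single cosine cuts out a periodic set, so infinitely many frequencies [pi / (2 r 2^j)] are
    intersected. Each of them keeps the interval. For a point outside, the phase at [j = 0] exceeds
    [pi / 2], and repeated halving brings it into []pi / 2, pi]], where the cosine is negative. *)
Let stable_itv c r : 0 < r -> stable `[c - r, c + r].
Proof.
move=> r0.
have -> : `[c - r, c + r]%classic =
  \bigcap_j [set x | 0 <= cos (pi / 2 / (r * 2 ^+ j) * x + - (pi / 2 / (r * 2 ^+ j) * c))].
  have pi0 := pi_gt0 R.
  apply/seteqP; split => x /=.
    rewrite in_itv/= => /andP[x1 x2] j _ /=; rewrite -mulrBr.
    apply: cos_ge0_pihalf; rewrite -mulNr.
    have r2 : 0 < r * 2 ^+ j by rewrite mulr_gt0// exprn_gt0.
    have : `|pi / 2 / (r * 2 ^+ j) * (x - c)| <= pi / 2.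
      have c0 : 0 <= pi / 2 / (r * 2 ^+ j) by apply/ltW/divr_gt0 => //; lra.
      rewrite normrM (ger0_norm c0) mulrAC ler_pdivrMr//.
      rewrite ler_wpM2l//; first by apply/ltW; lra.
      apply: (@le_trans _ _ r); first by rewrite ler_norml; lra.
      by apply: ler_peMr; [exact: ltW|rewrite exprn_ege1// ler1n].
    by rewrite ler_norml mulNr.
  move=> h; rewrite /= in_itv/= -ler_distlC distrC.
  rewrite leNgt; apply/negP => rx.
  pose y := pi / 2 / r * `|x - c|.
  have y0 : pi / 2 < y.
    by rewrite /y -mulrA ltr_pMr ?divr_gt0// ltr_pdivlMl// mulr1.
  have [j [j1 j2]] : exists j, pi / 2 < y / 2 ^+ j /\ y / 2 ^+ j <= pi.
    have : exists j, y / 2 ^+ j <= pi.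
      have [j hj] : exists j, y / pi < 2 ^+ j.
        exists (Num.bound (y / pi)); apply: lt_le_trans (archi_boundP _) _.
          by rewrite divr_ge0 ?ltW// (lt_trans _ y0)// divr_gt0.
        by rewrite -natrX ler_nat ltnW// ltn_expl.
      exists j; rewrite ler_pdivrMr ?exprn_gt0// mulrC -ler_pdivrMr// ltW//.
    move=> /ex_minnP[j hj jmin]; exists j; split=> //.
    case: j hj jmin => [|j] hj jmin; first by rewrite expr0 divr1.
    have /negP : ~~ (y / 2 ^+ j <= pi) by apply/negP => /jmin; rewrite ltnn.
    move=> /negP; rewrite -ltNge => hj'.
    rewrite (_ : y / 2 ^+ j.+1 = y / 2 ^+ j / 2); last by rewrite exprS invfM; ring.
    by rewrite ltr_pM2r.
  have := h j I => /=; rewrite -mulrBr -cos_norm normrM.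
  have r2 : 0 < r * 2 ^+ j by rewrite mulr_gt0// exprn_gt0.
  rewrite (ger0_norm (_ : 0 <= pi / 2 / (r * 2 ^+ j))); last by rewrite ltW ?divr_gt0.
  have -> : pi / 2 / (r * 2 ^+ j) * `|x - c| = y / 2 ^+ j.
    by rewrite /y invfM; ring.
  set z := y / 2 ^+ j in j1 j2 *.
  have -> : z = (z - pi) + pi by rewrite subrK.
  rewrite cosDpi oppr_ge0 leNgt => /negP; apply.
  by apply: cos_gt0_pihalf; lra.
by apply: stable_bigcap => j; exact: stable_cos.
Qed.

(** [EZcos] says that the signed measure [Z P], transported by [X], has zero Fourier transform. The
    stable sets form a sigma-algebra, and they include the half lines as increasing unions of
    intervals. *)
Lemma fourier_uniqueness (B : set R) : measurable B ->
  Ex P (fun t => Z t * \1_B (X t)) = 0.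
Proof.
move=> mB; suff sB : stable B.
  have [_ _ /(_ 0 0)] := sB.2 _ tame1.
  move=> <-; congr Ex; apply/funext => t.
  by rewrite mul0r addr0 cos0 mul1r mulr1.
have : (@RGenCInfty.G R).-sigma.-measurable B by rewrite -RGenCInfty.measurableE.
apply: smallest_sub.
  split.
  - have := stableC (stable_cos 0 0); rewrite (_ : ~` _ = set0)//.
    by apply/seteqP; split => x //=; rewrite mul0r addr0 cos0 ler01.
  - by move=> A sA; rewrite setTD; exact: stableC.
  - move=> F sF; rewrite -[X in stable X]setCK setC_bigcup; apply: stableC.
    by apply: stable_bigcap => n; exact/stableC/sF.
move=> _ [x ->].
have -> : `[x, +oo[%classic = ~` \bigcap_n ~` `[x + n.+1%:R - n.+1%:R, x + n.+1%:R + n.+1%:R]%classic.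
  rewrite setC_bigcap; apply/seteqP; split => y /=.
    rewrite in_itv/= andbT => xy; exists (Num.bound (y - x)) => //; rewrite setCK /=.
    rewrite in_itv/= addrK xy/=.
    have h : y - x < (Num.bound (y - x))%:R by apply: archi_boundP; rewrite subr_ge0.
    have : (Num.bound (y - x))%:R <= (Num.bound (y - x)).+1%:R :> R by rewrite ler_nat.
    have : (0:R) <= (Num.bound (y - x)).+1%:R by [].
    lra.
  by move=> [n _]; rewrite setCK /= !in_itv/= addrK andbT => /andP[].
by apply: stableC; apply: stable_bigcap => n; apply: stableC; exact: stable_itv.
Qed.
End fourier_uniqueness.

(** * Characteristic function of the normal law *)

Section normal_characteristic_function.
Context (R : realType) (s : R).
Hypothesis s0 : s != 0.
Local Notation mu := (@lebesgue_measure R).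
Let g := @normal_pdf R 0 s.
Let c := (s ^+ 2 * 2)^-1.

Let s2_gt0 : 0 < s ^+ 2. Proof. by rewrite exprn_even_gt0. Qed.
Let c_gt0 : 0 < c. Proof. by rewrite invr_gt0 mulr_gt0. Qed.

Let gE x : g x = normal_peak s * expR (- c * x ^+ 2).
Proof.
rewrite /g normal_pdfE// /normal_fun subr0; congr (_ * expR _).
by rewrite -[s ^+ 2 *+ 2]mulr_natr !mulNr mulrC.
Qed.

Let g_ge0 x : 0 <= g x. Proof. exact: normal_pdf_ge0. Qed.

Let mg : measurable_fun setT g. Proof. exact: measurable_normal_pdf. Qed.

Let is_derive_scale (t x : R) : is_derive x 1 (fun y : R => t * y) t.
Proof.
have := @is_deriveZ R R R id t x 1 1 (is_derive_id x 1).
by rewrite scaler1.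
Qed.

Let is_derive_g (x : R) : is_derive x 1 g (- (2 * c * x) * g x).
Proof.
have h1 : is_derive x 1 (fun y : R => - c * y ^+ 2) (- (2 * c * x)).
  have H := @is_deriveZ R R R (id ^+ 2) (- c) x 1 _ (is_deriveX 2 (is_derive_id x 1)).
  by apply: (is_derive_eq H); rewrite /= !scaler1 expr1 -[_ *: _]/(_ * _); ring.
have h2 := @is_derive1_comp R expR _ x _ _ (is_derive_expR _) h1.
have := @is_deriveZ R R R _ (normal_peak s) x 1 _ h2.
rewrite (_ : _ \*: _ = g); last by apply/funext => y; rewrite gE.
move=> H; apply: (is_derive_eq H); rewrite gE -[_ *: _]/(_ * _) /=; ring.
Qed.

Let is_derive_cos_scale (t x : R) :
  is_derive x 1 (fun y : R => cos (t * y)) (- (t * sin (t * x))).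
Proof.
have H := @is_derive1_comp R cos (fun y => t * y) x _ _ (is_derive_cos _) (is_derive_scale t x).
by apply: (is_derive_eq H); ring.
Qed.

Let is_derive_sin_scale (t x : R) :
  is_derive x 1 (fun y : R => sin (t * y)) (t * cos (t * x)).
Proof.
have H := @is_derive1_comp R sin (fun y => t * y) x _ _ (is_derive_sin _) (is_derive_scale t x).
by apply: (is_derive_eq H); ring.
Qed.

Let measurable_cos_scale t : measurable_fun setT (fun y : R => cos (t * y)).
Proof.
apply: measurableT_comp; last exact: measurable_funM.
by apply: continuous_measurable_fun; exact: continuous_cos.
Qed.

Let measurable_sin_scale t : measurable_fun setT (fun y : R => sin (t * y)).
Proof.
apply: measurableT_comp; last exact: measurable_funM.
by apply: continuous_measurable_fun; exact: continuous_sin.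
Qed.

Let int_bnd (b f : R -> R) (k : R) : mu.-integrable setT (EFin \o b) ->
  measurable_fun setT f -> (forall x, `|f x| <= b x) ->
  mu.-integrable setT (EFin \o f).
Proof.
move=> ib mf fb; apply: le_integrable ib => //; first exact/measurable_EFinP.
by move=> x _ /=; rewrite lee_fin (le_trans (fb x))// ler_norm.
Qed.

Let int_g : mu.-integrable setT (EFin \o g).
Proof. exact: integrable_normal_pdf. Qed.

Let int_absg : mu.-integrable setT (EFin \o (fun x => `|x| * g x)).
Proof.
pose r := Num.sqrt 2 * s.
have r0 : r != 0 by rewrite mulf_neq0// sqrtr_eq0 -ltNge.
(* Half of the Gaussian exponent, [u = c / 2 * x^2], absorbs the factor: [|x| <= 1 + x^2 <= (1 +
   2/c)(1 + u) <= (1 + 2/c) exp u]. The other half is the exponent of the density of parameter [r],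
   whence the quotient of peaks. *)
pose k := (1 + 2 / c) * normal_peak s / normal_peak r.
have pr : 0 < normal_peak r by exact: normal_peak_gt0.
have ps : 0 < normal_peak s by exact: normal_peak_gt0.
have ik : mu.-integrable setT (EFin \o (fun x => k * normal_pdf 0 r x)).
  exact: (integrableZl measurableT k (@integrable_normal_pdf R 0 r)).
apply: (int_bnd 0 ik).
  by apply: measurable_funM => //; exact: measurableT_comp.
move=> x; rewrite ger0_norm ?mulr_ge0// normal_pdfE// /normal_fun subr0.
have -> : - x ^+ 2 / (r ^+ 2 *+ 2) = - (c / 2 * x ^+ 2).
  rewrite -[r ^+ 2 *+ 2]mulr_natr /r exprMn sqr_sqrtr// /c.
  by field.
rewrite gE.
have -> : - c * x ^+ 2 = - (c / 2 * x ^+ 2) + - (c / 2 * x ^+ 2) by field.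
rewrite expRD; set e := expR _.
have e0 : 0 < e by exact: expR_gt0.
have -> : k * (normal_peak r * e) = (1 + 2 / c) * (normal_peak s * e).
  by rewrite /k; field; rewrite !gt_eqF.
have -> : `|x| * (normal_peak s * (e * e)) = (`|x| * e) * (normal_peak s * e) by ring.
rewrite ler_wpM2r//; first by rewrite mulr_ge0// ltW.
rewrite /e expRN ler_pdivrMr ?expR_gt0//.
have : 1 + c / 2 * x ^+ 2 <= expR (c / 2 * x ^+ 2) by exact: expR_ge1Dx.
set u := c / 2 * x ^+ 2 => hu.
have u0 : 0 <= u by rewrite mulr_ge0 ?sqr_ge0// divr_ge0// ltW.
have xu : x ^+ 2 = 2 / c * u by rewrite /u; field; rewrite gt_eqF.
have hx : `|x| <= 1 + x ^+ 2.
  rewrite -real_normK ?num_real//; have := sqr_ge0 (`|x| - 1).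
  have := normr_ge0 x; nra.
have c2 : 0 <= 2 / c by rewrite divr_ge0// ltW.
apply: (le_trans hx); rewrite xu.
apply: (@le_trans _ _ ((1 + 2 / c) * (1 + u))); last by rewrite ler_wpM2l// addr_ge0.
nra.
Qed.

Let h t := \int[mu]_x (cos (t * x) * g x).

Let int_cosg t : mu.-integrable setT (EFin \o (fun x => cos (t * x) * g x)).
Proof.
apply: (int_bnd 0 int_g); first by apply: measurable_funM.
by move=> x; rewrite normrM (ger0_norm (g_ge0 x)) ler_piMl ?cos_max.
Qed.

Let int_xsing t : mu.-integrable setT (EFin \o (fun x => x * sin (t * x) * g x)).
Proof.
apply: (int_bnd 0 int_absg).
  by apply: measurable_funM => //; exact: measurable_funM.
move=> x; rewrite !normrM (ger0_norm (g_ge0 x)) ler_wpM2r//.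
by rewrite ler_piMr ?sin_max.
Qed.

Let is_derive_h (t : R) : is_derive t 1 h (- \int[mu]_x (x * sin (t * x) * g x)).
Proof.
pose f (t x : R) := cos (t * x) * g x.
have df (u x : R) : is_derive u 1 (f ^~ x) (- (x * sin (u * x)) * g x).
  have : is_derive u 1 (fun y : R => cos (x * y)) (- (x * sin (x * u))).
    exact: is_derive_cos_scale.
  move=> /(@is_deriveZ R R R _ (g x) u 1 _).
  rewrite (_ : _ \*: _ = f ^~ x); last first.
    by apply/funext => y; rewrite /f [y * x]mulrC [RHS]mulrC.
  by move=> H; apply: (is_derive_eq H); rewrite [u * x]mulrC; exact: mulrC.
have d1 u x : partial1of2 f u x = - (x * sin (u * x)) * g x.
  by rewrite partial1of2E; exact: derive_val.
have it : `]t - 1, t + 1[%classic t by rewrite /= in_itv/=; apply/andP; split; lra.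
have intf (x : R) : `]t - 1, t + 1[%classic x -> mu.-integrable setT (EFin \o f x).
  by move=> _; exact: int_cosg.
have derf (x y : R) : `]t - 1, t + 1[%classic x -> setT y -> derivable (f ^~ y) x 1.
  by move=> _ _; exact: ex_derive.
have G0 y : 0 <= `|y| * g y by rewrite mulr_ge0.
have Gub (x y : R) : `]t - 1, t + 1[%classic x -> setT y -> `|partial1of2 f x y| <= `|y| * g y.
  move=> _ _; rewrite d1 normrM normrN normrM (ger0_norm (g_ge0 y)) ler_wpM2r//.
  by rewrite ler_piMr ?sin_max.
have D := @derivable_under_integral R _ _ mu f setT measurableT t (t - 1) (t + 1) it intf derf _ G0 int_absg Gub.
have E := @differentiation_under_integral R _ _ mu f setT measurableT t (t - 1) (t + 1) it intf derf _ G0 int_absg Gub.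
apply: DeriveDef; first exact: D.
rewrite -derive1E [LHS]E.
under eq_Rintegral do rewrite d1.
rewrite -mulN1r -RintegralZl//.
by apply: eq_Rintegral => x _; ring.
Qed.

Let F t x := sin (t * x) * g x.
Let f t x := t * (cos (t * x) * g x) - 2 * c * (x * sin (t * x) * g x).

Let is_derive_F (t x : R) : is_derive x 1 (F t) (f t x).
Proof.
have := @is_deriveM R R _ _ x 1 _ _ (is_derive_sin_scale t x) (is_derive_g x).
rewrite (_ : _ * _ = F t)//.
by move=> H; apply: (is_derive_eq H); rewrite /f -![_ *: _]/(_ * _); ring.
Qed.

Let int_f t : mu.-integrable setT (EFin \o f t).
Proof.
exact: (integrableB measurableT (integrableZl measurableT t (int_cosg t))
  (integrableZl measurableT (2 * c) (int_xsing t))).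
Qed.

Let continuous_f t : continuous (f t).
Proof.
have cg : continuous g by exact: continuous_normal_pdf.
have cs : continuous (fun x : R => t * x) by move=> x; apply: cvgMl_tmp; exact: cvg_id.
have cc : continuous (fun x => cos (t * x)).
  by move=> x; apply: (@continuous_comp _ _ _ (fun x => t * x) cos); [exact: cs|exact: continuous_cos].
have cn : continuous (fun x => sin (t * x)).
  by move=> x; apply: (@continuous_comp _ _ _ (fun x => t * x) sin); [exact: cs|exact: continuous_sin].
move=> x; apply: cvgB.
  by apply: cvgMl_tmp; apply: cvgM; [exact: cc|exact: cg].
by apply: cvgMl_tmp; apply: cvgM; [apply: cvgM; [exact: cvg_id|exact: cn]|exact: cg].
Qed.

Let I_ n : set R := `[- n.+1%:R, n.+1%:R].

Let FTC t n : (\int[mu]_(x in I_ n) (f t x)%:E = (F t n.+1%:R - F t (- n.+1%:R))%:E)%E.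
Proof.
have Fc x : F t y @[y --> x] --> F t x.
  apply: differentiable_continuous; apply/derivable1_diffP; exact: ex_derive.
rewrite EFinB; apply: continuous_FTC2.
- by rewrite (@lt_trans _ _ 0)// oppr_lt0.
- by apply: continuous_subspaceT; exact: continuous_f.
- split.
  + by move=> x _; exact: ex_derive.
  + exact: cvg_at_right_filter (Fc _).
  + exact: cvg_at_left_filter (Fc _).
- by move=> x _; rewrite derive1E; exact: derive_val.
Qed.

Let F_cvg0 t : F t n.+1%:R - F t (- n.+1%:R) @[n --> \oo] --> (0 : R).
Proof.
have ps : 0 < normal_peak s by exact: normal_peak_gt0.
pose k := 2 * normal_peak s / c.
apply: norm_cvg0; apply: (@squeeze_cvgr _ _ _ _ (fun=> 0) (fun n => k * n.+1%:R^-1)).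
- apply: nearW => n; rewrite normr_ge0/=.
  have gn x : `|F t x| <= g x by rewrite normrM (ger0_norm (g_ge0 x)) ler_piMl ?sin_max.
  rewrite (le_trans (ler_normB _ _))// (le_trans (lerD (gn _) (gn _)))//.
  rewrite !gE sqrrN -mulr2n -[_ *+ 2]mulr_natl /k -!mulrA.
  apply: ler_wpM2l => //; apply: ler_wpM2l; first exact: ltW.
  rewrite mulNr expRN -invfM lef_pV2 ?posrE ?expR_gt0 ?mulr_gt0//.
  apply: le_trans (expR_ge1Dx _); rewrite ler_wpDl//.
  apply: ler_wpM2l; first exact: ltW.
  by rewrite expr2; apply: ler_peMr => //; rewrite ler1n.
- exact: cvg_cst.
- rewrite -[0](mulr0 k); apply: cvgMl_tmp; exact: cvg_harmonic.
Qed.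

(** Stein's identity for the test function [sin (t x)]: [f t] is the derivative of
    [F t = sin (t x) g], so its integrals over growing intervals are boundary terms, which vanish in
    the limit. *)
Let stein t : \int[mu]_x f t x = 0.
Proof.
have mf : measurable_fun setT (f t) by apply: continuous_measurable_fun; exact: continuous_f.
pose f_ n (x : R) := (f t x * \1_(I_ n) x)%:E.
have : (\int[mu]_x f_ n x)%E @[n --> \oo] --> (\int[mu]_x (f t x)%:E)%E.
  apply: (@dominated_cvg _ _ _ mu setT measurableT f_ _ (fun x => (`|f t x|)%:E)).
  - move=> n; apply/measurable_EFinP; apply: measurable_funM => //.
    by apply: measurable_indic; exact: measurable_itv.
  - move=> x _; apply: cvg_EFin; first exact: nearW.
    apply: cvg_near_cst; near=> n; rewrite /f_/= indicE mem_set ?mulr1//=.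
    rewrite /I_/= in_itv/= -ler_norml.
    rewrite (le_trans (ltW (archi_boundP (normr_ge0 x))))// ler_nat.
    by apply: leqW; near: n; exact: nbhs_infty_ge.
  - by [].
  - exact: (integrable_norm (int_f t)).
  - move=> n x _; rewrite lee_fin normrM ler_piMr// indicE.
    by case: (_ \in _); rewrite ?normr1 ?normr0.
have fE n : (\int[mu]_x f_ n x)%E = (F t n.+1%:R - F t (- n.+1%:R))%:E.
  rewrite -FTC [RHS]integral_mkcond; apply: eq_integral => x _.
  by rewrite /f_ patchE indicE; case: ifP; rewrite ?mulr1 ?mulr0.
under eq_fun do rewrite fE.
move=> h1; have h2 : (F t n.+1%:R - F t (- n.+1%:R))%:E @[n --> \oo] --> (0 : \bar R).
  by apply: cvg_EFin; [exact: nearW|exact: F_cvg0].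
by rewrite /Rintegral (@cvg_unique _ (@ereal_hausdorff R) _ _ _ _ h1 h2).
Unshelve. all: by end_near. Qed.

(** Differentiation under the integral and Stein's identity give [h' = - s^2 t h]. [E] is the
    integrating factor, so [h E] is constant, with value 1 at the origin. *)
Let h_exp t : h t = expR (- (s ^+ 2 * t ^+ 2 / 2)).
Proof.
have hst u : \int[mu]_x (x * sin (u * x) * g x) = s ^+ 2 * u * h u.
  have := stein u; rewrite /f RintegralB//; [|exact: (integrableZl measurableT u (int_cosg u))|exact: (integrableZl measurableT (2 * c) (int_xsing u))].
  rewrite !RintegralZl//.
  rewrite -/(h u) => /eqP; rewrite subr_eq0 => /eqP e.
  have -> : s ^+ 2 * u * h u = s ^+ 2 * (u * h u) by ring.
  by rewrite e /c; field.
pose E t := expR (s ^+ 2 / 2 * t ^+ 2).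
have dE (u : R) : is_derive u 1 E (s ^+ 2 * u * E u).
  have h1 : is_derive u 1 (fun y : R => s ^+ 2 / 2 * y ^+ 2) (s ^+ 2 * u).
    have H := @is_deriveZ R R R (id ^+ 2) (s ^+ 2 / 2) u 1 _ (is_deriveX 2 (is_derive_id u 1)).
    by apply: (is_derive_eq H); rewrite /= !scaler1 expr1 -[_ *: _]/(_ * _); field.
  have H := @is_derive1_comp R expR _ u _ _ (is_derive_expR _) h1.
  by apply: (is_derive_eq H); rewrite /E mulrC.
have dhE (u : R) : is_derive u 1 (h * E) 0.
  have H := @is_deriveM R R _ _ u 1 _ _ (is_derive_h u) (dE u).
  by apply: (is_derive_eq H); rewrite hst -![_ *: _]/(_ * _); ring.
have := is_derive_0_is_cst t 0 dhE.
rewrite !fctE /E expr0n/= mulr0 expR0 mulr1.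
have -> : h 0 = 1.
  transitivity (\int[mu]_x g x); last by rewrite /Rintegral integral_normal_pdf.
  by apply: eq_Rintegral => x _; rewrite mul0r cos0 mul1r.
move=> e; apply: (@mulIf _ (expR (s ^+ 2 / 2 * t ^+ 2))); first by rewrite gt_eqF ?expR_gt0.
by rewrite e -expRD (_ : _ + _ = 0) ?expR0//; field.
Qed.

(** Frequency one suffices: other frequencies are absorbed into [s], which becomes the norm of a
    direction. *)
Lemma Ex_normal_cos : Ex (normal_prob 0 s) (@cos R) = expR (- (s ^+ 2 / 2)).
Proof.
have mc : measurable_fun setT (EFin \o @cos R).
  by apply/measurable_EFinP; apply: continuous_measurable_fun; exact: continuous_cos.
have ic : (normal_prob 0 s).-integrable setT (EFin \o @cos R).
  apply: (@L1_bnd _ _ _ (normal_prob 0 s) _ 1) => [|x]; last exact: cos_max.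
  exact/measurable_EFinP.
have := h_exp 1; rewrite expr1n mulr1 => <-.
rewrite /Ex /h /Rintegral; congr fine.
transitivity (\int[mu]_x ((EFin \o @cos R) x * (EFin \o g) x))%E; last first.
  by apply: eq_integral => x _; rewrite /= mul1r EFinM.
have dom := @normal_prob_dominates R 0 s.
rewrite -(Radon_Nikodym_change_of_variables dom measurableT ic).
apply: ae_eq_integral => //.
- apply: emeasurable_funM => //; apply: (measurable_int mu).
- by apply: emeasurable_funM => //; exact/measurable_EFinP.
- apply: ae_eqe_mul2l => /=.
  rewrite Radon_NikodymE//=; case: cid => /= k [k1 k2 k3].
  apply: integral_ae_eq => //=.
  + exact/measurable_EFinP.
  + by move=> E E01 mE; rewrite -k3.
Qed.

End normal_characteristic_function.

(** * Gaussian vectors *)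

Section law.
Context (R : realType) (d : measure_display) (T : measurableType d)
  (d' : measure_display) (S : measurableType d').

Definition mfun_of (f : T -> S) (mf : measurable_fun setT f) : {mfun T >-> S} :=
  HB.pack f (isMeasurableFun.Build _ _ _ _ _ mf).

Definition law (P : probability T R) (f : T -> S) (mf : measurable_fun setT f) :
  probability S R := distribution P (mfun_of mf).

Lemma lawE (P : probability T R) (f : T -> S) (mf : measurable_fun setT f) E :
  law P mf E = P (f @^-1` E).
Proof. by []. Qed.

Lemma L1_law (P : probability T R) (f : T -> S) (mf : measurable_fun setT f)
    (g : S -> R) : measurable_fun setT g ->
  L1 (law P mf) g <-> L1 P (g \o f).
Proof.
move=> mg.
have E : (\int[law P mf]_y `|(EFin \o g) y| = \int[P]_x `|(EFin \o (g \o f)) x|)%E.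
  rewrite (@ge0_integral_distribution _ _ _ _ _ P (mfun_of mf) (fun y => `|(g y)%:E|%E))//.
  by apply: measurableT_comp => //; exact/measurable_EFinP.
split=> /integrableP[_ h]; apply/integrableP; split; rewrite ?E// -?E//.
- by apply/measurable_EFinP; exact: measurableT_comp.
- exact/measurable_EFinP.
Qed.

Lemma Ex_law (P : probability T R) (f : T -> S) (mf : measurable_fun setT f)
    (g : S -> R) : measurable_fun setT g -> L1 P (g \o f) ->
  Ex (law P mf) g = Ex P (g \o f).
Proof.
move=> mg Lg; rewrite /Ex /Rintegral; congr fine.
by rewrite (@integral_distribution _ _ _ _ _ P (mfun_of mf) (fun y => (g y)%:E))//;
  exact/measurable_EFinP.
Qed.

End law.

Section eq_measure.
Context (R : realType) (d : measure_display) (T : measurableType d).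
Variables (P Q : probability T R).
Hypothesis PQ : forall E, measurable E -> P E = Q E.

Lemma eq_measure_Ex (g : T -> R) : Ex P g = Ex Q g.
Proof.
by rewrite /Ex /Rintegral; congr fine; apply: eq_measure_integral => A mA _; exact: PQ.
Qed.

Lemma eq_measure_L1 (g : T -> R) : L1 P g -> L1 Q g.
Proof.
move=> /integrableP[mg h]; apply/integrableP; split=> //.
by rewrite -(@eq_measure_integral _ _ _ setT Q P)// => A mA _; exact: PQ.
Qed.

End eq_measure.

(** * Independence of the coordinates of a standard Gaussian vector *)

Section standard_gaussian.
Context (R : realType) (n : nat) (d : measure_display) (T : measurableType d)
  (P : probability T R) (N : T -> 'cV[R]_n).
Hypothesis mN : measurable_fun setT N.
Hypothesis gN : forall c : 'cV[R]_n, c != 0 -> forall B : set R, measurable B ->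
  P ((fun t => dotv c (N t)) @^-1` B) = normal_prob 0 (Num.sqrt (dotv c c)) B.

Let mdot c : measurable_fun setT (fun t => dotv c (N t)).
Proof. exact: measurable_dotv. Qed.

Let Ex_proj c (g : R -> R) k : c != 0 -> measurable_fun setT g ->
  (forall x, `|g x| <= k) ->
  Ex P (fun t => g (dotv c (N t))) = Ex (normal_prob 0 (Num.sqrt (dotv c c))) g.
Proof.
move=> c0 mg gk.
have M : measurable_fun setT ((fun t => dotv c (N t)) : T -> measurableTypeR R).
  exact: mdot.
rewrite -[LHS](@Ex_law _ _ _ _ (measurableTypeR R) P _ M g)//.
  by apply: (@eq_measure_Ex _ _ _ (law P M)) => B mB; rewrite lawE gN.
apply: (@L1_bnd _ _ _ _ _ k); first exact: measurableT_comp.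
by move=> t; exact: gk.
Qed.

Let mcos : measurable_fun setT (@cos R).
Proof. by apply: continuous_measurable_fun; exact: continuous_cos. Qed.

Let msin : measurable_fun setT (@sin R).
Proof. by apply: continuous_measurable_fun; exact: continuous_sin. Qed.

Let L1_sin c : L1 P (fun t => sin (dotv c (N t))).
Proof.
by apply: (@L1_bnd _ _ _ _ _ 1) => [|t]; [exact: measurableT_comp|exact: sin_max].
Qed.

Let L1_cos c : L1 P (fun t => cos (dotv c (N t))).
Proof.
by apply: (@L1_bnd _ _ _ _ _ 1) => [|t]; [exact: measurableT_comp|exact: cos_max].
Qed.

Lemma Ex_gaussian_cos c p :
  Ex P (fun t => cos (dotv c (N t) + p)) = expR (- (dotv c c / 2)) * cos p.
Proof.
have [->|c0] := eqVneq c 0.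
  under [fun t => _]eq_fun do rewrite dotv0l add0r.
  by rewrite Ex_cst dotv0l mul0r oppr0 expR0 mul1r.
(* The projections on [c] and [- c] have the same law, so an odd function has mean zero. *)
have Esin : Ex P (fun t => sin (dotv c (N t))) = 0.
  have c0' : - c != 0 by rewrite oppr_eq0.
  have := Ex_proj c0' msin (@sin_max R).
  rewrite dotvNl dotvNr opprK -(Ex_proj c0 msin (@sin_max R)).
  under [fun t => _ in LHS]eq_fun do rewrite dotvNl sinN.
  rewrite ExN// => /eqP; rewrite eq_sym -addr_eq0 -mulr2n mulrn_eq0 => /eqP //.
have Ecos : Ex P (fun t => cos (dotv c (N t))) = expR (- (dotv c c / 2)).
  rewrite (Ex_proj c0 mcos (@cos_max R)) Ex_normal_cos.
    by rewrite sqr_sqrtr// dotvv_ge0.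
  by rewrite sqrtr_eq0 -ltNge dotvv_gt0.
under [fun t => _]eq_fun do rewrite cosD mulrC [sin _ * _]mulrC.
rewrite ExB; [|exact: L1Z|exact: L1Z].
by rewrite !ExZ// Esin Ecos mulr0 subr0 mulrC.
Qed.

Variable B : 'I_n -> set R.
Hypothesis mB : forall i, measurable (B i).

Let q i := Ex P (fun t => \1_(B i) (N t i ord0)).
Let box k t : R := \prod_(j < n | (j < k)%N) \1_(B j) (N t j ord0).

Let mN_ i : measurable_fun setT (fun t => N t i ord0).
Proof. exact/(measurable_cVP _).1. Qed.

Let mind i : measurable_fun setT (fun t => \1_(B i) (N t i ord0) : R).
Proof. by apply: measurableT_comp => //; exact: measurable_indic. Qed.

Let mbox k : measurable_fun setT (box k).
Proof.
rewrite /box; under eq_fun do rewrite big_mkcond/=.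
by apply: measurable_prod => j _; case: (j < k)%N.
Qed.

Let box01 k t : 0 <= box k t <= 1.
Proof.
rewrite /box; elim/big_ind: _ => [|a b /andP[a0 a1] /andP[b0 b1]|i _].
- by rewrite ler01 lexx.
- by rewrite mulr_ge0// mulr_ile1.
- by rewrite indicE; case: (_ \in _); rewrite ?ler01 ?lexx.
Qed.

Let boxS k (kn : (k < n)%N) t :
  box k.+1 t = \1_(B (Ordinal kn)) (N t (Ordinal kn) ord0) * box k t.
Proof.
rewrite /box (bigD1 (Ordinal kn))/=; last by rewrite ltnS.
congr (_ * _); apply: eq_bigl => j; rewrite ltnS -val_eqE/=.
by rewrite ltn_neqAle andbC.
Qed.

Let L1_boxcos k (th : 'cV[R]_n) p : L1 P (fun t => box k t * cos (dotv th (N t) + p)).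
Proof.
apply: (@L1_bnd _ _ _ _ _ 1).
  apply: measurable_funM => //; apply: (measurableT_comp mcos).
  by apply: measurable_funD.
move=> t; have /andP[b0 b1] := box01 k t.
by rewrite normrM -[leRHS]mulr1 ler_pM ?cos_max// ger0_norm.
Qed.

(** The box constrains the first [k] coordinates and the cosine involves only the others. The
    induction moves one coordinate from the cosine into the box: once [box * cos] is centered by its
    mean [c1], it is uncorrelated with every cosine of coordinate [k], hence by Fourier uniqueness
    with the indicator of [B k]. *)
Let box_cos k : (k <= n)%N -> forall (th : 'cV[R]_n) p,
  (forall i : 'I_n, (i < k)%N -> th i ord0 = 0) ->
  Ex P (fun t => box k t * cos (dotv th (N t) + p)) =
  (\prod_(j < n | (j < k)%N) q j) * (expR (- (dotv th th / 2)) * cos p).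
Proof.
elim: k => [_ th p _|k IH kn th p th0].
  rewrite big_pred0// mul1r -Ex_gaussian_cos; congr Ex; apply/funext => t.
  by rewrite /box big_pred0// mul1r.
pose i := Ordinal kn.
pose c1 := (\prod_(j < n | (j < k)%N) q j) * (expR (- (dotv th th / 2)) * cos p).
have thk (j : 'I_n) : (j < k)%N -> th j ord0 = 0.
  by move=> jk; apply: th0; exact: ltnW.
have IHk := IH (ltnW kn).
have E1 : Ex P (fun t => box k t * cos (dotv th (N t) + p)) = c1 by exact: IHk.
pose Z t := box k t * cos (dotv th (N t) + p) - c1.
have LZ : L1 P Z by apply: L1B; [exact: L1_boxcos|exact: L1_cst].
have bZ t : `|Z t| <= 1 + `|c1|.
  rewrite (le_trans (ler_normB _ _))// lerD2r normrM.
  have /andP[b0 b1] := box01 k t.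
  by rewrite -[leRHS]mulr1 ler_pM ?cos_max// ger0_norm.
pose e : 'cV[R]_n := delta_mx i ord0.
have eN x : dotv e x = x i ord0.
  rewrite dotvE (bigD1 i)//= big1 ?addr0; first by rewrite mxE !eqxx mul1r.
  by move=> j ji; rewrite mxE (negbTE ji) mul0r.
have ee : dotv e e = 1 by rewrite eN mxE !eqxx.
have thi : th i ord0 = 0 by apply: th0.
have EZ a p' : Ex P (fun t => Z t * cos (a * N t i ord0 + p')) = 0.
  have eth x : (forall j : 'I_n, (j < k)%N -> (th + x *: e) j ord0 = 0).
    move=> j jk; rewrite !mxE thk// add0r (_ : j == i = false) ?mulr0//.
    by apply/negbTE; rewrite -val_eqE/= ltn_eqF.
  have nrm x : dotv (th + x *: e) (th + x *: e) = dotv th th + x ^+ 2.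
    rewrite !dotvDl !dotvDr !dotvZl !dotvZr ee [dotv th e]dotvC eN thi; ring.
  have h1 := IHk (th + a *: e) (p + p') (eth a).
  have h2 := IHk (th + (- a) *: e) (p - p') (eth (- a)).
  have h3 := Ex_gaussian_cos (a *: e) p'.
  (* The product of cosines becomes a sum with the directions [th + a e] and [th - a e], which still
     vanish on the first [k] coordinates; as [e] is orthogonal to [th], both have squared norm
     [|th|^2 + a^2], and the exponential factorizes. *)
  transitivity (2^-1 * Ex P (fun t => box k t * cos (dotv (th + a *: e) (N t) + (p + p'))) +
     2^-1 * Ex P (fun t => box k t * cos (dotv (th + (- a) *: e) (N t) + (p - p'))) -
     c1 * Ex P (fun t => cos (dotv (a *: e) (N t) + p'))).
    have Lc : L1 P (fun t => cos (dotv (a *: e) (N t) + p')).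
      apply: (@L1_bnd _ _ _ _ _ 1) => [|t]; last exact: cos_max.
      by apply: (measurableT_comp mcos); exact: measurable_funD.
    rewrite -!ExZ//.
    rewrite -ExD; [|by apply: L1Z; exact: L1_boxcos|by apply: L1Z; exact: L1_boxcos].
    rewrite -ExB; [|by apply: L1D; apply: L1Z; exact: L1_boxcos|exact: L1Z].
    congr Ex; apply/funext => t; rewrite /Z mulrBl -mulrA cosM.
    rewrite !dotvDl !dotvZl eN.
    rewrite (_ : dotv th (N t) + p + (a * N t i ord0 + p') = dotv th (N t) + a * N t i ord0 + (p + p')); last by ring.
    rewrite (_ : dotv th (N t) + p - (a * N t i ord0 + p') = dotv th (N t) + - a * N t i ord0 + (p - p')); last by ring.
    by ring.
  rewrite h1 h2 h3 !nrm sqrrN dotvZl dotvZr ee /c1.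
  have -> : - ((dotv th th + a ^+ 2) / 2) = - (dotv th th / 2) + - (a ^+ 2 / 2) by field.
  rewrite expRD (_ : a * (a * 1) = a ^+ 2); last by ring.
  by rewrite cosD cosB; field.
have := fourier_uniqueness (mN_ i) (L1_measurable LZ) bZ EZ (mB i).
have -> : (fun t => Z t * \1_(B i) (N t i ord0)) =
  (fun t => box k.+1 t * cos (dotv th (N t) + p) - c1 * \1_(B i) (N t i ord0)).
  by apply/funext => t; rewrite /Z boxS -/i; ring.
have Li : L1 P (fun t => \1_(B i) (N t i ord0)).
  by apply: (@L1_bnd _ _ _ _ _ 1) => // t; exact: indic_le1.
rewrite ExB; [|exact: L1_boxcos|exact: L1Z].
rewrite ExZ// => /eqP; rewrite subr_eq0 => /eqP ->.
rewrite [in RHS](bigD1 i)/=; last by rewrite ltnS.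
rewrite -/(q i) (eq_bigl (fun j : 'I_n => (j < k)%N)) /c1; first by ring.
by move=> j; rewrite ltnS -val_eqE/= ltn_neqAle andbC.
Qed.

Lemma gaussian_box :
  P [set t | forall i, B i (N t i ord0)] =
  (\prod_(i < n) fine (normal_prob 0 1 (B i)))%:E.
Proof.
have mE : measurable [set t | forall i, B i (N t i ord0)].
  rewrite [X in measurable X](_ : _ = \bigcap_(i in [set: 'I_n]) [set t | B i (N t i ord0)]).
    apply: fin_bigcap_measurable => // i _.
    by rewrite -[X in measurable X]setTI; exact: mN_.
  by apply/seteqP; split => t h i //=; exact: h.
have h := @box_cos n (leqnn n) 0 0 (fun i _ => mxE _ _ _ _).
transitivity (Ex P (\1_[set t | forall i, B i (N t i ord0)]))%:E.
  rewrite -ExE; first by rewrite integral_indic// setIT.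
  by apply: (@L1_bnd _ _ _ _ _ 1) => [|t]; [exact: measurable_indic|exact: indic_le1].
congr (_%:E); transitivity (Ex P (fun t => box n t * cos (dotv 0 (N t) + 0))).
  congr Ex; apply/funext => t; rewrite dotv0l addr0 cos0 mulr1 /box indicE.
  have [tE|tE] := boolP (t \in _).
    rewrite big1// => i _; rewrite indicE mem_set//.
    by move/set_mem: tE; exact.
  move/negP: tE; rewrite inE => /existsNP[i nB].
  by rewrite (bigD1 i)/= ?ltn_ord// indicE memNset// mul0r.
rewrite h dotv0l mul0r oppr0 expR0 cos0 !mulr1.
rewrite (eq_bigl xpredT); last by move=> j; rewrite ltn_ord.
apply: eq_bigr => i _.
pose e : 'cV[R]_n := delta_mx i ord0.
have eN x : dotv e x = x i ord0.
  rewrite dotvE (bigD1 i)//= big1 ?addr0; first by rewrite mxE !eqxx mul1r.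
  by move=> j ji; rewrite mxE (negbTE ji) mul0r.
have ee : dotv e e = 1 by rewrite eN mxE !eqxx.
have e0 : e != 0 by rewrite -dotvv_eq0 ee oner_eq0.
have := gN e0 (mB i); rewrite ee sqrtr1 => <-.
rewrite (_ : (fun t => dotv e (N t)) @^-1` B i = (fun t => N t i ord0) @^-1` B i); last first.
  by apply/seteqP; split => t /=; rewrite eN.
have mBi : measurable ((fun t => N t i ord0) @^-1` B i).
  by rewrite -[X in measurable X]setTI; exact: mN_.
rewrite /q /Ex /Rintegral; congr fine.
have := @integral_indic _ _ _ P setT measurableT _ mBi; rewrite setIT => <-.
by [].
Qed.

End standard_gaussian.

Section cV_measure_unique.
Context (R : realType) (n : nat).

Definition cV_box (B : 'I_n -> set R) : set 'cV[R]_n :=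
  [set x | forall i, B i (x i ord0)].

Lemma cV_measure_unique (P Q : probability 'cV[R]_n R) :
  (forall B : 'I_n -> set R, (forall i, measurable (B i)) ->
    P (cV_box B) = Q (cV_box B)) ->
  forall E, measurable E -> P E = Q E.
Proof.
move=> h.
pose G := [set E | exists2 B : 'I_n -> set R, (forall i, measurable (B i)) & E = cV_box B].
have mbox B : (forall i, measurable (B i)) -> measurable (cV_box B).
  move=> mB; rewrite [X in measurable X](_ : _ = \bigcap_(i in [set: 'I_n]) [set x : 'cV[R]_n | B i (x i ord0)]).
    apply: fin_bigcap_measurable => // i _.
    by rewrite -[X in measurable X]setTI; exact: measurable_coord.
  by apply/seteqP; split => x hx i //=; exact: hx.
have GT : G setT.
  by exists (fun=> setT) => //; apply/seteqP; split.
apply: (@measure_unique _ _ _ G (fun=> setT)).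
- apply/seteqP; split.
    apply: smallest_sub; first exact: smallest_sigma_algebra.
    move=> E; rewrite -bigcup_seq => -[i _ [C mC <-]].
    apply: sub_sigma_algebra; exists (fun j => if j == i then C else setT).
      by move=> j; case: ifP.
    rewrite setTI; apply/seteqP; split => x /=.
      by move=> hC j; case: eqP => [->|].
    by move=> /(_ i); rewrite eqxx.
  apply: smallest_sub; first exact: sigma_algebra_measurable.
  by move=> E [B mB ->]; exact: mbox.
- move=> _ _ [B mB ->] [C mC ->]; exists (fun i => B i `&` C i).
    by move=> i; exact: measurableI.
  apply/seteqP; split => x /= => [[hB hC] i|hBC]; first by split.
  by split => i; have [] := hBC i.
- by [].
- by rewrite bigcup_const.
- by move=> _ [B mB ->]; exact: h.
- by move=> k; rewrite [X in (X < _)%E]probability_setT ltry.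
Qed.

End cV_measure_unique.

Lemma normal_prob_itv_gt0 (R : realType) (a e : R) : 0 < e ->
  (0 < normal_prob 0%R 1%R `](a - e)%R, (a + e)%R[)%E.
Proof.
move=> e0; pose k := `|a| + e.
(* On the interval [|x| <= k], so [m] is a positive lower bound of the density there. *)
pose m := normal_peak (1:R) * expR (- (k ^+ 2 / 2)).
have m0 : 0 < m by rewrite mulr_gt0 ?expR_gt0// normal_peak_gt0.
have pdfm x : `](a - e), (a + e)[%classic x -> m <= normal_pdf 0 1 x.
  rewrite /= in_itv/= => /andP[x1 x2].
  rewrite normal_pdfE// ler_wpM2l ?normal_peak_ge0// /normal_fun ler_expR subr0.
  rewrite expr1n -[1 *+ 2]/(2:R) mulNr lerN2 ler_pdivlMr// divfK// -real_normK ?num_real//.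
  rewrite lerXn2r ?nnegrE ?addr_ge0 ?(ltW e0)//.
  have h : `|x - a| <= e by rewrite ler_distl; apply/andP; split; lra.
  rewrite -[x](subrK a) (le_trans (ler_normD _ _))// addrC lerD2l//.
apply: (@lt_le_trans _ _ (\int[lebesgue_measure]_(x in `](a - e)%R, (a + e)%R[) m%:E)%E).
  rewrite integral_cst//= lebesgue_measure_itv/= lte_fin ifT; last by lra.
  by rewrite -EFinB -EFinM lte_fin mulr_gt0//; lra.
apply: ge0_le_integral => //=.
- by move=> x _; rewrite lee_fin ltW.
- by apply: measurable_funTS; apply/measurable_EFinP; exact: measurable_normal_pdf.
Qed.

Lemma cVBE (R : realType) n (x y : 'cV[R]_n) i :
  (x - y) i ord0 = x i ord0 - y i ord0.
Proof. by rewrite !mxE. Qed.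

Lemma continuous_sumr (R : realType) (V : topologicalType) n (F : 'I_n -> V -> R) :
  (forall i, continuous (F i)) -> continuous (fun y => \sum_i F i y).
Proof.
move=> h; rewrite (_ : (fun y => _) = \sum_i F i); last by apply/funext => y; rewrite fct_sumE.
elim/big_ind: _ => //; first by move=> x; exact: cvg_cst.
by move=> f g cf cg x; apply: cvgD; [exact: cf|exact: cg].
Qed.

Lemma continuous_prodr (R : realType) (V : topologicalType) (f g : V -> R) :
  continuous f -> continuous g -> continuous (fun y => f y * g y).
Proof. by move=> cf cg y; apply: cvgM; [exact: cf|exact: cg]. Qed.

Lemma continuous_subr_cst (R : realType) (V : topologicalType) (a : R) (f : V -> R) :
  continuous f -> continuous (fun y => a - f y).
Proof. by move=> cf y; apply: cvgB; [exact: cvg_cst|exact: cf]. Qed.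

Lemma continuous_cst_mulmx (R : realType) n p (K : 'M[R]_(p, n)) i :
  continuous (fun y : 'cV[R]_n => (K *m y) i ord0).
Proof.
rewrite (_ : (fun y => _) = (fun y : 'cV[R]_n => \sum_j K i j * y j ord0)).
  apply: continuous_sumr => j; apply: continuous_prodr; first exact: cst_continuous.
  exact: coord_continuous.
by apply/funext => y; rewrite mxE.
Qed.

Lemma continuous_dotv_affine (R : realType) n p (K L : 'M[R]_(p, n)) (a b : 'cV[R]_p) :
  continuous (fun y : 'cV[R]_n => dotv (a - K *m y) (b - L *m y)).
Proof.
rewrite (_ : (fun y => _) = (fun y : 'cV[R]_n =>
  \sum_i (a i ord0 - (K *m y) i ord0) * (b i ord0 - (L *m y) i ord0))).
  apply: continuous_sumr => i; apply: continuous_prodr; apply: continuous_subr_cst;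
    exact: continuous_cst_mulmx.
by apply/funext => y; rewrite dotvE; apply: eq_bigr => i _; rewrite !cVBE.
Qed.

Lemma mom2_tr (R : realType) (d : measure_display) (T : measurableType d)
    (P : probability T R) n k (X : T -> 'cV[R]_k) (Z : T -> 'cV[R]_n) :
  (mom2 P X Z)^T = mom2 P Z X.
Proof.
apply/matrixP => i j; rewrite !mxE; congr fine.
by apply: eq_integral => t _; rewrite mulrC.
Qed.

(** * Invariance and full support of a Gaussian law *)

Section gaussian_vector.
Context (R : realType) (n : nat) (d : measure_display) (T : measurableType d)
  (P : probability T R) (Y : T -> 'cV[R]_n) (S Q : 'M[R]_n).
Hypothesis mY : measurable_fun setT Y.
Hypothesis gY : forall c : 'cV[R]_n, c != 0 -> forall B : set R, measurable B ->
  P ((fun t => dotv c (Y t)) @^-1` B) =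
  normal_prob 0 (Num.sqrt (dotv c (S *m c))) B.
Hypotheses (sQ : Q^T = Q) (uQ : Q \in unitmx) (QQ : Q *m Q = S).

Let siQ : (invmx Q)^T = invmx Q. Proof. by rewrite trmx_inv sQ. Qed.
Let iSi : invmx Q *m S *m invmx Q = 1%:M.
Proof. by rewrite -QQ mulmxA mulVmx// mul1mx mulmxV. Qed.

Let whiten (M : 'M[R]_n) t := invmx Q *m (M *m Y t).

Let mwhiten M : measurable_fun setT (whiten M).
Proof. by apply: measurable_cst_mulmx; exact: measurable_cst_mulmx. Qed.

Let gwhiten (M : 'M[R]_n) : M *m S *m M^T = S ->
  forall c : 'cV[R]_n, c != 0 -> forall B : set R, measurable B ->
  P ((fun t => dotv c (whiten M t)) @^-1` B) = normal_prob 0 (Num.sqrt (dotv c c)) B.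
Proof.
move=> MS c c0 B mB.
pose c' := M^T *m (invmx Q *m c).
have E : dotv c' (S *m c') = dotv c c.
  rewrite /c' dotv_mulmxl trmxK dotv_mulmxl siQ !mulmxA.
  rewrite -[_ *m M *m S *m _]mulmxA -[_ *m M *m (S *m _)]mulmxA [M *m (S *m _)]mulmxA MS.
  by rewrite iSi mul1mx.
have c'0 : c' != 0.
  apply: contra_neq c0 => c'0; apply/eqP; rewrite -dotvv_eq0 -E c'0 dotv0l//.
rewrite -E -(gY c'0 mB); congr (P (_ @^-1` B)); apply/funext => t.
by rewrite /c' !dotv_mulmxl trmxK siQ.
Qed.

(** [Q^-1 M Y] and [Q^-1 Y] both have standard Gaussian projections, hence equal probabilities on
    boxes, hence equal laws. Multiplication by [Q] undoes the whitening. *)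
Lemma gaussian_law_invariant (M : 'M[R]_n) : M *m S *m M^T = S ->
  forall E, measurable E -> P ((fun t => M *m Y t) @^-1` E) = P (Y @^-1` E).
Proof.
move=> MS E mE.
have MS1 : 1%:M *m S *m 1%:M^T = S by rewrite trmx1 mulmx1 mul1mx.
have hbox (B : 'I_n -> set R) : (forall i, measurable (B i)) ->
    law P (mwhiten M) (cV_box B) = law P (mwhiten 1%:M) (cV_box B).
  move=> mB; have h1 := gaussian_box (mwhiten M) (gwhiten MS) mB.
  have h2 := gaussian_box (mwhiten 1%:M) (gwhiten MS1) mB.
  exact: (etrans h1 (esym h2)).
have eqlaw := cV_measure_unique hbox.
have mQE : measurable ((fun x : 'cV[R]_n => Q *m x) @^-1` E).
  rewrite -[X in measurable X]setTI; apply: measurable_cst_mulmx => //.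
have : P (whiten M @^-1` ((fun x : 'cV[R]_n => Q *m x) @^-1` E)) =
    P (whiten 1%:M @^-1` ((fun x : 'cV[R]_n => Q *m x) @^-1` E)) := eqlaw _ mQE.
congr (_ = _); congr (P _); apply/seteqP; split => t /=;
  by rewrite /whiten mulKVmx ?mul1mx.
Qed.

Lemma gaussian_full_support (g : 'cV[R]_n -> R) : continuous g ->
  {ae P, forall t, 0 <= g (Y t)} -> forall y, 0 <= g y.
Proof.
move=> cg [A [mA A0 subA]] y; rewrite leNgt; apply/negP => gy.
have MS1 : 1%:M *m S *m 1%:M^T = S by rewrite trmx1 mulmx1 mul1mx.
have : nbhs y [set z | g z < 0] by apply: (@cvgr_lt _ _ _ _ g (g y) (cg y) 0).
move=> /nbhs_ballP[e /= e0 he].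
(* [K] strictly exceeds every absolute row sum of [Q], so [Q] maps the box of half-width [e / K]
   around [Q^-1 y] into the sup-norm ball of radius [e] around [y]. That box has positive
   probability, being a product of intervals. *)
pose K := 1 + \sum_i \sum_j `|Q i j|.
have K0 : 0 < K by rewrite ltr_pwDl// !sumr_ge0// => i _; rewrite sumr_ge0.
pose del := e / K.
have del0 : 0 < del by rewrite divr_gt0.
pose y1 := invmx Q *m y.
pose B (i : 'I_n) : set R := `](y1 i ord0 - del), (y1 i ord0 + del)[%classic.
have mB i : measurable (B i) by exact: measurable_itv.
have h := gaussian_box (mwhiten 1%:M) (gwhiten MS1) mB.
have sub : [set t | forall i, B i (whiten 1%:M t i ord0)] `<=` A.
  move=> t /= tB; apply: subA => /= gt; have : g (Y t) < 0; last by lra.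
  apply: he; split => // i j; rewrite ord1 /ball/=.
  have -> : y = Q *m y1 by rewrite mulKVmx.
  have -> : Y t = Q *m whiten 1%:M t by rewrite /whiten mulKVmx// mul1mx.
  rewrite -[X in `|X|](_ : (Q *m (y1 - whiten 1%:M t)) i ord0 = _); last first.
    by rewrite mulmxBr [LHS]mxE [X in _ + X]mxE.
  rewrite mxE (le_lt_trans (ler_norm_sum _ _ _))//.
  apply: (@le_lt_trans _ _ (\sum_j `|Q i j| * del)).
    apply: ler_sum => k _; rewrite normrM ler_wpM2l//.
    have := tB k; rewrite /B/= in_itv/= => /andP[h1 h2].
    rewrite cVBE distrC ler_distl; apply/andP; split; lra.
  rewrite -mulr_suml /del mulrA ltr_pdivrMr// mulrC ltr_pM2l// /K.
  rewrite ltr_pwDl// [leRHS](bigD1 i)//= lerDl sumr_ge0// => k _; rewrite sumr_ge0//.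
have mE : measurable [set t | forall i, B i (whiten 1%:M t i ord0)].
  rewrite [X in measurable X](_ : _ = \bigcap_(i in [set: 'I_n]) [set t | B i (whiten 1%:M t i ord0)]).
    apply: fin_bigcap_measurable => // i _.
    rewrite -[X in measurable X]setTI.
    exact: ((measurable_cVP _).1 (mwhiten 1%:M) i).
  by apply/seteqP; split => t ht i //=; exact: ht.
have : (P [set t | forall i, B i (whiten 1%:M t i ord0)] <= P A)%E.
  by apply: le_measure; rewrite ?inE.
rewrite A0 h lee_fin leNgt => /negP; apply.
apply: prodr_gt0 => i _; apply: fine_gt0; rewrite normal_prob_itv_gt0//=.
by rewrite (le_lt_trans (probability_le1 _ _))//; [exact: mB|exact: ltry].
Qed.

End gaussian_vector.

(** * Conditional expectation and square integrability *)

Section layer_cake.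
Context (R : realType).
Implicit Types (x y : R) (N : nat).

(** The integer part of the positive part of [y], capped at [N], written as a sum of indicators so
    that hypotheses about indicators apply term by term. *)
Definition staircase N y : R := \sum_(k < N) \1_`[k.+1%:R, +oo[ y.

Let staircaseS N y : staircase N.+1 y = staircase N y + (N.+1%:R <= y)%R%:R.
Proof.
rewrite /staircase big_ord_recr/= indicE; congr (_ + _%:R); congr nat_of_bool.
by apply/idP/idP => [/set_mem|h]; rewrite ?inE/= in_itv/= andbT.
Qed.

Let staircase_leN N y : staircase N y <= N%:R.
Proof.
elim: N => [|N IH]; first by rewrite /staircase big_ord0.
by rewrite staircaseS -natr1 lerD// lern1; case: (_ <= y)%R.
Qed.

Lemma staircase_ge0 N y : 0 <= staircase N y.
Proof. by apply: sumr_ge0 => k _; rewrite indicE. Qed.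

Lemma staircase_le N y : staircase N y <= Num.max y 0.
Proof.
elim: N => [|N IH]; first by rewrite /staircase big_ord0 le_max lexx orbT.
rewrite staircaseS; have [h|h] := leP N.+1%:R y; last by rewrite addr0.
rewrite le_max; apply/orP; left; apply: le_trans h.
by rewrite -natr1 lerD2r staircase_leN.
Qed.

Lemma staircase_gt N y : y < N.+1%:R -> y - 1 < staircase N y.
Proof.
have full M : M%:R <= y -> staircase M y = M%:R.
  elim: M => [|M IH] h; first by rewrite /staircase big_ord0.
  rewrite staircaseS h IH; first by rewrite natr1.
  by rewrite (le_trans _ h)// ler_nat.
elim: N => [|N IH] h; first by rewrite /staircase big_ord0 subr_lt0.
rewrite staircaseS; have [h'|h'] := leP N.+1%:R y; last by rewrite addr0 IH.
by rewrite ltrBlDr full ?natr1// (le_trans _ h')// ler_nat.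
Qed.

Lemma staircase_cvg x :
  2^-1 ^+ n * staircase (n * 2 ^ n) (2 ^+ n * x) @[n --> \oo] --> Num.max x 0.
Proof.
have p2 n : 0 < (2:R) ^+ n by rewrite exprn_gt0.
have [x0|] := boolP (x <= 0); last rewrite -ltNge => x0.
  rewrite max_r//; apply: cvg_near_cst; apply: nearW => n.
  apply/eqP; rewrite mulf_eq0; apply/orP; right; rewrite eq_le staircase_ge0 andbT.
  by rewrite (le_trans (staircase_le _ _))// max_r// mulr_ge0_le0// ltW.
rewrite max_l ?ltW//.
apply: (@squeeze_cvgr _ _ _ _ (fun n => x - 2^-1 ^+ n) (fun=> x)).
- near=> n; apply/andP; split.
    (* The [n 2^n] steps of height [2^-n] reach up to [n]; once [n] exceeds [x] the cap is inactive
       and the error is at most [2^-n]. *)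
    have xn : 2 ^+ n * x < (n * 2 ^ n).+1%:R.
      rewrite -[(n * 2 ^ n).+1%:R]natr1 natrM natrX; apply: (@le_lt_trans _ _ (n%:R * 2 ^+ n)).
        rewrite mulrC; apply: ler_wpM2r; first exact: ltW.
        apply: (le_trans (ltW (archi_boundP (ltW x0)))); rewrite ler_nat.
        by near: n; exact: nbhs_infty_ge.
      by rewrite ltrDl.
    have := ltW (staircase_gt xn); rewrite -(ler_pM2l (p2 n)) => _.
    have := ltW (staircase_gt xn); rewrite exprVn -(ler_pM2l (_ : 0 < (2 ^+ n)^-1)) ?invr_gt0//.
    by rewrite mulrBr mulKf ?gt_eqF// mulr1.
  rewrite exprVn ler_pdivrMl//.
  by rewrite (le_trans (staircase_le _ _))// max_l// mulr_ge0// ltW.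
- rewrite -[X in _ --> X]subr0; apply: cvgB; first exact: cvg_cst.
  by apply: cvg_expr; rewrite ger0_norm//; lra.
- exact: cvg_cst.
Unshelve. all: by end_near. Qed.

End layer_cake.

(** * Orthogonality to unbounded functions of a conditioning variable *)

Section conditional.
Context (R : realType) (d : measure_display) (T : measurableType d)
  (P : probability T R).

(** The positive part of [h] is a limit of combinations of indicators of level sets of [h], and
    [|Z h|] dominates the products with [Z]. The negative part is obtained by applying this to
    [- h]. *)
Lemma Ex_mul_eq0_pos (Z h : T -> R) : measurable_fun setT h -> L1 P Z ->
  L1 P (fun t => Z t * h t) ->
  (forall B, measurable B -> Ex P (fun t => Z t * \1_B (h t)) = 0) ->
  L1 P (fun t => Z t * Num.max (h t) 0) /\
  Ex P (fun t => Z t * Num.max (h t) 0) = 0.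
Proof.
move=> mh LZ LZh EZ.
have mZ := L1_measurable LZ.
have mind (B : set R) : measurable B -> measurable_fun setT (fun t => \1_B (h t) : R).
  by move=> mB; apply: measurableT_comp => //; exact: measurable_indic.
pose B n k : set R := [set x | k.+1%:R <= 2 ^+ n * x].
have mB n k : measurable (B n k).
  have mm : measurable_fun setT (fun x : R => 2 ^+ n * x) by exact: measurable_funM.
  have := mm measurableT _ (measurable_itv `[(k.+1%:R : R), +oo[).
  by rewrite setTI; congr measurable; apply/seteqP; split => x /=; rewrite in_itv/= andbT.
pose f_ n t := Z t * (2^-1 ^+ n * staircase (n * 2 ^ n) (2 ^+ n * h t)).
have f_E n t : f_ n t = 2^-1 ^+ n * \sum_(k < n * 2 ^ n) (Z t * \1_(B n k) (h t)).
  rewrite /f_ /staircase mulrCA -mulr_sumr; congr (_ * (_ * _)).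
  apply: eq_bigr => k _; rewrite !indicE; congr (_%:R); congr nat_of_bool.
  by apply/idP/idP => /set_mem; rewrite /B/= ?in_itv/= ?andbT => ?; apply/mem_set; rewrite /= ?in_itv/= ?andbT.
have LB n k : L1 P (fun t => Z t * \1_(B n k) (h t)).
  by apply: (@L1M_bnd _ _ _ _ _ _ 1) => // [|t]; [exact: mind|exact: indic_le1].
apply: (@Ex_lim _ _ _ _ f_ _ (fun t => `|Z t * h t|)).
- move=> n; rewrite (_ : f_ n = fun t => 2^-1 ^+ n * \sum_(k < n * 2 ^ n) (Z t * \1_(B n k) (h t))).
    by apply: L1_measurable; apply: L1Z; exact: L1_sum.
  by apply/funext => t; exact: f_E.
- by move=> t; apply: cvgMl_tmp; exact: staircase_cvg.
- move=> n t; rewrite /f_ !normrM ler_wpM2l//.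
  rewrite [`|staircase _ _|]ger0_norm ?staircase_ge0// ger0_norm ?exprn_ge0//.
  rewrite exprVn ler_pdivrMl ?exprn_gt0// (le_trans (staircase_le _ _))//.
  rewrite ge_max mulr_ge0 ?exprn_ge0// andbT ler_wpM2l ?exprn_ge0//.
  exact: ler_norm.
- exact: L1_normr.
- move=> n; rewrite (_ : f_ n = fun t => 2^-1 ^+ n * \sum_(k < n * 2 ^ n) (Z t * \1_(B n k) (h t))); last first.
    by apply/funext => t; exact: f_E.
  rewrite ExZ; last exact: L1_sum.
  rewrite Ex_sum// big1 ?mulr0// => k _; exact: EZ.
Qed.

Lemma Ex_mul_eq0 (Z h : T -> R) : measurable_fun setT h -> L1 P Z ->
  L1 P (fun t => Z t * h t) ->
  (forall B, measurable B -> Ex P (fun t => Z t * \1_B (h t)) = 0) ->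
  Ex P (fun t => Z t * h t) = 0.
Proof.
move=> mh LZ LZh EZ.
have [L1p E1] := Ex_mul_eq0_pos mh LZ LZh EZ.
have [] := @Ex_mul_eq0_pos Z (fun t => - h t).
- exact: measurable_funN.
- exact: LZ.
- by under eq_fun do rewrite mulrN; exact: L1N.
- move=> B mB.
  have mB' : measurable [set x : R | B (- x)].
    have := @measurable_funN _ _ _ setT id (@measurable_id _ _ setT) measurableT B mB.
    by rewrite setTI.
  exact: (EZ _ mB').
move=> L1n E2.
rewrite (_ : (fun t => _) = (fun t => Z t * Num.max (h t) 0 - Z t * Num.max (- h t) 0)).
  by rewrite ExB// E1 E2 subrr.
apply/funext => t; rewrite -mulrBr; congr (_ * _).
have [h0|] := boolP (h t <= 0); last rewrite -ltNge => h0.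
  by rewrite [X in X - _]max_r// max_l ?sub0r ?opprK// oppr_ge0.
by rewrite max_l ?(ltW h0)// max_r ?subr0// oppr_le0 ltW.
Qed.

(* Conditional expectation contracts the second moment; the proof goes through
   truncations of [a] because [a] is only known to be integrable. *)
Lemma cond_exp_sqr_L1 (v a : T -> R) : L1 P v -> L1 P (fun t => v t ^+ 2) ->
  L1 P a ->
  (forall B, measurable B -> Ex P (fun t => (v t - a t) * \1_B (a t)) = 0) ->
  L1 P (fun t => a t ^+ 2).
Proof.
move=> Lv Lv2 La Ea.
have ma := L1_measurable La; have mv := L1_measurable Lv.
pose C (k : nat) : set R := [set x | `|x| <= k%:R].
have mC k : measurable (C k).
  have mn : measurable_fun setT (fun x : R => `|x|) by exact: measurableT_comp.
  have := mn measurableT _ (measurable_itv `]-oo, (k%:R : R)]).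
  by rewrite setTI; congr measurable; apply/seteqP; split => x /=; rewrite in_itv.
pose a_ k t := a t * \1_(C k) (a t).
have mind k : measurable_fun setT (fun t => \1_(C k) (a t) : R).
  by apply: measurableT_comp => //; exact: measurable_indic.
have ma_ k : measurable_fun setT (a_ k) by exact: measurable_funM.
have ba_ k t : `|a_ k t| <= k%:R.
  rewrite /a_ indicE; case: (boolP (a t \in C k)) => [/set_mem|_]; rewrite ?mulr1//.
  by rewrite mulr0 normr0.
have aa k t : a t * a_ k t = a_ k t ^+ 2.
  by rewrite /a_ expr2 indicE; case: (_ \in _); rewrite ?mulr1 ?mulr0.
have Ea_ k : Ex P (fun t => (v t - a t) * a_ k t) = 0.
  apply: Ex_mul_eq0 => //; first exact: L1B.
    by apply: (@L1M_bnd _ _ _ _ _ _ k%:R) => //; exact: L1B.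
  move=> B mB.
  have mD : measurable [set x | B (x * \1_(C k) x)].
    have mm : measurable_fun setT (fun x : R => x * \1_(C k) x).
      by apply: measurable_funM => //; exact: measurable_indic.
    by have := mm measurableT B mB; rewrite setTI.
  exact: (Ea _ mD).
have La_2 k : L1 P (fun t => a_ k t ^+ 2).
  apply: (@L1_bnd _ _ _ _ _ (k%:R ^+ 2)); first exact: measurable_funX.
  by move=> t; rewrite normrX lerXn2r ?nnegrE.
have Eb k : Ex P (fun t => a_ k t ^+ 2) <= Ex P (fun t => v t ^+ 2).
  have Lva : L1 P (fun t => v t * a_ k t) by apply: (@L1M_bnd _ _ _ _ _ _ k%:R).
  have Laa : L1 P (fun t => a t * a_ k t) by apply: (@L1M_bnd _ _ _ _ _ _ k%:R).
  have E1 : Ex P (fun t => v t * a_ k t) = Ex P (fun t => a_ k t ^+ 2).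
    have := Ea_ k; under [fun t => (_ - _) * _]eq_fun do rewrite mulrBl.
    rewrite ExB// => /eqP; rewrite subr_eq0 => /eqP ->.
    by congr Ex; apply/funext => t; exact: aa.
  (* Young's inequality; half of the second moment of [a_ k] can then be absorbed because truncation
     makes it finite. *)
  have : Ex P (fun t => v t * a_ k t) <=
      Ex P (fun t => 2^-1 * v t ^+ 2 + 2^-1 * a_ k t ^+ 2).
    apply: Ex_le => //; first by apply: L1D; exact: L1Z.
    by move=> t; have := sqr_ge0 (v t - a_ k t); nra.
  rewrite ExD; [|exact: L1Z|exact: L1Z].
  by rewrite !ExZ// E1; lra.
have ma2 : measurable_fun setT (fun t => (a t ^+ 2)%:E).
  by apply/measurable_EFinP; exact: measurable_funX.
apply/integrableP; split => //=.
under eq_integral do rewrite ger0_norm ?sqr_ge0//.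
pose g_ k t := (a_ k t ^+ 2)%:E.
have a_E k t : `|a t| <= k%:R -> a_ k t = a t.
  by move=> h; rewrite /a_ indicE mem_set ?mulr1.
have cv t : g_ n t @[n --> \oo] --> (a t ^+ 2)%:E.
  apply: cvg_near_cst; near=> n; rewrite /g_ a_E//.
  rewrite (le_trans (ltW (archi_boundP (normr_ge0 (a t)))))// ler_nat.
  by near: n; exact: nbhs_infty_ge.
have mg n : measurable_fun setT (g_ n) by apply/measurable_EFinP; exact: measurable_funX.
have g0 n t : setT t -> (0 <= g_ n t)%E by rewrite lee_fin sqr_ge0.
have ndg t : setT t -> nondecreasing_seq (g_ ^~ t).
  move=> _ k l kl; rewrite lee_fin /a_ !exprMn ler_wpM2l ?sqr_ge0// !indicE.
  have [/set_mem h|_] := boolP (a t \in C k); last by rewrite expr0n/= sqr_ge0.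
  by rewrite mem_set// /C/= (le_trans h)// ler_nat.
have := @cvg_monotone_convergence _ _ _ P setT measurableT g_ mg g0 ndg.
rewrite (eq_integral (fun t => (a t ^+ 2)%:E)); last first.
  by move=> t _; apply/cvg_lim => //; exact: cv.
move=> cvI; apply: (@le_lt_trans _ _ (Ex P (fun t => v t ^+ 2))%:E); last exact: ltry.
apply: (@cvge_le _ _ _ _ _ _ _ _ cvI); apply: nearW => n.
by rewrite /g_ ExE// lee_fin.
Unshelve. all: by end_near. Qed.

End conditional.

Section L2_theory.
Context (R : realType) (d : measure_display) (T : measurableType d)
  (P : probability T R).

Lemma L2_coord n (X : T -> 'cV[R]_n) i : L2 P X -> L1 P (fun t => X t i ord0).
Proof.
move=> [mX LX]; apply: L1_sqr_L1; first exact: ((measurable_cVP _).1 mX).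
exact: LX.
Qed.

Lemma L2_coordM n p (X : T -> 'cV[R]_n) (Z : T -> 'cV[R]_p) i j :
  L2 P X -> L2 P Z -> L1 P (fun t => X t i ord0 * Z t j ord0).
Proof.
move=> [mX LX] [mZ LZ]; apply: L1M_sqr.
- exact: ((measurable_cVP _).1 mX).
- exact: ((measurable_cVP _).1 mZ).
- exact: LX.
- exact: LZ.
Qed.

Lemma L2_dotv n (X Z : T -> 'cV[R]_n) : L2 P X -> L2 P Z ->
  L1 P (fun t => dotv (X t) (Z t)).
Proof.
move=> LX LZ; under eq_fun do rewrite dotvE.
by apply: L1_sum => i; exact: L2_coordM.
Qed.

Lemma L2_lin n p (X : T -> 'cV[R]_n) (M : 'M[R]_(p, n)) : L2 P X ->
  L2 P (fun t => M *m X t).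
Proof.
move=> LX; split; first by apply: measurable_cst_mulmx; exact: LX.1.
move=> i.
have : L1 P (fun t => \sum_j \sum_k M i j * M i k * (X t j ord0 * X t k ord0)).
  by apply: L1_sum => j; apply: L1_sum => k; apply: L1Z; exact: L2_coordM.
congr (P.-integrable _ _); apply/funext => t /=; congr (_%:E).
rewrite mxE expr2 mulr_suml; apply: eq_bigr => j _; rewrite mulr_sumr.
by apply: eq_bigr => k _; ring.
Qed.

Lemma L2_col n p (X : T -> 'cV[R]_n) (Z : T -> 'cV[R]_p) : L2 P X -> L2 P Z ->
  L2 P (fun t => col_mx (X t) (Z t)).
Proof.
move=> [mX LX] [mZ LZ]; split; first exact: measurable_col_mx.
move=> i; case: (split_ordP i) => j ->.
- by under eq_fun do rewrite col_mxEu; exact: LX.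
- by under eq_fun do rewrite col_mxEd; exact: LZ.
Qed.

Lemma L2_usub n p (X : T -> 'cV[R]_(n + p)) : L2 P X -> L2 P (fun t => usubmx (X t)).
Proof.
move=> [mX LX]; split; first exact: measurable_usubmx.
by move=> i; under eq_fun do rewrite mxE; exact: LX.
Qed.

Lemma L2_dsub n p (X : T -> 'cV[R]_(n + p)) : L2 P X -> L2 P (fun t => dsubmx (X t)).
Proof.
move=> [mX LX]; split; first exact: measurable_dsubmx.
by move=> i; under eq_fun do rewrite mxE; exact: LX.
Qed.

End L2_theory.

(** * Projection onto the graph *)

(** The hypothesis says that [Pi Y] and [Y - Pi Y] are uncorrelated when [Y] has covariance [S].
    Changing the sign of the second part therefore preserves the covariance. *)
Lemma reflection_cov (R : realType) n (Pi S : 'M[R]_n) : S^T = S ->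
  Pi *m S *m Pi^T = Pi *m S ->
  (2 *: Pi - 1%:M) *m S *m (2 *: Pi - 1%:M)^T = S.
Proof.
move=> sS PSP.
have PSP' : S *m Pi^T = Pi *m S.
  have : (Pi *m S)^T = Pi *m S by rewrite -PSP !trmx_mul trmxK sS mulmxA.
  by rewrite trmx_mul sS.
have -> : (2 *: Pi - 1%:M) *m S = 2 *: (Pi *m S) - S.
  by rewrite mulmxBl -scalemxAl mul1mx.
rewrite linearB/= linearZ/= trmx1 mulmxBr mulmx1 -scalemxAr mulmxBl -scalemxAl PSP PSP'.
rewrite [2 *: (Pi *m S)]scaler_nat mulr2n addrK.
by rewrite [2 *: _]scaler_nat mulr2n opprB addrCA subrr addr0.
Qed.

Section projection.
Context (R : realType) (m : nat) (A : 'M[R]_m).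
Hypothesis pA : posdef A.
Implicit Types (x y : 'cV[R]_(m + m)).

(** The space splits into the graphs of [A] and [- A^T]: [y = (r, A r) + (w, - A^T w)]. Eliminating
    [w] from [u = r + w] and [v = A r - A^T w] gives [(A + A^T) r = A^T u + v]. *)
Definition rmat : 'M[R]_(m, m + m) := invmx (A + A^T) *m row_mx A^T 1%:M.
Definition rproj y : 'cV[R]_m := rmat *m y.
Definition gproj y : 'cV[R]_(m + m) := col_mx (rproj y) (A *m rproj y).
Definition wproj y : 'cV[R]_m := usubmx y - rproj y.
Definition reflmat : 'M[R]_(m + m) := 2 *: (col_mx 1%:M A *m rmat) - 1%:M.

Lemma rproj_col u v :
  rproj (col_mx u v) = invmx (A + A^T) *m (A^T *m u + v).
Proof. by rewrite /rproj /rmat -mulmxA mul_row_col mul1mx. Qed.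

Let uA : A \in unitmx. Proof. exact: posdef_unitmx. Qed.
Let uB : A + A^T \in unitmx.
Proof. by apply: posdef_unitmx; apply: posdefD => //; exact: posdef_tr. Qed.

Lemma usubE y : usubmx y = rproj y + wproj y.
Proof. by rewrite /wproj addrC subrK. Qed.

Lemma dsubE y : dsubmx y = A *m rproj y - A^T *m wproj y.
Proof.
have e : (A + A^T) *m rproj y = A^T *m usubmx y + dsubmx y.
  by rewrite -{1}(vsubmxK y) rproj_col mulKVmx.
have -> : dsubmx y = (A + A^T) *m rproj y - A^T *m usubmx y by rewrite e addrC addKr.
by rewrite usubE mulmxDl mulmxDr opprD addrA addrK.
Qed.

Lemma rproj_graph r : rproj (col_mx r (A *m r)) = r.
Proof. by rewrite rproj_col -mulmxDl [A^T + A]addrC mulKmx. Qed.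

Lemma gprojE y : gproj y = col_mx 1%:M A *m rmat *m y.
Proof. by rewrite -mulmxA mul_col_mx mul1mx. Qed.

Lemma rproj_gproj y : rproj (gproj y) = rproj y.
Proof. exact: rproj_graph. Qed.

Lemma reflmatE y : reflmat *m y = 2 *: gproj y - y.
Proof. by rewrite /reflmat mulmxBl -scalemxAl -gprojE mul1mx. Qed.

Lemma rproj_refl y : rproj (reflmat *m y) = rproj y.
Proof.
rewrite reflmatE /rproj linearB linearZ/= -/(rproj (gproj y)) rproj_gproj /rproj.
by rewrite scaler_nat mulr2n addrK.
Qed.

Lemma wproj_refl y : wproj (reflmat *m y) = - wproj y.
Proof.
rewrite /wproj rproj_refl reflmatE linearB linearZ/= col_mxKu.
by rewrite scaler_nat mulr2n opprB addrAC addrK.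
Qed.

Lemma Sform_col (r s u v : 'cV[R]_m) :
  Sform (col_mx r s) (col_mx u v) = dotv s u + dotv r v :> R.
Proof. by rewrite /Sform !col_mxKu !col_mxKd. Qed.

(** The two summands of [y] are orthogonal for [Sform], so only the one on the graph of [A]
    contributes. *)
Lemma Sform_gproj y : Sform (gproj y) y / 2 = dotv (rproj y) (A *m rproj y).
Proof.
rewrite -{2}(vsubmxK y) Sform_col usubE dsubE; move: (rproj y) (wproj y) => r w.
by rewrite !dotvDr dotvNr (dotv_mulmxr A^T) trmxK [dotv (A *m r) r]dotvC; field.
Qed.

(* Completing the square in [r]. *)
Lemma graph_quadratic (r : 'cV[R]_m) y :
  dotv (A *m r) (usubmx y) + dotv r (dsubmx y) - dotv r (A *m r) =
  dotv (rproj y) (A *m rproj y) - dotv (r - rproj y) (A *m (r - rproj y)).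
Proof.
rewrite usubE dsubE; move: (rproj y) (wproj y) => p w.
rewrite mulmxBr !dotvDl !dotvDr !dotvNl !dotvNr.
by rewrite (dotv_mulmxr A^T) trmxK [dotv (A *m r) p]dotvC; ring.
Qed.

Lemma graph_monotone : S_monotone (graph (fun u => A *m u)).
Proof.
move=> _ _ [u _ <-] [v _ <-].
rewrite opp_col_mx add_col_mx -mulmxBr Sform_col [dotv (A *m _) _]dotvC.
by rewrite addr_ge0// posdef_ge0.
Qed.

(* Test against the points [p + e (q - A p)] for small [e]. *)
Lemma graph_related p q :
  (forall r, 0 <= dotv (p - r) (q - A *m r)) -> q = A *m p.
Proof.
move=> h; apply/eqP; rewrite -subr_eq0; apply/negPn/negP => c0.
set c := q - A *m p in c0.
have n0 := dotvv_gt0 c0; have a0 := pA c0.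
set a := dotv c (A *m c) in a0; set n := dotv c c in n0.
pose e := n / (2 * a).
have e0 : 0 < e by rewrite divr_gt0// mulr_gt0.
have := h (p + e *: c).
have -> : p - (p + e *: c) = (- e) *: c by rewrite opprD addrA subrr add0r scaleNr.
have -> : q - A *m (p + e *: c) = c - e *: (A *m c).
  by rewrite mulmxDr -scalemxAr opprD addrA.
rewrite dotvZl dotvDr dotvNr dotvZr -/a -/n.
have -> : n - e * a = n / 2 by rewrite /e; field; rewrite gt_eqF.
by rewrite leNgt mulNr oppr_lt0 mulr_gt0// divr_gt0.
Qed.

Lemma Sform_sub x y (r := rproj y) :
  Sform (x - gproj y) (x - gproj y) =
  2 * dotv (usubmx x - r) (dsubmx x - A *m r).
Proof.
rewrite -{1 2}(vsubmxK x) /gproj opp_col_mx add_col_mx Sform_col.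
by rewrite [dotv (dsubmx x - _) _]dotvC; ring.
Qed.

Lemma graph_maximal : maximal_S_monotone (graph (fun u => A *m u)).
Proof.
split; first exact: graph_monotone.
move=> G' mG' sub; apply/seteqP; split => // x G'x.
exists (usubmx x) => //; rewrite -[RHS]vsubmxK; congr col_mx; apply/esym.
apply: graph_related => r.
have Gr : G' (col_mx r (A *m r)) by apply: sub; exists r.
have := mG' _ _ G'x Gr.
have -> : col_mx r (A *m r) = gproj (col_mx r (A *m r)) by rewrite /gproj rproj_graph.
by rewrite Sform_sub rproj_graph pmulr_rge0.
Qed.

Lemma psiG_graph y : psiG (graph (fun u => A *m u)) y =
  (dotv (rproj y) (A *m rproj y))%:E.
Proof.
have E (r : 'cV[R]_m) : Sform (col_mx r (A *m r)) y -
    Sform (col_mx r (A *m r)) (col_mx r (A *m r)) / 2 =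
    dotv (rproj y) (A *m rproj y) - dotv (r - rproj y) (A *m (r - rproj y)).
  rewrite -graph_quadratic -{1}(vsubmxK y) !Sform_col [dotv (A *m r) r]dotvC.
  by field.
apply/eqP; rewrite eq_le; apply/andP; split.
  apply: ge_ereal_sup => _ [_ [r _ <-] <-]; rewrite lee_fin E.
  by rewrite gerBl posdef_ge0.
apply: ereal_sup_ubound; exists (gproj y); first by exists (rproj y).
by rewrite /gproj E subrr dotv0l subr0.
Qed.

Section covariance.
Variables (Suu Suv Svv : 'M[R]_m).
Let S := block_mx Suu Suv Suv^T Svv.
Hypotheses (sSuu : Suu^T = Suu) (sSvv : Svv^T = Svv).
Hypothesis eqA : A *m Suu *m A + (A *m Suv - Suv^T *m A) = Svv.

(** Up to the factor [(A + A^T)^-1], [q1] and [q2] are the covariances of [R] with [U] and [V]. The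
    transposed equation for [A] reads [q1 A^T = q2], so [R] is uncorrelated with
    [V - A U = - (A + A^T) W]. *)
Lemma reflmat_cov : reflmat *m S *m reflmat^T = S.
Proof.
have sB : (invmx (A + A^T))^T = invmx (A + A^T).
  by rewrite trmx_inv linearD/= trmxK addrC.
have sS : S^T = S by rewrite /S tr_block_mx sSuu sSvv trmxK.
set q1 := A^T *m Suu + Suv^T; set q2 := A^T *m Suv + Svv.
have q12 : q1 *m A^T = q2.
  have e : A^T *m Suu *m A^T + (Suv^T *m A^T - A^T *m Suv) = Svv.
    rewrite -[RHS]sSvv -eqA.
    by rewrite !(linearD, linearB, linearN)/= !trmx_mul sSuu trmxK mulmxA.
  by rewrite /q2 -e [RHS]addrC -!addrA addNr addr0 /q1 mulmxDl.
have KS : rmat *m S = invmx (A + A^T) *m row_mx q1 q2.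
  by rewrite /rmat -mulmxA /S mul_row_block !mul1mx.
pose Pi := col_mx 1%:M A *m rmat.
have PSP : Pi *m S *m Pi^T = Pi *m S.
  rewrite /Pi -[_ *m rmat *m S]mulmxA KS.
  rewrite !trmx_mul sB tr_col_mx tr_row_mx trmxK !tr_scalar_mx -!mulmxA; congr (_ *m (_ *m _)).
  rewrite !mulmxA mul_row_col mulmx1 -q12 -mulmxDr mulmxK//.
  by rewrite mul_mx_row mulmx1.
exact: reflection_cov.
Qed.

End covariance.
End projection.

(** * The common upper bound for maps and plans *)

Section plan_bound.
Context (R : realType) (m : nat) (A : 'M[R]_m) (d : measure_display)
  (T : measurableType d) (P : probability T R).
Hypothesis pA : posdef A.

Definition graph_value (y : T -> 'cV[R]_(m + m)) : R :=
  Ex P (fun t => dotv (rproj A (y t)) (A *m rproj A (y t))).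

Lemma L2_rproj (y : T -> 'cV[R]_(m + m)) : L2 P y -> L2 P (fun t => rproj A (y t)).
Proof. exact: L2_lin. Qed.

Lemma L1_graph_value (y : T -> 'cV[R]_(m + m)) : L2 P y ->
  L1 P (fun t => dotv (rproj A (y t)) (A *m rproj A (y t))).
Proof. by move=> Ly; apply: L2_dotv; [|apply: L2_lin]; exact: L2_rproj. Qed.

Lemma graph_value_bound (y : T -> 'cV[R]_(m + m)) (r : T -> 'cV[R]_m) :
  L2 P y -> L2 P r ->
  let v := Ex P (fun t => dotv (A *m r t) (usubmx (y t)) +
    dotv (r t) (dsubmx (y t)) - dotv (r t) (A *m r t)) in
  v <= graph_value y /\
  (graph_value y <= v -> {ae P, forall t, r t = rproj A (y t)}).
Proof.
move=> Ly Lr v.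
have LR := L2_rproj Ly.
have LRR := L1_graph_value Ly.
pose e t := r t - rproj A (y t).
have Le : L2 P e.
  have := L2_lin (row_mx 1%:M (- 1%:M)) (L2_col Lr LR).
  congr (L2 P _); apply/funext => t.
  by rewrite mul_row_col mul1mx mulNmx mul1mx.
have Lq : L1 P (fun t => dotv (e t) (A *m e t)) by apply: L2_dotv => //; exact: L2_lin.
have vE : v = graph_value y - Ex P (fun t => dotv (e t) (A *m e t)).
  by rewrite /v /graph_value -ExB//; congr Ex; apply/funext => t; exact: graph_quadratic.
have q0 : 0 <= Ex P (fun t => dotv (e t) (A *m e t)).
  by apply: Ex_ge0 => t; exact: posdef_ge0.
split; first by rewrite vE gerBl.
rewrite vE => h.
have E0 : Ex P (fun t => dotv (e t) (A *m e t)) = 0 by lra.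
have := Ex_ge0_eq0 Lq (aeW _ (fun t => posdef_ge0 _ pA)) E0.
apply: filterS => t /(posdef_eq0 pA)/eqP; rewrite subr_eq0 => /eqP //.
Qed.

(** With [x = (p, q)], the conditional expectation property turns the value into [E <p, q>]. Both
    [r = p] and [r = A^-1 q], inserted in [graph_value_bound], give this same number. In the
    equality case the first choice identifies [p] and the second identifies [q]. *)
Lemma plan_bound (x y : T -> 'cV[R]_(m + m)) : L2 P x -> L2 P y ->
  (forall B, measurable B -> forall i,
    Ex P (fun t => (y t i ord0 - x t i ord0) * \1_B (x t)) = 0) ->
  Ex P (fun t => Sform (x t) (y t) / 2) <= graph_value y /\
  (graph_value y <= Ex P (fun t => Sform (x t) (y t) / 2) ->
    {ae P, forall t, x t = gproj A (y t)}).
Proof.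
move=> Lx Ly Exy.
have uA := posdef_unitmx pA.
pose p t := usubmx (x t); pose q t := dsubmx (x t).
pose u t := usubmx (y t); pose v t := dsubmx (y t).
have Lp : L2 P p by exact: L2_usub. have Lq : L2 P q by exact: L2_dsub.
have Lu : L2 P u by exact: L2_usub. have Lv : L2 P v by exact: L2_dsub.
have E0 i (M : 'M[R]_(m, m + m)) j :
    Ex P (fun t => (y t i ord0 - x t i ord0) * (M *m x t) j ord0) = 0.
  have LM := L2_lin M Lx.
  have L1i := L1B (L2_coord i Ly) (L2_coord i Lx).
  apply: Ex_mul_eq0 => //.
  - exact: ((measurable_cVP _).1 LM.1).
  - have := L1B (L2_coordM i j Ly LM) (L2_coordM i j Lx LM).
    by congr (L1 P _); apply/funext => t; rewrite mulrBl.
  - move=> B mB.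
    have mB' : measurable [set z : 'cV[R]_(m + m) | B ((M *m z) j ord0)].
      have mz : measurable_fun setT (fun z : 'cV[R]_(m + m) => M *m z).
        exact: measurable_cst_mulmx.
      have := (measurable_cVP _).1 mz j measurableT B mB.
      by rewrite setTI.
    exact: (Exy _ mB' i).
have Eu (M : 'M[R]_(m, m + m)) :
    Ex P (fun t => dotv (M *m x t) (u t)) = Ex P (fun t => dotv (M *m x t) (p t)).
  have LM := L2_lin M Lx.
  apply/eqP; rewrite -subr_eq0 -ExB; [|exact: L2_dotv|exact: L2_dotv].
  rewrite (_ : (fun t => _) = (fun t => \sum_i (y t (lshift m i) ord0 - x t (lshift m i) ord0) * (M *m x t) i ord0)).
    rewrite Ex_sum ?big1// => i.
    have := L1B (L2_coordM (lshift m i) i Ly LM) (L2_coordM (lshift m i) i Lx LM).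
    by congr (L1 P _); apply/funext => t; rewrite mulrBl.
  apply/funext => t; rewrite -dotvNr -dotvDr dotvE; apply: eq_bigr => i _.
  by rewrite cVBE [usubmx _ _ _]mxE [usubmx _ _ _]mxE mulrC.
have Ev (M : 'M[R]_(m, m + m)) :
    Ex P (fun t => dotv (M *m x t) (v t)) = Ex P (fun t => dotv (M *m x t) (q t)).
  have LM := L2_lin M Lx.
  apply/eqP; rewrite -subr_eq0 -ExB; [|exact: L2_dotv|exact: L2_dotv].
  rewrite (_ : (fun t => _) = (fun t => \sum_i (y t (rshift m i) ord0 - x t (rshift m i) ord0) * (M *m x t) i ord0)).
    rewrite Ex_sum ?big1// => i.
    have := L1B (L2_coordM (rshift m i) i Ly LM) (L2_coordM (rshift m i) i Lx LM).
    by congr (L1 P _); apply/funext => t; rewrite mulrBl.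
  apply/funext => t; rewrite -dotvNr -dotvDr dotvE; apply: eq_bigr => i _.
  by rewrite cVBE [dsubmx _ _ _]mxE [dsubmx _ _ _]mxE mulrC.
have pM (M : 'M[R]_m) t : M *m p t = row_mx M 0 *m x t.
  by rewrite -[in RHS](vsubmxK (x t)) mul_row_col mul0mx addr0.
have qM (M : 'M[R]_m) t : M *m q t = row_mx 0 M *m x t.
  by rewrite -[in RHS](vsubmxK (x t)) mul_row_col mul0mx add0r.
have Epu (M : 'M[R]_m) : Ex P (fun t => dotv (M *m p t) (u t)) = Ex P (fun t => dotv (M *m p t) (p t)).
  by under eq_fun do rewrite pM; rewrite Eu; under eq_fun do rewrite -pM.
have Epv (M : 'M[R]_m) : Ex P (fun t => dotv (M *m p t) (v t)) = Ex P (fun t => dotv (M *m p t) (q t)).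
  by under eq_fun do rewrite pM; rewrite Ev; under eq_fun do rewrite -pM.
have Equ (M : 'M[R]_m) : Ex P (fun t => dotv (M *m q t) (u t)) = Ex P (fun t => dotv (M *m q t) (p t)).
  by under eq_fun do rewrite qM; rewrite Eu; under eq_fun do rewrite -qM.
have Eqv (M : 'M[R]_m) : Ex P (fun t => dotv (M *m q t) (v t)) = Ex P (fun t => dotv (M *m q t) (q t)).
  by under eq_fun do rewrite qM; rewrite Ev; under eq_fun do rewrite -qM.
have Epv1 : Ex P (fun t => dotv (p t) (v t)) = Ex P (fun t => dotv (p t) (q t)).
  by have := Epv 1%:M; congr (_ = _); congr Ex; apply/funext => t; rewrite mul1mx.
have Equ1 : Ex P (fun t => dotv (q t) (u t)) = Ex P (fun t => dotv (q t) (p t)).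
  by have := Equ 1%:M; congr (_ = _); congr Ex; apply/funext => t; rewrite mul1mx.
have pqC : Ex P (fun t => dotv (q t) (p t)) = Ex P (fun t => dotv (p t) (q t)).
  by congr Ex; apply/funext => t; rewrite dotvC.
have SE : Ex P (fun t => Sform (x t) (y t) / 2) = Ex P (fun t => dotv (p t) (q t)).
  transitivity (2^-1 * (Ex P (fun t => dotv (q t) (u t)) + Ex P (fun t => dotv (p t) (v t)))).
    rewrite -ExD; [|exact: L2_dotv|exact: L2_dotv].
    rewrite -ExZ; last by apply: L1D; exact: L2_dotv.
    by congr Ex; apply/funext => t; rewrite /Sform mulrC.
  by rewrite Equ1 Epv1 pqC; field.
have LAp : L2 P (fun t => A *m p t) by exact: L2_lin.
have Liq : L2 P (fun t => invmx A *m q t) by exact: L2_lin.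
have [b1 e1] := graph_value_bound Ly Lp.
have [b2 e2] := graph_value_bound Ly Liq.
have v1 : Ex P (fun t => dotv (A *m p t) (usubmx (y t)) +
    dotv (p t) (dsubmx (y t)) - dotv (p t) (A *m p t)) = Ex P (fun t => dotv (p t) (q t)).
  rewrite ExB; [|by apply: L1D; exact: L2_dotv|exact: L2_dotv].
  rewrite ExD; [|exact: L2_dotv|exact: L2_dotv].
  rewrite Epu Epv1 (_ : (fun t => dotv (p t) (A *m p t)) = (fun t => dotv (A *m p t) (p t))).
    by rewrite addrAC subrr add0r.
  by apply/funext => t; rewrite dotvC.
have v2 : Ex P (fun t => dotv (A *m (invmx A *m q t)) (usubmx (y t)) +
    dotv (invmx A *m q t) (dsubmx (y t)) - dotv (invmx A *m q t) (A *m (invmx A *m q t))) =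
    Ex P (fun t => dotv (p t) (q t)).
  under eq_fun do rewrite mulKVmx//.
  rewrite ExB; [|by apply: L1D; exact: L2_dotv|exact: L2_dotv].
  rewrite ExD; [|exact: L2_dotv|exact: L2_dotv].
  by rewrite Equ1 Eqv addrK pqC.
rewrite SE; split; first by rewrite -v1.
move=> h.
have ae1 := e1 ltac:(by rewrite v1).
have ae2 := e2 ltac:(by rewrite v2).
apply: filterS2 ae1 ae2 => t h1 h2.
rewrite -[LHS]vsubmxK /gproj; congr col_mx; first exact: h1.
by rewrite -h2 mulKVmx.
Qed.

End plan_bound.

(** * The functions psi_G *)

Section psiG_theory.
Context (R : realType).

Lemma open_cV_measurable n (O : set 'cV[R]_n) :
  (forall y, O y -> exists2 e : R, 0 < e &
    forall z : 'cV[R]_n, (forall i, `|z i ord0 - y i ord0| < e) -> O z) ->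
  measurable O.
Proof.
move=> hO.
pose box (qk : 'cV[rat]_n * nat) : set 'cV[R]_n :=
  [set z | forall i, `|z i ord0 - ratr (qk.1 i ord0)| < qk.2.+1%:R^-1].
pose F qk : set 'cV[R]_n := if `[< box qk `<=` O >] then box qk else set0.
have mbox qk : measurable (box qk).
  rewrite [X in measurable X](_ : _ = \bigcap_(i in [set: 'I_n])
     [set z : 'cV[R]_n | `|z i ord0 - ratr (qk.1 i ord0)| < qk.2.+1%:R^-1]).
    apply: fin_bigcap_measurable => // i _.
    have mf : measurable_fun setT (fun z : 'cV[R]_n => `|z i ord0 - ratr (qk.1 i ord0)|).
      apply: measurableT_comp => //; apply: measurable_funB => //.
      exact: measurable_coord.
    have := mf measurableT _ (measurable_itv `]-oo, (qk.2.+1%:R^-1 : R)[).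
    by rewrite setTI; congr measurable; apply/seteqP; split => x /=; rewrite in_itv.
  by apply/seteqP; split => x hx i //=; exact: hx.
have -> : O = \bigcup_qk F qk.
  apply/seteqP; split => y; last first.
    by move=> [qk _]; rewrite /F; case: asboolP => // h /h.
  move=> Oy; have [e e0 he] := hO y Oy.
  (* The rational center is within one radius of [y], so points of the box are within two radii. *)
  have [k hk] : exists k : nat, k.+1%:R^-1 < e / 2.
    have e20 : 0 < e / 2 by rewrite divr_gt0.
    exists (Num.bound (e / 2)^-1); rewrite -[ltRHS]invrK ltf_pV2 ?posrE ?invr_gt0//.
    apply: lt_le_trans (archi_boundP _) _; first by rewrite invr_ge0 ltW.
    by rewrite ler_nat.
  have k0 : 0 < k.+1%:R^-1 :> R by rewrite invr_gt0.
  have ex i : exists q : rat, `|y i ord0 - ratr q| < k.+1%:R^-1.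
    have hlt : y i ord0 - k.+1%:R^-1 < y i ord0 + k.+1%:R^-1.
      by rewrite ltrBlDr -addrA ltrDl addr_gt0.
    have [q] := rat_in_itvoo hlt.
    by rewrite in_itv/= => hq; exists q; rewrite distrC ltr_distl.
  have /choice[q hq] := ex.
  exists (\col_i q i, k) => //; rewrite /F.
  have yb : box (\col_i q i, k) y by move=> i /=; rewrite mxE.
  case: asboolP => // -[]; move=> z hz; apply: he => i.
  have := hz i; have := yb i; rewrite /= mxE => h1 h2.
  rewrite (_ : z i ord0 - y i ord0 = (z i ord0 - ratr (q i)) - (y i ord0 - ratr (q i))); last by ring.
  rewrite (le_lt_trans (ler_normB _ _))//.
  by move: h1 h2 hk; move: (k.+1%:R^-1 : R) => ep; lra.
apply: countable_bigcupT_measurable; first exact: countableP.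
by move=> qk; rewrite /F; case: asboolP.
Qed.

Variable m : nat.
Implicit Types (G : set 'cV[R]_(m + m)) (x y : 'cV[R]_(m + m)).

Let svec x : 'cV[R]_(m + m) := col_mx (dsubmx x) (usubmx x).

Let SformE x y : Sform x y = dotv (svec x) y.
Proof.
rewrite -{2}(vsubmxK y) /Sform /svec /dotv tr_col_mx mul_row_col [RHS]mxE.
by [].
Qed.

Lemma SformDr x y z : Sform x (y + z) = Sform x y + Sform x z.
Proof. by rewrite !SformE dotvDr. Qed.

Lemma SformZr k x y : Sform x (k *: y) = k * Sform x y.
Proof. by rewrite !SformE dotvZr. Qed.

Lemma SformNr x y : Sform x (- y) = - Sform x y.
Proof. by rewrite !SformE dotvNr. Qed.

Lemma SformC x y : Sform x y = Sform y x.
Proof. by rewrite /Sform addrC [dotv (usubmx x) _]dotvC [dotv (dsubmx x) _]dotvC. Qed.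

Lemma Sform_sqrB x y :
  Sform (x - y) (x - y) = Sform x x - 2 * Sform x y + Sform y y.
Proof.
rewrite SformDr SformNr ![Sform (x - y) _]SformC !SformDr !SformNr [Sform y x]SformC.
by ring.
Qed.

(** The supremum is over an arbitrary set, possibly uncountable. As a supremum of continuous
    functions it is lower semicontinuous, and its strict superlevel sets are open. *)
Lemma measurable_psiG G : measurable_fun setT (psiG G).
Proof.
apply: (measurability _ (ErealGenOInfty.measurableE R)) => _ [_ [r ->] <-].
rewrite setTI; apply: open_cV_measurable => y /=.
rewrite in_itv/= andbT => /ereal_sup_gt[_ [x Gx <-]]; rewrite lte_fin => hx.
have cS : continuous (fun y => Sform x y - Sform x x / 2).
  rewrite (_ : (fun y => _) =
      (fun y => - (Sform x x / 2) - \sum_i (- svec x i ord0) * y i ord0)).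
    apply: continuous_subr_cst; apply: continuous_sumr => i.
    by apply: continuous_prodr; [exact: cst_continuous|exact: coord_continuous].
  apply/funext => z; rewrite SformE dotvE addrC; congr (_ + _); rewrite -sumrN.
  by apply: eq_bigr => i _; rewrite mulNr opprK.
have : nbhs y [set z | r < Sform x z - Sform x x / 2].
  by apply: (@cvgr_gt _ _ _ _ (fun y => Sform x y - Sform x x / 2) _ (cS y) r).
move=> /nbhs_ballP[e /= e0 he]; exists e => // z hz /=.
rewrite in_itv/= andbT; apply: (@lt_le_trans _ _ (Sform x z - Sform x x / 2)%:E).
  rewrite lte_fin; apply: he; split => // i j; rewrite ord1 /ball/= distrC.
  exact: hz.
by apply: ereal_sup_ubound; exists x.
Qed.

(** [psiG] is the Fitzpatrick function of [G]. The bound at [y] says exactly that [y] is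
    monotonically related to every point of [G], and maximality then puts it in [G]. *)
Lemma psiG_le_in G y : maximal_S_monotone G ->
  (psiG G y <= (Sform y y / 2)%:E)%E -> G y.
Proof.
move=> [mG maxG] h.
have rel x : G x -> 0 <= Sform (x - y) (x - y).
  move=> Gx; have : ((Sform x y - Sform x x / 2)%:E <= (Sform y y / 2)%:E)%E.
    by apply: le_trans h; apply: ereal_sup_ubound; exists x.
  by rewrite lee_fin Sform_sqrB; lra.
rewrite -(maxG (G `|` [set y])); first by right.
  have S0 : Sform (0 : 'cV[R]_(m + m)) 0 = 0 by rewrite SformE dotv0r.
  move=> a b [Ga|->] [Gb|->]; [exact: mG|exact: rel| |by rewrite subrr S0].
  have := rel _ Gb; by rewrite -opprB SformNr SformC SformNr opprK.
by left.
Qed.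

Lemma psiG_ge G y : maximal_S_monotone G ->
  ((Sform y y / 2)%:E <= psiG G y)%E.
Proof.
move=> mG; rewrite leNgt; apply/negP => h.
have Gy := psiG_le_in mG (ltW h).
have : ((Sform y y - Sform y y / 2)%:E <= psiG G y)%E.
  by apply: ereal_sup_ubound; exists y.
rewrite leNgt => /negP; apply; apply: lt_le_trans h _.
by rewrite lee_fin; lra.
Qed.

Lemma psiG_mid G y z (a b : R) :
  psiG G y = a%:E -> psiG G z = b%:E ->
  (psiG G (2^-1 *: (y + z)) <= (2^-1 * (a + b))%:E)%E.
Proof.
move=> ha hb; apply: ge_ereal_sup => _ [x Gx <-]; rewrite lee_fin.
have : ((Sform x y - Sform x x / 2)%:E <= a%:E)%E.
  by rewrite -ha; apply: ereal_sup_ubound; exists x.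
have : ((Sform x z - Sform x x / 2)%:E <= b%:E)%E.
  by rewrite -hb; apply: ereal_sup_ubound; exists x.
by rewrite !lee_fin SformZr SformDr; lra.
Qed.

End psiG_theory.

Section integral_aux.
Context (R : realType) (d : measure_display) (T : measurableType d)
  (P : probability T R).

(** The minorant keeps the integral of the negative part finite, so an infinite positive part would
    make the whole integral infinite. *)
Lemma integrable_lower_bound (f : T -> \bar R) (h : T -> R) :
  measurable_fun setT f -> L1 P h -> (forall t, (h t)%:E <= f t)%E ->
  (\int[P]_t f t < +oo)%E -> P.-integrable setT f.
Proof.
move=> mf Lh hf If.
have neg : (\int[P]_t f^\- t < +oo)%E.
  apply: (@le_lt_trans _ _ (\int[P]_t (`|h t|)%:E)%E); last first.
    by rewrite ExE ?ltry//; exact: L1_normr.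
  apply: ge0_le_integral => //=.
  - exact: measurable_funeneg.
  - by apply/measurable_EFinP; apply: measurableT_comp => //; exact: L1_measurable Lh.
  - move=> t _; rewrite funenegE ge_max lee_fin normr_ge0 andbT leeNl.
    apply: le_trans (hf t); rewrite -EFinN lee_fin lerNl.
    by rewrite -normrN ler_norm.
have pos : (\int[P]_t f^\+ t < +oo)%E.
  rewrite ltNge leye_eq; apply/negP => /eqP e.
  have [r hr] : exists r, (\int[P]_t f^\- t = r%:E)%E.
    exists (fine (\int[P]_t f^\- t)%E); rewrite fineK// ge0_fin_numE//.
    by apply: integral_ge0 => t _; exact: funeneg_ge0.
  by move: If; rewrite integralE e hr -EFinN addye// ltxx.
apply/integrableP; split => //.
rewrite -[fun x => _]/(abse \o f) fune_abse ge0_integralD//.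
- by rewrite lte_add_pinfty.
- exact: measurable_funepos.
- exact: measurable_funeneg.
Qed.

Lemma integral_set_eqP (D : set T) (f g : T -> R) : measurable D ->
  L1 P f -> L1 P g ->
  (\int[P]_(t in D) (f t)%:E = \int[P]_(t in D) (g t)%:E)%E <->
  Ex P (fun t => (f t - g t) * \1_D t) = 0.
Proof.
move=> mD Lf Lg.
have Lf1 : L1 P (fun t => f t * \1_D t).
  by apply: (@L1M_bnd _ _ _ P f (\1_D) 1 Lf) => [|t]; [exact: measurable_indic|exact: indic_le1].
have Lg1 : L1 P (fun t => g t * \1_D t).
  by apply: (@L1M_bnd _ _ _ P g (\1_D) 1 Lg) => [|t]; [exact: measurable_indic|exact: indic_le1].
rewrite (integral_set_indic P D f) (integral_set_indic P D g) (ExE Lf1) (ExE Lg1).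
under [fun t => (_ - _) * _]eq_fun do rewrite mulrBl.
rewrite ExB//; split => [[->]|/eqP]; first by rewrite subrr.
by rewrite subr_eq0 => /eqP ->.
Qed.

End integral_aux.

(** * Optimality and equilibrium *)

Lemma mom2_col (R : realType) (d : measure_display) (T : measurableType d)
    (P : probability T R) n p (U : T -> 'cV[R]_n) (V : T -> 'cV[R]_p) :
  let Y t := col_mx (U t) (V t) in
  mom2 P Y Y = block_mx (mom2 P U U) (mom2 P U V) (mom2 P V U) (mom2 P V V).
Proof.
move=> Y; apply/matrixP => i j.
case: (split_ordP i) => i' ->; case: (split_ordP j) => j' ->;
  rewrite ?block_mxEul ?block_mxEur ?block_mxEdl ?block_mxEdr !mxE;
  congr fine; apply: eq_integral => t _; rewrite /Y ?col_mxEu ?col_mxEd//.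
Qed.

Lemma cVNE (R : realType) n (x : 'cV[R]_n) i : (- x) i ord0 = - x i ord0.
Proof. by rewrite mxE. Qed.

Lemma measure_ae_eq (R : realType) (d : measure_display) (T : measurableType d)
    (P : probability T R) (A B : set T) : measurable A -> measurable B ->
  {ae P, forall t, A t <-> B t} -> P A = P B.
Proof.
move=> mA mB AB.
transitivity (\int[P]_t (\1_A t)%:E)%E; first by rewrite integral_indic// setIT.
transitivity (\int[P]_t (\1_B t)%:E)%E; last by rewrite integral_indic// setIT.
apply: ae_eq_integral => //; [exact/measurable_EFinP|exact/measurable_EFinP|].
apply: filterS AB => t [h1 h2] _; rewrite !indicE; congr (_%:R%:E); congr nat_of_bool.
by apply/idP/idP => /set_mem h; apply/mem_set; [exact: h1|exact: h2].
Qed.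

Lemma Ex_ae_ge0 (R : realType) (d : measure_display) (T : measurableType d)
    (P : probability T R) (f : T -> R) : measurable_fun setT f ->
  {ae P, forall t, 0 <= f t} -> 0 <= Ex P f.
Proof.
move=> mf f0; rewrite (@Ex_ae_eq _ _ _ P f (fun t => `|f t|))//.
- exact: Ex_ge0.
- exact: measurableT_comp.
- by apply: filterS f0 => t /ger0_norm.
Qed.

(** With [x = (r, w)] and [y = (u, v)], the gain is [Sform x y - Sform x x / 2 - <u, v>]. Maximizing
    it over [r] is the supremum that defines [psiG] for the graph of the pricing rule. *)
Lemma insider_gain (R : realType) n (r u v w : 'cV[R]_n) :
  dotv (r - u) (v - w) = dotv w u + dotv r v - dotv r w - dotv u v.
Proof.
by rewrite !dotvDl !dotvDr !dotvNl !dotvNr [dotv w u]dotvC; ring.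
Qed.

Lemma ae_preimage (R : realType) (d d' : measure_display) (T : measurableType d)
    (S : measurableType d') (P : probability T R) (Y Y' : T -> S) (E : set S) :
  measurable_fun setT Y -> measurable_fun setT Y' ->
  (forall B, measurable B -> P (Y' @^-1` B) = P (Y @^-1` B)) ->
  measurable E -> {ae P, forall t, E (Y t)} -> {ae P, forall t, E (Y' t)}.
Proof.
move=> mY mY' eqYY mE [N [mN N0 sub]].
have mEC : measurable (~` E) by exact: measurableC.
have m1 : measurable (Y @^-1` ~` E) by rewrite -[Z in measurable Z]setTI; exact: mY.
have m2 : measurable (Y' @^-1` ~` E) by rewrite -[Z in measurable Z]setTI; exact: mY'.
exists (Y' @^-1` ~` E); split => //.
rewrite eqYY//; apply/eqP; rewrite -measure_le0 -N0.
by apply: le_measure; rewrite ?inE.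
Qed.

(** * Optimal maps, plans, dual sets and equilibria for Gaussian data *)

Section gaussian_problem.
Context (R : realType) (d : measure_display) (T : measurableType d)
  (P : probability T R) (m : nat) (U V : T -> 'cV[R]_m) (A : 'M[R]_m).
Let Y t : 'cV[R]_(m + m) := col_mx (U t) (V t).
Hypotheses (LU : L2 P U) (LV : L2 P V) (gY : nondeg_centered_gaussian P Y).
Hypotheses (pA : posdef A)
  (eqA : A *m mom2 P U U *m A + (A *m mom2 P U V - mom2 P V U *m A) = mom2 P V V).
Local Notation Rv t := (rproj A (Y t)).
Local Notation Xv t := (gproj A (Y t)).
Let Y' t := reflmat A *m Y t.

Let LY : L2 P Y. Proof. exact: L2_col. Qed.
Let mY : measurable_fun setT Y. Proof. exact: LY.1. Qed.
Let mY' : measurable_fun setT Y'. Proof. exact: measurable_cst_mulmx. Qed.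
Let LR : L2 P (fun t => Rv t). Proof. exact: L2_rproj. Qed.
Let uA : A \in unitmx. Proof. exact: posdef_unitmx. Qed.

Let sqrtS : exists Q : 'M[R]_(m + m),
  [/\ Q^T = Q, Q \in unitmx & Q *m Q = mom2 P Y Y].
Proof.
have [sQ [pQ QQ]] := msqrtP (mom2_tr P Y Y) gY.1.
by exists (msqrt (mom2 P Y Y)); split => //; exact: posdef_unitmx.
Qed.

Let law_refl E : measurable E -> P (Y' @^-1` E) = P (Y @^-1` E).
Proof.
have [Q [sQ uQ QQ]] := sqrtS.
move=> mE; apply: (gaussian_law_invariant mY gY.2 sQ uQ QQ) => //.
rewrite mom2_col -(mom2_tr P U V); apply: reflmat_cov => //.
- exact: mom2_tr.
- exact: mom2_tr.
- by rewrite (mom2_tr P U V).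
Qed.

Let refl_Ex (g : 'cV[R]_(m + m) -> R) : measurable_fun setT g ->
  L1 P (fun t => g (Y t)) ->
  L1 P (fun t => g (Y' t)) /\ Ex P (fun t => g (Y' t)) = Ex P (fun t => g (Y t)).
Proof.
move=> mg Lg.
have eql E : measurable E -> law P mY E = law P mY' E by move=> mE; apply/esym/law_refl.
have L := (L1_law P mY' mg).1 (eq_measure_L1 eql ((L1_law P mY mg).2 Lg)).
split=> //.
rewrite -[LHS](Ex_law mY' mg L) -[RHS](Ex_law mY mg Lg).
by apply/esym/eq_measure_Ex.
Qed.

Let refl_ae (E : set 'cV[R]_(m + m)) : measurable E ->
  {ae P, forall t, E (Y t)} -> {ae P, forall t, E (Y' t)}.
Proof. by move=> mE; apply: ae_preimage => //; exact: law_refl. Qed.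

(** Full support upgrades the almost sure inequality to all values of [y]. On the graph [R] takes
    every value [r], so [graph_related] applies. *)
Lemma related_ae (p q : 'cV[R]_m) :
  {ae P, forall t, 0 <= dotv (p - Rv t) (q - A *m Rv t)} -> q = A *m p.
Proof.
move=> h; have [Q [sQ uQ QQ]] := sqrtS.
pose g (y : 'cV[R]_(m + m)) := dotv (p - rmat A *m y) (q - (A *m rmat A) *m y).
have cg : continuous g by exact: continuous_dotv_affine.
have g0 : forall y, 0 <= g y.
  apply: (gaussian_full_support mY gY.2 sQ uQ QQ) => //.
  by apply: filterS h => t; rewrite /g /rproj -mulmxA.
apply: (graph_related pA) => r; have := g0 (col_mx r (A *m r)).
by rewrite /g -mulmxA -/(rproj A _) rproj_graph.
Qed.

Let mrproj : measurable_fun setT (rproj A).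
Proof. exact: measurable_cst_mulmx. Qed.

Let mgproj : measurable_fun setT (gproj A).
Proof. by apply: measurable_col_mx => //; exact: measurable_cst_mulmx. Qed.

Let mwproj : measurable_fun setT (wproj A).
Proof.
apply: measurable_cVD; first exact: measurable_usubmx.
exact: measurable_cVN.
Qed.

Let LW : L2 P (fun t => wproj A (Y t)).
Proof.
have := L2_lin (row_mx 1%:M (- 1%:M)) (L2_col LU LR).
congr (L2 P _); apply/funext => t.
by rewrite mul_row_col mul1mx mulNmx mul1mx /wproj col_mxKu.
Qed.

(* The reflection preserves the law of Y, fixes R and changes the sign of W. *)
Let Ex_wproj (B : set 'cV[R]_m) i : measurable B ->
  Ex P (fun t => wproj A (Y t) i ord0 * \1_B (Rv t)) = 0.
Proof.
move=> mB; pose g y := wproj A y i ord0 * \1_B (rproj A y).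
have mind : measurable_fun setT (fun y => \1_B (rproj A y) : R).
  by apply: measurableT_comp => //; exact: measurable_indic.
have mg : measurable_fun setT g.
  by apply: measurable_funM => //; exact: ((measurable_cVP _).1 mwproj).
have Lg : L1 P (fun t => g (Y t)).
  apply: (@L1M_bnd _ _ _ P _ _ 1 (L2_coord i LW)) => [|t]; last exact: indic_le1.
  exact: (measurableT_comp mind mY).
have [Lg' e] := refl_Ex mg Lg.
have : Ex P (fun t => g (Y t)) = - Ex P (fun t => g (Y t)).
  rewrite -ExN// -[LHS]e; congr Ex; apply/funext => t.
  by rewrite /g /Y' rproj_refl// wproj_refl// cVNE mulNr.
rewrite -/(g _) => h; change (Ex P (fun t => g (Y t)) = 0); lra.
Qed.

Let YX t : Y t - Xv t = col_mx (wproj A (Y t)) (- (A^T *m wproj A (Y t))).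
Proof.
rewrite -{1}(vsubmxK (Y t)) /gproj opp_col_mx add_col_mx; congr col_mx.
by rewrite (dsubE pA) addrAC subrr add0r.
Qed.

Let LX : L2 P (fun t => Xv t).
Proof. by apply: L2_col => //; exact: L2_lin. Qed.

(** [X] is a function of [R] and [Y - X = (W, - A^T W)] is linear in [W], so everything reduces to
    [Ex_wproj]. *)
Let Ex_YX (B : set 'cV[R]_(m + m)) i : measurable B ->
  Ex P (fun t => (Y t i ord0 - Xv t i ord0) * \1_B (Xv t)) = 0.
Proof.
move=> mB.
pose B' : set 'cV[R]_m := [set r | B (col_mx r (A *m r))].
have mB' : measurable B'.
  have mf : measurable_fun setT (fun r : 'cV[R]_m => col_mx r (A *m r)).
    by apply: measurable_col_mx => //; exact: measurable_cst_mulmx.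
  by have := mf measurableT B mB; rewrite setTI.
have LWB j : L1 P (fun t => wproj A (Y t) j ord0 * \1_B' (Rv t)).
  apply: (@L1M_bnd _ _ _ P _ _ 1 (L2_coord j LW)) => [|t]; last exact: indic_le1.
  apply: (measurableT_comp _ LR.1); exact: measurable_indic.
case: (split_ordP i) => j ->.
  rewrite -[RHS](Ex_wproj j mB'); congr Ex; apply/funext => t; congr (_ * _).
  by rewrite -cVBE YX col_mxEu.
transitivity (Ex P (fun t => \sum_k (- A k j) * (wproj A (Y t) k ord0 * \1_B' (Rv t)))).
  congr Ex; apply/funext => t; rewrite -cVBE YX col_mxEd.
  rewrite cVNE mxE -sumrN mulr_suml; apply: eq_bigr => k _.
  by rewrite mxE -!mulNr mulrA.
rewrite Ex_sum; last by move=> k; exact: L1Z.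
by apply: big1 => k _; rewrite ExZ// Ex_wproj// mulr0.
Qed.

Lemma map_value_gproj : map_value P Y (fun t => Xv t) = (graph_value A P Y)%:E.
Proof.
rewrite /graph_value -ExE; last exact: L1_graph_value.
by apply: eq_integral => t _; rewrite Sform_gproj.
Qed.

Lemma admissible_gproj : admissible_map P Y (fun t => Xv t).
Proof.
split => //.
  by exists (gproj A); split => //; exact: aeW.
split.
- by move=> i; exact: (L2_coord i LY).
- by move=> i; exact: (L2_coord i LX).
- by exists id; split => //; exact: aeW.
- move=> B mB i; apply/(integral_set_eqP _ (L2_coord i LY) (L2_coord i LX)).
    by rewrite -[Z in measurable Z]setTI; exact: LX.1.
  exact: Ex_YX.
Qed.

Let L1_Sform (d' : measure_display) (T' : measurableType d') (Q : probability T' R)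
    (x y : T' -> 'cV[R]_(m + m)) : L2 Q x -> L2 Q y ->
  L1 Q (fun t => Sform (x t) (y t) / 2).
Proof.
move=> Lx Ly; under eq_fun do rewrite mulrC.
apply: L1Z; apply: L1D; apply: L2_dotv; do ?exact: L2_usub; exact: L2_dsub.
Qed.

Let map_bound X' : admissible_map P Y X' ->
  (map_value P Y X' <= (graph_value A P Y)%:E)%E /\
  ((graph_value A P Y)%:E <= map_value P Y X' ->
    {ae P, forall t, X' t = Xv t})%E.
Proof.
move=> [LX' _ [_ _ _ hX']].
rewrite /map_value (ExE (L1_Sform LX' LY)) !lee_fin.
apply: plan_bound => // B mB i.
apply/(integral_set_eqP _ (L2_coord i LY) (L2_coord i LX')) => //.
  by rewrite -[Z in measurable Z]setTI; exact: LX'.1.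
exact: hX'.
Qed.

Lemma optimal_map_gproj : optimal_map P Y (fun t => Xv t).
Proof.
split; first exact: admissible_gproj.
by move=> X' /map_bound[]; rewrite map_value_gproj.
Qed.

Lemma optimal_map_uniq X' : optimal_map P Y X' -> {ae P, forall t, X' t = Xv t}.
Proof.
move=> [aX' oX']; have [_] := map_bound aX'; apply.
by rewrite -map_value_gproj; apply: oX'; exact: admissible_gproj.
Qed.

Let mXY : measurable_fun setT (fun t => (Xv t, Y t)).
Proof. by apply: measurable_fun_pair => //; exact: LX.1. Qed.

Let gam0 : probability ('cV[R]_(m + m) * 'cV[R]_(m + m))%type R := law P mXY.

Let plan_L2 gam : admissible_plan P Y gam -> L2 gam fst /\ L2 gam snd.
Proof. by move=> [h1 h2 _ _]; split; split. Qed.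

Let graph_value_plan gam : admissible_plan P Y gam ->
  graph_value A gam snd = graph_value A P Y.
Proof.
move=> agam; have [L1g L2g] := plan_L2 agam; have [_ _ hm _] := agam.
have mg : measurable_fun setT (fun y => dotv (rproj A y) (A *m rproj A y)).
  by apply: measurable_dotv => //; exact: measurable_cst_mulmx.
have ms : measurable_fun setT (@snd 'cV[R]_(m + m) 'cV[R]_(m + m)) by exact: measurable_snd.
rewrite /graph_value.
rewrite -[LHS](Ex_law ms mg (L1_graph_value A L2g)) -[RHS](Ex_law mY mg (L1_graph_value A LY)).
by apply: eq_measure_Ex => E mE; exact: hm.
Qed.

Let plan_bound_gam gam : admissible_plan P Y gam ->
  (plan_value gam <= (graph_value A P Y)%:E)%E /\
  ((graph_value A P Y)%:E <= plan_value gam ->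
    {ae gam, forall z, z.1 = gproj A z.2})%E.
Proof.
move=> agam; have [L1g L2g] := plan_L2 agam; have [_ _ _ hc] := agam.
rewrite -(graph_value_plan agam) /plan_value (ExE (L1_Sform L1g L2g)) !lee_fin.
apply: plan_bound => // B mB i.
apply/(integral_set_eqP _ (L2_coord i L2g) (L2_coord i L1g)) => //.
  by rewrite -[Z in measurable Z]setTI; exact: measurable_fst.
exact: hc.
Qed.

Let admissible_gam0 : admissible_plan P Y gam0.
Proof.
have mc1 i : measurable_fun setT (fun z : 'cV[R]_(m + m) * 'cV[R]_(m + m) => z.1 i ord0).
  exact: ((measurable_cVP _).1 measurable_fst).
have mc2 i : measurable_fun setT (fun z : 'cV[R]_(m + m) * 'cV[R]_(m + m) => z.2 i ord0).
  exact: ((measurable_cVP _).1 measurable_snd).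
have s1 i : L1 gam0 (fun z => z.1 i ord0 ^+ 2).
  by apply/L1_law; [exact: measurable_funX|exact: LX.2].
have s2 i : L1 gam0 (fun z => z.2 i ord0 ^+ 2).
  by apply/L1_law; [exact: measurable_funX|exact: LY.2].
split => //.
move=> B mB i.
have l1 : L1 gam0 (fun z => z.1 i ord0) by apply: L1_sqr_L1.
have l2 : L1 gam0 (fun z => z.2 i ord0) by apply: L1_sqr_L1.
have mf : measurable (@fst 'cV[R]_(m + m) 'cV[R]_(m + m) @^-1` B).
  by rewrite -[Z in measurable Z]setTI; exact: measurable_fst.
apply/(integral_set_eqP mf l2 l1).
have mind : measurable_fun setT (\1_(@fst 'cV[R]_(m + m) 'cV[R]_(m + m) @^-1` B) : _ -> R).
  exact: measurable_indic.
rewrite [LHS](Ex_law mXY); first exact: (Ex_YX i mB).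
  by apply: measurable_funM => //; exact: measurable_funB.
apply: (@L1M_bnd _ _ _ P _ _ 1 (L1B (L2_coord i LY) (L2_coord i LX))) => [|t]; last exact: indic_le1.
exact: (measurableT_comp mind mXY).
Qed.

Let plan_value_gam0 : plan_value gam0 = (graph_value A P Y)%:E.
Proof.
have [L1g L2g] := plan_L2 admissible_gam0.
rewrite -map_value_gproj /plan_value /map_value (ExE (L1_Sform L1g L2g)).
rewrite (ExE (L1_Sform LX LY)); congr (_%:E); apply: (Ex_law mXY).
  exact: L1_measurable (L1_Sform L1g L2g).
exact: (L1_Sform LX LY).
Qed.

Lemma optimal_plan_gproj :
  exists gam0 : probability ('cV[R]_(m + m) * 'cV[R]_(m + m))%type R,
      [/\ forall E, measurable E ->
            gam0 E = P ((fun t => (Xv t, Y t)) @^-1` E),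
          optimal_plan P Y gam0 &
          forall gam : probability ('cV[R]_(m + m) * 'cV[R]_(m + m))%type R,
            optimal_plan P Y gam -> forall E, measurable E -> gam E = gam0 E].
Proof.
exists gam0; split => //.
  split; first exact: admissible_gam0.
  by move=> gam /plan_bound_gam[]; rewrite plan_value_gam0.
move=> gam [agam ogam] E mE.
have [_ /(_ _)] := plan_bound_gam agam.
rewrite -plan_value_gam0 => /(_ (ogam _ admissible_gam0)) ae.
(* An optimal plan lives on the pairs [(gproj A y, y)], so its mass on [E] is read off the second
   marginal. *)
pose E' : set 'cV[R]_(m + m) := [set y | E (gproj A y, y)].
have mE' : measurable E'.
  have mp : measurable_fun setT (fun y => (gproj A y, y)) by exact: measurable_fun_pair.
  by have := mp measurableT E mE; rewrite setTI.
have mE2 : measurable (@snd 'cV[R]_(m + m) 'cV[R]_(m + m) @^-1` E').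
  by rewrite -[Z in measurable Z]setTI; exact: measurable_snd.
have -> : gam0 E = P (Y @^-1` E') by [].
have [_ _ <- // _] := agam.
apply: measure_ae_eq => //.
by apply: filterS ae => -[x y] /= ->.
Qed.


Let g0 (y : 'cV[R]_(m + m)) : R := dotv (rproj A y) (A *m rproj A y).

Let mg0 : measurable_fun setT g0.
Proof. by apply: measurable_dotv => //; exact: measurable_cst_mulmx. Qed.

Lemma dual_value_graph :
  dual_value P Y (graph (fun u => A *m u)) = (graph_value A P Y)%:E.
Proof.
change (\int[law P mY]_y psiG (graph (fun u => A *m u)) y = (graph_value A P Y)%:E)%E.
rewrite (eq_integral (fun y => (g0 y)%:E)); last by move=> y _; rewrite psiG_graph.
have Lg : L1 P (g0 \o Y) by exact: L1_graph_value.
by rewrite (ExE ((L1_law P mY mg0).2 Lg)) (Ex_law mY mg0 Lg).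
Qed.

Let mid t : Xv t = 2^-1 *: (Y t + Y' t).
Proof.
rewrite /Y' reflmatE addrC subrK scalerA mulVf ?scale1r//.
Qed.

Let SformX t : Sform (Xv t) (Xv t) / 2 = g0 (Y t).
Proof.
have := Sform_gproj pA (Xv t).
by rewrite rproj_gproj// {1}/gproj rproj_gproj.
Qed.

(** For a finite dual value, the chain is [E psi(Y) = E (psi(Y) + psi(Y')) / 2], pointwise [(psi(Y)
    + psi(Y')) / 2 >= psi(X) >= Sform X X / 2], and the last term has mean [graph_value]. Equality
    makes [psi(X) <= Sform X X / 2] almost surely, which puts [X] in [G]. *)
Let dual_bound G : maximal_S_monotone G ->
  ((graph_value A P Y)%:E <= dual_value P Y G)%E /\
  (dual_value P Y G <= (graph_value A P Y)%:E -> {ae P, forall t, G (Xv t)})%E.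
Proof.
move=> mG.
have [lt|] := ltP (dual_value P Y G) +oo%E; last first.
  by rewrite leye_eq => /eqP ->; split; [exact: leey|rewrite leye_eq].
pose mu := law P mY; pose psi := psiG G; pose phi y := fine (psi y).
have mpsi : measurable_fun setT psi by exact: measurable_psiG.
have mS : measurable_fun setT (fun y : 'cV[R]_(m + m) => Sform y y / 2).
  apply: measurable_funM => //; apply: measurable_funD; apply: measurable_dotv;
    do ?[exact: measurable_usubmx|exact: measurable_dsubmx].
have Lh : L1 mu (fun y => Sform y y / 2).
  by apply/L1_law => //; exact: L1_Sform.
have ipsi : mu.-integrable setT psi.
  by apply: (integrable_lower_bound mpsi Lh) => // y; exact: psiG_ge.
have mphi : measurable_fun setT phi by exact: measurableT_comp.
have Lphi : L1 mu phi.
  apply: le_integrable ipsi => //; first exact/measurable_EFinP.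
  by move=> y _; rewrite /phi /=; case: (psi y) => [r||] //=; rewrite ?normr0 ?leey.
(* The null set is kept explicit so that it can be pulled back along both [Y] and [Y']. *)
have [N [mN N0 Nsub]] : {ae mu, forall y, psi y \is a fin_num}.
  by have := integrable_ae measurableT ipsi; apply: filterS => y; apply.
have finY : {ae P, forall t, psi (Y t) \is a fin_num}.
  exists (Y @^-1` N); split => //; first by rewrite -[Z in measurable Z]setTI; exact: mY.
  by move=> t /= h; apply: Nsub.
have finY' : {ae P, forall t, psi (Y' t) \is a fin_num}.
  exists (Y' @^-1` N); split => //; first by rewrite -[Z in measurable Z]setTI; exact: mY'.
    by rewrite law_refl.
  by move=> t /= h; apply: Nsub.
have LY1 : L1 P (fun t => phi (Y t)) by exact: ((L1_law P mY mphi).1 Lphi).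
have [LY2 E2] := refl_Ex mphi LY1.
have dE : dual_value P Y G = (Ex P (fun t => phi (Y t)))%:E.
  have <- : Ex mu phi = Ex P (fun t => phi (Y t)) by exact: Ex_law.
  rewrite -(ExE Lphi); change (\int[mu]_y psi y = \int[mu]_y (phi y)%:E)%E.
  apply: ae_eq_integral => //; first exact/measurable_EFinP.
  by exists N; split => // y /= h; apply: Nsub => /= hf; apply: h => _; rewrite /phi fineK.
pose k t := 2^-1 * (phi (Y t) + phi (Y' t)).
have Lk : L1 P k by apply: L1Z; exact: L1D.
have Ek : Ex P k = Ex P (fun t => phi (Y t)).
  rewrite /k ExZ; last exact: L1D.
  by rewrite ExD// E2; field.
have Lq : L1 P (fun t => g0 (Y t)) by exact: L1_graph_value.
have psik : {ae P, forall t, (psi (Xv t) <= (k t)%:E)%E}.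
  apply: filterS2 finY finY' => t h1 h2; rewrite mid.
  by apply: psiG_mid; rewrite /phi fineK.
have qk : {ae P, forall t, 0 <= k t - g0 (Y t)}.
  apply: filterS psik => t h; rewrite subr_ge0 -lee_fin -SformX.
  by apply: le_trans h; exact: psiG_ge.
have Lkq : L1 P (fun t => k t - g0 (Y t)) by exact: L1B.
have Ekq : Ex P (fun t => k t - g0 (Y t)) = Ex P (fun t => phi (Y t)) - graph_value A P Y.
  by rewrite ExB// Ek.
have := Ex_ae_ge0 (L1_measurable Lkq) qk; rewrite Ekq subr_ge0 => le1.
rewrite dE !lee_fin; split => // le2.
have Ekq0 : Ex P (fun t => k t - g0 (Y t)) = 0.
  by apply/eqP; rewrite Ekq subr_eq0 eq_le le1 le2.
have ae0 := Ex_ge0_eq0 Lkq qk Ekq0.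
apply: filterS2 psik ae0 => t h /eqP; rewrite subr_eq0 => /eqP e.
by apply: psiG_le_in => //; rewrite SformX -e.
Qed.

Lemma optimal_set_graph : optimal_set P Y (graph (fun u => A *m u)).
Proof.
split; first exact: graph_maximal.
by move=> G' /dual_bound[]; rewrite dual_value_graph.
Qed.

Lemma optimal_set_uniq G : optimal_set P Y G -> G = graph (fun u => A *m u).
Proof.
move=> [mG oG]; have [_ h] := dual_bound mG.
have {h} GX : {ae P, forall t, G (Xv t)}.
  by apply: h; rewrite -dual_value_graph; apply: oG; exact: graph_maximal.
(* Maximality of [G] leaves only the inclusion of [G] in the graph: each point of [G] is almost
   surely related to [X]. *)
apply/esym; apply: mG.2; first exact: graph_monotone.
move=> x Gx; exists (usubmx x) => //; rewrite -[RHS]vsubmxK; congr col_mx; apply/esym.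
apply: related_ae; apply: filterS GX => t GXt.
by have := mG.1 _ _ Gx GXt; rewrite Sform_sub pmulr_rge0.
Qed.

Lemma equilibrium_rproj : Y_equilibrium P U V (fun t => Rv t) (fun u => A *m u).
Proof.
have LAR : L2 P (fun t => A *m Rv t) by exact: L2_lin.
split => //.
- by exists (rproj A); split => //; exact: aeW.
- exact: measurable_cst_mulmx.
- split.
  + by move=> i; exact: (L2_coord i LV).
  + by move=> i; exact: (L2_coord i LAR).
  + by exists (fun u => A *m u); split; [exact: measurable_cst_mulmx|exact: aeW].
  + move=> B mB i; apply/(integral_set_eqP _ (L2_coord i LV) (L2_coord i LAR)).
      by rewrite -[Z in measurable Z]setTI; exact: LR.1.
    pose B' : set 'cV[R]_(m + m) := [set x | B (usubmx x)].
    have mB' : measurable B'.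
      have mf : measurable_fun setT (@usubmx R m m 1) by exact: measurable_usubmx.
      by have := mf measurableT B mB; rewrite setTI.
    rewrite -[RHS](Ex_YX (rshift m i) mB'); congr Ex; apply/funext => t.
    rewrite /gproj !col_mxEd; congr (_ * _); rewrite !indicE /B'; congr (_%:R).
    congr nat_of_bool.
    by apply/idP/idP => /set_mem h; apply/mem_set; move: h; rewrite /= col_mxKu.
- apply: aeW => t r; rewrite !insider_gain lerD2r.
  have E (s : 'cV[R]_m) : dotv (A *m s) (U t) + dotv s (V t) - dotv s (A *m s) =
      dotv (Rv t) (A *m Rv t) - dotv (s - Rv t) (A *m (s - Rv t)).
    by rewrite -graph_quadratic// col_mxKu col_mxKd.
  by rewrite !E subrr dotv0l subr0 gerBl posdef_ge0.
Qed.

(** The number [E <q, U>], where [q = f' (R')], is squeezed. [graph_value_bound] at [A^-1 q] bounds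
    it above by [graph_value]. It is also [E Psi(Y)], and averaging over [Y] and [Y'] bounds that
    below by [graph_value]. The equality case of the average gives [<r - R, f' r - A R> >= 0] almost
    surely for each [r], hence [f' r = A r]; the equality case of the upper bound gives
    [A^-1 q = R]. *)
Lemma equilibrium_uniq (R' : T -> 'cV[R]_m) (f' : 'cV[R]_m -> 'cV[R]_m) :
  Y_equilibrium P U V R' f' ->
  {ae P, forall t, R' t = Rv t} /\ f' = (fun u => A *m u).
Proof.
move=> [LR' [h [mh R'h]] mf' [_ Lf1 _ hc] argmax].
have mR' := LR'.1.
pose q t := f' (R' t).
have mq : measurable_fun setT q by exact: measurableT_comp.
have mcoord (z : T -> 'cV[R]_m) : measurable_fun setT z ->
    forall i, measurable_fun setT (fun t => z t i ord0).
  by move=> mz i; exact: ((measurable_cVP _).1 mz).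
have LVq i : L1 P (fun t => V t i ord0 - q t i ord0).
  by apply: L1B; [exact: L2_coord|exact: Lf1].
have EB i (B : set 'cV[R]_m) : measurable B ->
    Ex P (fun t => (V t i ord0 - q t i ord0) * \1_B (R' t)) = 0.
  move=> mB; apply/(integral_set_eqP _ (L2_coord i LV) (Lf1 i)); last exact: hc.
  by rewrite -[Z in measurable Z]setTI; exact: mR'.
(* The equilibrium only provides integrability of [f' (R')]; square integrability is inherited from
   [V]. *)
have Lq : L2 P q.
  split => // i; apply: (cond_exp_sqr_L1 (L2_coord i LV) (LV.2 i) (Lf1 i)) => B mB.
  pose B' : set 'cV[R]_m := [set r | B (f' r i ord0)].
  have mB' : measurable B'.
    by have := (measurable_cVP _).1 mf' i measurableT B mB; rewrite setTI.
  exact: (EB i B' mB').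
have E0 i (b : 'cV[R]_m -> 'cV[R]_m) j : measurable_fun setT b ->
    L2 P (fun t => b (R' t)) ->
    Ex P (fun t => (V t i ord0 - q t i ord0) * b (R' t) j ord0) = 0.
  move=> mb Lb; apply: Ex_mul_eq0 => //.
  - by apply: mcoord; exact: Lb.1.
  - have := L1B (L2_coordM i j LV Lb) (L2_coordM i j Lq Lb).
    by congr (L1 P _); apply/funext => t; rewrite mulrBl.
  - move=> B mB; pose B' : set 'cV[R]_m := [set r | B (b r j ord0)].
    have mB' : measurable B'.
      by have := (measurable_cVP _).1 mb j measurableT B mB; rewrite setTI.
    exact: (EB i B' mB').
have Edot (b : 'cV[R]_m -> 'cV[R]_m) : measurable_fun setT b ->
    L2 P (fun t => b (R' t)) ->
    Ex P (fun t => dotv (b (R' t)) (V t)) = Ex P (fun t => dotv (b (R' t)) (q t)).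
  move=> mb Lb; apply/eqP; rewrite -subr_eq0 -ExB; [|exact: L2_dotv|exact: L2_dotv].
  rewrite (_ : (fun t => _) = (fun t => \sum_i (V t i ord0 - q t i ord0) * b (R' t) i ord0)).
    rewrite Ex_sum ?big1// => [i _|i]; first exact: E0.
    have := L1B (L2_coordM i i LV Lb) (L2_coordM i i Lq Lb).
    by congr (L1 P _); apply/funext => t; rewrite mulrBl.
  apply/funext => t; rewrite -dotvNr -dotvDr dotvE; apply: eq_bigr => i _.
  by rewrite cVBE mulrC.
have Liq : L2 P (fun t => invmx A *m q t) by exact: L2_lin.
have LqU : L1 P (fun t => dotv (q t) (U t)) by exact: L2_dotv.
have LRV : L1 P (fun t => dotv (R' t) (V t)) by exact: L2_dotv.
have LRq : L1 P (fun t => dotv (R' t) (q t)) by exact: L2_dotv.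
have ERV : Ex P (fun t => dotv (R' t) (V t)) = Ex P (fun t => dotv (R' t) (q t)).
  by apply: (Edot id) => //; exact: measurable_id.
have EiV : Ex P (fun t => dotv (invmx A *m q t) (V t)) = Ex P (fun t => dotv (invmx A *m q t) (q t)).
  by apply: (Edot (fun r => invmx A *m f' r)) => //; exact: measurable_cst_mulmx.
have [bnd eqb] := graph_value_bound pA LY Liq.
have vE : Ex P (fun t => dotv (A *m (invmx A *m q t)) (usubmx (Y t)) +
    dotv (invmx A *m q t) (dsubmx (Y t)) - dotv (invmx A *m q t) (A *m (invmx A *m q t))) =
    Ex P (fun t => dotv (q t) (U t)).
  under eq_fun do rewrite mulKVmx// col_mxKu col_mxKd.
  rewrite ExB; [|by apply: L1D; exact: L2_dotv|exact: L2_dotv].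
  rewrite ExD//; last exact: L2_dotv.
  by rewrite EiV addrK.
rewrite vE in bnd eqb.
pose ell (r : 'cV[R]_m) (y : 'cV[R]_(m + m)) :=
  dotv (f' r) (usubmx y) + dotv r (dsubmx y) - dotv r (f' r).
(* [R'] is replaced by [h (Y)] to obtain a Borel function of [y], which can also be evaluated at
   [Y']. At [Y] it is almost surely the maximum of [ell r (Y)]. *)
pose Psi y := ell (h y) y.
have mell (b : 'cV[R]_(m + m) -> 'cV[R]_m) : measurable_fun setT b ->
    measurable_fun setT (fun y => ell (b y) y).
  move=> mb; have mfb : measurable_fun setT (fun y => f' (b y)) by exact: measurableT_comp.
  have mu_ : measurable_fun setT (@usubmx R m m 1) by exact: measurable_usubmx.
  have md_ : measurable_fun setT (@dsubmx R m m 1) by exact: measurable_dsubmx.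
  by apply: measurable_funB; [apply: measurable_funD|]; exact: measurable_dotv.
have mPsi : measurable_fun setT Psi by exact: mell.
have PsiE : {ae P, forall t, dotv (q t) (U t) + dotv (R' t) (V t) - dotv (R' t) (q t) = Psi (Y t)}.
  by apply: filterS R'h => t e; rewrite /Psi /ell /q e col_mxKu col_mxKd.
have Lraw : L1 P (fun t => dotv (q t) (U t) + dotv (R' t) (V t) - dotv (R' t) (q t)).
  by apply: L1B => //; exact: L1D.
have mPsiY : measurable_fun setT (fun t => Psi (Y t)) by exact: measurableT_comp.
have LPsi : L1 P (fun t => Psi (Y t)) by exact: L1_ae_eq PsiE Lraw.
have EPsi : Ex P (fun t => Psi (Y t)) = Ex P (fun t => dotv (q t) (U t)).
  rewrite -(Ex_ae_eq (L1_measurable Lraw) mPsiY PsiE) ExB//; last exact: L1D.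
  by rewrite ExD// ERV addrK.
have [LPsi' EPsi'] := refl_Ex mPsi LPsi.
have opt : {ae P, forall t, forall r, ell r (Y t) <= Psi (Y t)}.
  apply: filterS2 argmax PsiE => t ha hP r.
  have := ha r; rewrite !insider_gain lerD2r -hP /ell col_mxKu col_mxKd.
  by [].
(* The inequality for all [r] at once is an uncountable intersection. It is transferred to [Y'] only
   along a Borel choice of [r], for which the event is measurable. *)
have optb (b : 'cV[R]_(m + m) -> 'cV[R]_m) : measurable_fun setT b ->
    {ae P, forall t, ell (b (Y t)) (Y t) <= Psi (Y t)} /\
    {ae P, forall t, ell (b (Y' t)) (Y' t) <= Psi (Y' t)}.
  move=> mb; have a1 : {ae P, forall t, ell (b (Y t)) (Y t) <= Psi (Y t)}.
    by apply: filterS opt => t; apply.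
  split => //.
  pose E : set 'cV[R]_(m + m) := [set y | ell (b y) y <= Psi y].
  apply: (@refl_ae E) => //.
  have md : measurable_fun setT (fun y => Psi y - ell (b y) y).
    by apply: measurable_funB => //; exact: mell.
  have := md measurableT _ (measurable_itv `[(0:R), +oo[).
  by rewrite setTI; congr measurable; apply/seteqP; split => y /=; rewrite in_itv/= andbT subr_ge0.
pose k t := 2^-1 * (Psi (Y t) + Psi (Y' t)).
have ellmid r t : ell r (Xv t) = 2^-1 * (ell r (Y t) + ell r (Y' t)).
  have umid (a b : 'cV[R]_(m + m)) : usubmx (2^-1 *: (a + b)) = 2^-1 *: (usubmx a + usubmx b).
    by apply/matrixP => i j; rewrite !mxE.
  have dmid (a b : 'cV[R]_(m + m)) : dsubmx (2^-1 *: (a + b)) = 2^-1 *: (dsubmx a + dsubmx b).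
    by apply/matrixP => i j; rewrite !mxE.
  by rewrite mid /ell umid dmid !dotvZr !dotvDr; field.
(* At [r = R] and [y = X] the two terms containing [f'] cancel, so the unknown rule disappears from
   the lower bound. *)
have ellR t : ell (Rv t) (Xv t) = g0 (Y t).
  by rewrite /ell /gproj col_mxKu col_mxKd [dotv (f' _) _]dotvC addrAC subrr add0r.
have [bY bY'] := optb _ mrproj.
have qk : {ae P, forall t, 0 <= k t - g0 (Y t)}.
  apply: filterS2 bY bY' => t h1 h2; rewrite subr_ge0 -ellR ellmid /k.
  by move: h2; rewrite {1}/Y' rproj_refl//; move: h1; lra.
have Lk : L1 P k by apply: L1Z; exact: L1D.
have Ek : Ex P k = Ex P (fun t => Psi (Y t)).
  rewrite /k ExZ; last exact: L1D.
  by rewrite ExD// EPsi'; field.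
have Lq0 : L1 P (fun t => g0 (Y t)) by exact: L1_graph_value.
have Lkq : L1 P (fun t => k t - g0 (Y t)) by exact: L1B.
have Ekq : Ex P (fun t => k t - g0 (Y t)) = Ex P (fun t => dotv (q t) (U t)) - graph_value A P Y.
  by rewrite ExB// Ek EPsi.
have := Ex_ae_ge0 (L1_measurable Lkq) qk; rewrite Ekq subr_ge0 => le1.
have Ekq0 : Ex P (fun t => k t - g0 (Y t)) = 0.
  by apply/eqP; rewrite Ekq subr_eq0 eq_le le1 bnd.
have ae0 := Ex_ge0_eq0 Lkq qk Ekq0.
have f'A r : f' r = A *m r.
  apply: related_ae.
  have [c1 c2] := optb (fun=> r) (measurable_cst r).
  apply: filterS3 ae0 c1 c2 => t e h1 h2.
  have : ell r (Xv t) <= g0 (Y t).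
    by rewrite ellmid; move: e h1 h2; rewrite /k; lra.
  rewrite /ell /gproj col_mxKu col_mxKd /g0; move: (Rv t) => p.
  rewrite !dotvDl !dotvDr !dotvNl !dotvNr [dotv (f' r) p]dotvC; lra.
split; last by apply/funext.
apply: filterS (eqb le1) => t <-.
by rewrite /q f'A mulKmx.
Qed.

End gaussian_problem.

Unset Implicit Arguments.

Theorem theorem11 (R : realType) (d : measure_display) (T : measurableType d)
    (P : probability T R) (m : nat) (U V : T -> 'cV[R]_m) :
  let Y : T -> 'cV[R]_(m + m) := fun t => col_mx (U t) (V t) in
  let Suu := mom2 P U U in
  let Svv := mom2 P V V in
  let Suv := mom2 P U V in
  let Svu := mom2 P V U in
  L2 P U -> L2 P V ->
  nondeg_centered_gaussian P Y ->
  posdef Suu -> posdef Svv ->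
  let Lam := minvsqrt Suu *m msqrt (msqrt Suu *m Svv *m msqrt Suu)
             *m minvsqrt Suu in
  exists A : 'M[R]_m,
  let Rv : T -> 'cV[R]_m := fun t => invmx (A + A^T) *m (A^T *m U t + V t) in
  let f : 'cV[R]_m -> 'cV[R]_m := fun u => A *m u in
  let X : T -> 'cV[R]_(m + m) := fun t => col_mx (Rv t) (f (Rv t)) in
  [/\
   (* (a) A is the unique positive-definite solution *)
   (posdef A /\ A *m Suu *m A + (A *m Suv - Svu *m A) = Svv) /\
   (forall A' : 'M[R]_m, posdef A' ->
      A' *m Suu *m A' + (A' *m Suv - Svu *m A') = Svv -> A' = A),
   [/\
   (* (b) unique Y-equilibrium *)
   Y_equilibrium P U V Rv f /\
   (forall (R' : T -> 'cV[R]_m) (f' : 'cV[R]_m -> 'cV[R]_m),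
      Y_equilibrium P U V R' f' ->
      {ae P, forall t, R' t = Rv t} /\ f' = f),
   (* (b) X = (R, f(R)) is the unique optimal map *)
   optimal_map P Y X /\
   (forall X' : T -> 'cV[R]_(m + m), optimal_map P Y X' ->
      {ae P, forall t, X' t = X t}),
   (* (b) Law(X, Y) is the unique optimal plan *)
   (exists gam0 : probability ('cV[R]_(m + m) * 'cV[R]_(m + m))%type R,
      [/\ forall E, measurable E ->
            gam0 E = P ((fun t => (X t, Y t)) @^-1` E),
          optimal_plan P Y gam0 &
          forall gam : probability ('cV[R]_(m + m) * 'cV[R]_(m + m))%type R,
            optimal_plan P Y gam -> forall E, measurable E -> gam E = gam0 E]) &
   (* (b) graph f is the unique optimal set of the dual problem *)
   optimal_set P Y (graph f) /\
   (forall G : set 'cV[R]_(m + m), optimal_set P Y G -> G = graph f)] &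
   (* (c) *)
   [/\ posdef Lam /\ Lam *m Suu *m Lam = Svv,
       (forall L : 'M[R]_m, posdef L -> L *m Suu *m L = Svv -> L = Lam),
       (A^T = A <-> Lam *m Suv = Svu *m Lam),
       (Lam *m Suv = Svu *m Lam <-> (Lam *m Suv)^T = Lam *m Suv) &
       (A^T = A ->
          A = Lam /\ forall t, Rv t = 2^-1 *: (U t + invmx Lam *m V t))]].
Proof.
move=> Y Suu Svv Suv Svu LU LV gY pSuu pSvv Lam.
have sSuu : Suu^T = Suu by exact: mom2_tr.
have sSvv : Svv^T = Svv by exact: mom2_tr.
have vuE : Suv^T = Svu by exact: mom2_tr.
have [A [pA eqA]] : exists A : 'M[R]_m, posdef A /\
    A *m Suu *m A + (A *m Suv - Svu *m A) = Svv.
  rewrite -vuE; apply: riccati_exists.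
    by rewrite tr_block_mx sSuu sSvv trmxK.
  by have := gY.1; rewrite mom2_col -(mom2_tr P U V).
have uniqA A' : posdef A' -> A' *m Suu *m A' + (A' *m Suv - Svu *m A') = Svv -> A' = A.
  move=> pA' eqA'.
  have oA' := optimal_set_graph LU LV gY pA' eqA'.
  have e := optimal_set_uniq LU LV gY pA eqA oA'.
  have E (r : 'cV[R]_m) : A' *m r = A *m r.
    have : graph (fun u => A' *m u) (col_mx r (A' *m r)) by exists r.
    by rewrite e => -[u _ /eq_col_mx[-> ->]].
  apply/matrixP => i j; have := congr1 (fun c : 'cV[R]_m => c i ord0) (E (delta_mx j ord0)).
  by rewrite -!colE !mxE.
have [sL pL eL] := congr_rootP sSuu pSuu sSvv pSvv.
rewrite -[congr_root _ _]/Lam in sL pL eL.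
have uniqL L : posdef L -> L *m Suu *m L = Svv -> L = Lam.
  by move=> pL' eL'; exact: (congr_eq_uniq sSuu pSuu pL' pL eL' eL).
have symA : A^T = A -> A = Lam /\ Lam *m Suv = Svu *m Lam.
  move=> sA.
  (* For symmetric [A], transposing the equation reverses the sign of the antisymmetric bracket,
     which must therefore vanish. *)
  have e2 : A *m Suu *m A + (Svu *m A - A *m Suv) = Svv.
    rewrite -[RHS]sSvv -eqA !(linearD, linearB, linearN)/= !trmx_mul sSuu sA.
    by rewrite -vuE trmxK !mulmxA.
  have e0 : A *m Suv - Svu *m A = 0.
    have : A *m Suv - Svu *m A = Svu *m A - A *m Suv.
      by apply: (addrI (A *m Suu *m A)); rewrite eqA e2.
    move=> h; have : (A *m Suv - Svu *m A) *+ 2 = 0 by rewrite mulr2n {1}h addrA subrK subrr.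
    by rewrite -scaler_nat => /eqP; rewrite scaler_eq0 pnatr_eq0 => /eqP.
  have AL : A = Lam by apply: uniqL => //; rewrite -[LHS]addr0 -e0.
  split => //; rewrite -AL; apply/eqP; rewrite -subr_eq0; exact/eqP.
have RvE : (fun t => invmx (A + A^T) *m (A^T *m U t + V t)) = (fun t => rproj A (Y t)).
  by apply/funext => t; rewrite rproj_col.
exists A; cbv beta zeta; rewrite RvE.
have XE : (fun t => col_mx (invmx (A + A^T) *m (A^T *m U t + V t))
    (A *m (invmx (A + A^T) *m (A^T *m U t + V t)))) = (fun t => gproj A (Y t)).
  by apply/funext => t; rewrite -rproj_col.
rewrite XE.
have XYE : (fun t => (col_mx (invmx (A + A^T) *m (A^T *m U t + V t))
    (A *m (invmx (A + A^T) *m (A^T *m U t + V t))), Y t)) = (fun t => (gproj A (Y t), Y t)).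
  by apply/funext => t; rewrite -rproj_col.
rewrite XYE.
split.
- by [].
- split.
  + split; first exact: equilibrium_rproj.
    move=> R' f' /(equilibrium_uniq LU LV gY pA eqA)[h ->]; split => //.
    by apply: filterS h => t ->; rewrite rproj_col.
  + split; first exact: optimal_map_gproj.
    move=> X' /(optimal_map_uniq LU LV gY pA eqA); apply: filterS => t ->.
    by rewrite -rproj_col.
  + exact: (optimal_plan_gproj LU LV gY pA eqA).
  + split; first exact: optimal_set_graph.
    by move=> G; exact: optimal_set_uniq.
- split => //.
  + split => [/symA[]//|h].
    (* If the bracket vanishes at [Lam], then [Lam] solves the equation of (a), and uniqueness there
       identifies it with [A]. *)
    suff -> : A = Lam by exact: sL.
    by apply/esym/uniqA => //; rewrite h subrr addr0.
  + by rewrite trmx_mul sL vuE; split => ->.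
  + move=> sA; have [AL _] := symA sA; split => // t.
    rewrite sA -mulr2n -AL.
    have uA := posdef_unitmx pA.
    have -> : invmx (A *+ 2) = 2^-1 *: invmx A.
      have u2 : (2 : R) \is a GRing.unit by rewrite unitfE pnatr_eq0.
      by rewrite -scaler_nat invmxZ// unitmxZ.
    by rewrite -scalemxAl mulmxDr mulKmx.
Qed.
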